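(* Let $(M,\mathrm{g}_M)$ and $(N,\mathrm{g}_N)$ be smooth connected Riemannian manifolds without boundary. Let $M$ be compact of dimension $m=\dim M\ge 2$, let $N$ be of dimension at most $\frac m2$, and assume that the sectional curvatures satisfy $\sec_N\le\sigma\le\sec_M$ for some $\sigma>0$. Let $f:M\to N$ be a smooth minimal map. Let $\mathrm{g}=\mathrm{g}_M+f^*\mathrm{g}_N$, let $\mathrm{s}=\mathrm{g}_M-f^*\mathrm{g}_N$, and let $\operatorname{tr}(\mathrm{s})$ be the trace of $\mathrm{s}$ with respect to $\mathrm{g}$. Assume there is a finite constant $\kappa$ with $$\kappa^2>1\qquad\text{and}\qquad f^*\mathrm{g}_N<\kappa^2\,\mathrm{g}_M$$ such that the second fundamental tensor $\mathrm{A}$ of the graph $\Gamma(f)$ satisfies $$\|\mathrm{A}\|^2\le\frac{\kappa^2\sigma}{\kappa^4-1}\operatorname{tr}(\mathrm{s})\quad\text{on } M.$$ Then $f$ is a constant map.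
   Context: For a smooth map $f:M\to N$ between Riemannian manifolds, the graph is $\Gamma(f)=\{(x,f(x)):x\in M\}\subset M\times N$, the image of the embedding $F:M\to M\times N$, $F(x)=(x,f(x))$. The product $M\times N$ carries the product metric $\mathrm{g}_{M\times N}=\mathrm{g}_M\times\mathrm{g}_N$. The map $f$ is called minimal if $\Gamma(f)$ is a minimal submanifold of $(M\times N,\mathrm{g}_{M\times N})$, i.e. its mean curvature vector (the trace of $\mathrm{A}$ with respect to $\mathrm{g}$) vanishes identically. The induced metric on $M$ is $\mathrm{g}=F^*\mathrm{g}_{M\times N}=\mathrm{g}_M+f^*\mathrm{g}_N$, with Levi-Civita connection $\nabla$. For a local $\mathrm{g}$-orthonormal frame $\{e_1,\dots,e_m\}$ of $TM$, one sets $\operatorname{tr}(\mathrm{s})=\sum_{k=1}^m\mathrm{s}(e_k,e_k)$. The second fundamental tensor of the graph is $\mathrm{A}(v,w)=\nabla^{\mathrm{g}_{M\times N}}_{\mathrm{d}F(v)}\mathrm{d}F(w)-\mathrm{d}F(\nabla_v w)$, where $\nabla^{\mathrm{g}_{M\times N}}$ is the Levi-Civita connection of $\mathrm{g}_{M\times N}$; its norm is $\|\mathrm{A}\|^2=\sum_{i,j=1}^m\mathrm{g}_{M\times N}(\mathrm{A}(e_i,e_j),\mathrm{A}(e_i,e_j))$. The inequality $f^*\mathrm{g}_N<\kappa^2\mathrm{g}_M$ means that $\kappa^2\mathrm{g}_M-f^*\mathrm{g}_N$ is positive definite at every point of $M$. Curvature inequalities are required for all tangent $2$-planes (and are vacuous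 if the manifold is one-dimensional). *)

(* Defs.v *)
From HB Require Import structures.
From mathcomp Require Import all_boot all_order all_algebra.
From mathcomp Require Import all_classical all_reals all_analysis.

Set Implicit Arguments.
Unset Strict Implicit.
Unset Printing Implicit Defensive.

Import Order.TTheory GRing.Theory Num.Theory.
Import numFieldNormedType.Exports.

Local Open Scope classical_set_scope.
Local Open Scope ring_scope.

Definition iter_derive (R : realType) (n : nat) (W : normedModType R)
    (vs : seq 'rV[R]_n) (h : 'rV[R]_n -> W) : 'rV[R]_n -> W :=
  foldr (fun v k x => 'D_v k x) h vs.

(* C^infinity; only used for open U.  The values of h outside U are irrelevant. *)
Definition smooth_on (R : realType) (n : nat) (W : normedModType R)
    (U : set 'rV[R]_n) (h : 'rV[R]_n -> W) : Prop :=
  forall (vs : seq 'rV[R]_n) (x : 'rV[R]_n), U x ->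
    {for x, continuous (iter_derive vs h)} /\
    (forall v : 'rV[R]_n, derivable (iter_derive vs h) x v).

Definition bform (R : realType) (n : nat) (G : 'M[R]_n) (u v : 'rV[R]_n) : R :=
  (u *m G *m v^T) 0 0.

Definition posdef (R : realType) (n : nat) (G : 'M[R]_n) : Prop :=
  forall v : 'rV[R]_n, v != 0 -> 0 < bform G v v.

Definition basisv (R : realType) (n : nat) (i : 'I_n) : 'rV[R]_n :=
  delta_mx 0 i.

Definition pullback (R : realType) (m n : nat) (h : 'rV[R]_m -> 'rV[R]_n)
    (g : 'rV[R]_n -> 'M[R]_n) (x : 'rV[R]_m) : 'M[R]_m :=
  \matrix_(i, j) bform (g (h x)) ('D_(basisv R i) h x) ('D_(basisv R j) h x).

(** Riemannian geometry of a metric g on an open subset of R^n; tangent vectors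
    and vector fields are given by their components in the standard frame. *)

(* Christoffel symbols as a bilinear map: g(Gamma(u, v), w) is given by the
   Koszul formula for the (commuting) constant fields u, v, w. *)
Definition christoffel (R : realType) (n : nat) (g : 'rV[R]_n -> 'M[R]_n)
    (x u v : 'rV[R]_n) : 'rV[R]_n :=
  (\row_k (2^-1 * ('D_u (fun y => bform (g y) v (basisv R k)) x
                 + 'D_v (fun y => bform (g y) u (basisv R k)) x
                 - 'D_(basisv R k) (fun y => bform (g y) u v) x)))
  *m invmx (g x).

Definition levi_civita (R : realType) (n : nat) (g : 'rV[R]_n -> 'M[R]_n)
    (X Y : 'rV[R]_n -> 'rV[R]_n) (x : 'rV[R]_n) : 'rV[R]_n :=
  'D_(X x) Y x + christoffel g x (X x) (Y x).

(* The Levi-Civita connection of G along a map F: covariant derivative, in the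
   direction dF(v), of a field W along F (W x is tangent at F x). *)
Definition levi_civita_along (R : realType) (m k : nat) (G : 'rV[R]_k -> 'M[R]_k)
    (F : 'rV[R]_m -> 'rV[R]_k) (v : 'rV[R]_m) (W : 'rV[R]_m -> 'rV[R]_k)
    (x : 'rV[R]_m) : 'rV[R]_k :=
  'D_v W x + christoffel G (F x) ('D_v F x) (W x).

Definition lie_bracket (R : realType) (n : nat)
    (X Y : 'rV[R]_n -> 'rV[R]_n) (x : 'rV[R]_n) : 'rV[R]_n :=
  'D_(X x) Y x - 'D_(Y x) X x.

Definition riemann (R : realType) (n : nat) (g : 'rV[R]_n -> 'M[R]_n)
    (X Y Z : 'rV[R]_n -> 'rV[R]_n) (x : 'rV[R]_n) : 'rV[R]_n :=
  levi_civita g X (levi_civita g Y Z) x - levi_civita g Y (levi_civita g X Z) x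
  - levi_civita g (lie_bracket X Y) Z x.

(* u and v are extended to constant fields, which is harmless because the
   curvature is tensorial. *)
Definition sectional (R : realType) (n : nat) (g : 'rV[R]_n -> 'M[R]_n)
    (x u v : 'rV[R]_n) : R :=
  bform (g x) (riemann g (cst u) (cst v) (cst v) x) u
  / (bform (g x) u u * bform (g x) v v - bform (g x) u v ^+ 2).

(* The traces below are written with respect to an arbitrary frame e, to be taken
   orthonormal for graph_metric; they do not depend on the choice of e.  All the
   quantities are tensorial, so a basis at the point x is enough. *)
Definition orthonormal_frame (R : realType) (n : nat) (G : 'M[R]_n)
    (e : 'I_n -> 'rV[R]_n) : Prop :=
  forall i j : 'I_n, bform G (e i) (e j) = (i == j)%:R.

(** Graph of a map h between open subsets of R^m and R^n carrying metrics gM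
    and gN. *)

Definition graph_map (R : realType) (m n : nat) (h : 'rV[R]_m -> 'rV[R]_n)
    (x : 'rV[R]_m) : 'rV[R]_(m + n) := row_mx x (h x).

Definition prod_metric (R : realType) (m n : nat) (gM : 'rV[R]_m -> 'M[R]_m)
    (gN : 'rV[R]_n -> 'M[R]_n) (z : 'rV[R]_(m + n)) : 'M[R]_(m + n) :=
  block_mx (gM (lsubmx z)) 0 0 (gN (rsubmx z)).

Definition graph_metric (R : realType) (m n : nat) (gM : 'rV[R]_m -> 'M[R]_m)
    (gN : 'rV[R]_n -> 'M[R]_n) (h : 'rV[R]_m -> 'rV[R]_n) (x : 'rV[R]_m) :
    'M[R]_m := gM x + pullback h gN x.

Definition s_tensor (R : realType) (m n : nat) (gM : 'rV[R]_m -> 'M[R]_m)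
    (gN : 'rV[R]_n -> 'M[R]_n) (h : 'rV[R]_m -> 'rV[R]_n) (x : 'rV[R]_m) :
    'M[R]_m := gM x - pullback h gN x.

(* A(v, w), with w extended to a constant field (A is tensorial). *)
Definition second_fund (R : realType) (m n : nat) (gM : 'rV[R]_m -> 'M[R]_m)
    (gN : 'rV[R]_n -> 'M[R]_n) (h : 'rV[R]_m -> 'rV[R]_n)
    (x v w : 'rV[R]_m) : 'rV[R]_(m + n) :=
  let F := graph_map h in
  levi_civita_along (prod_metric gM gN) F v (fun y => 'D_w F y) x
  - 'D_(levi_civita (graph_metric gM gN h) (cst v) (cst w) x) F x.

Definition mean_curvature (R : realType) (m n : nat)
    (gM : 'rV[R]_m -> 'M[R]_m) (gN : 'rV[R]_n -> 'M[R]_n)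
    (h : 'rV[R]_m -> 'rV[R]_n) (x : 'rV[R]_m) (e : 'I_m -> 'rV[R]_m) :
    'rV[R]_(m + n) := \sum_k second_fund gM gN h x (e k) (e k).

Definition second_fund_norm2 (R : realType) (m n : nat)
    (gM : 'rV[R]_m -> 'M[R]_m) (gN : 'rV[R]_n -> 'M[R]_n)
    (h : 'rV[R]_m -> 'rV[R]_n) (x : 'rV[R]_m) (e : 'I_m -> 'rV[R]_m) : R :=
  \sum_i \sum_j bform (prod_metric gM gN (graph_map h x))
    (second_fund gM gN h x (e i) (e j)) (second_fund gM gN h x (e i) (e j)).

Definition tr_s (R : realType) (m n : nat) (gM : 'rV[R]_m -> 'M[R]_m)
    (gN : 'rV[R]_n -> 'M[R]_n) (h : 'rV[R]_m -> 'rV[R]_n) (x : 'rV[R]_m)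
    (e : 'I_m -> 'rV[R]_m) : R :=
  \sum_k bform (s_tensor gM gN h x) (e k) (e k).

(** Charts are onto open subsets of R^n: manifolds have no boundary. *)

(* chart_fun and chart_inv are total functions, meaningful only on chart_dom
   and chart_cod respectively. *)
Record chart (R : realType) (n : nat) (T : topologicalType) := Chart {
  chart_dom : set T;
  chart_cod : set 'rV[R]_n;
  chart_fun : T -> 'rV[R]_n;
  chart_inv : 'rV[R]_n -> T;
  chart_dom_open : open chart_dom;
  chart_cod_open : open chart_cod;
  chart_funP : forall p, chart_dom p ->
    chart_cod (chart_fun p) /\ chart_inv (chart_fun p) = p;
  chart_invP : forall x, chart_cod x ->
    chart_dom (chart_inv x) /\ chart_fun (chart_inv x) = x;
  chart_fun_continuous : {within chart_dom, continuous chart_fun};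
  chart_inv_continuous : {within chart_cod, continuous chart_inv} }.

(* Expression of f : S -> T in the charts c, d, and its domain. *)
Definition loc_dom (R : realType) (m n : nat) (S T : topologicalType)
    (f : S -> T) (c : chart R m S) (d : chart R n T) : set 'rV[R]_m :=
  [set x | chart_cod c x /\ chart_dom d (f (chart_inv c x))].

Definition loc_rep (R : realType) (m n : nat) (S T : topologicalType)
    (f : S -> T) (c : chart R m S) (d : chart R n T) : 'rV[R]_m -> 'rV[R]_n :=
  fun x => chart_fun d (f (chart_inv c x)).

Record manifold (R : realType) (n : nat) := Manifold {
  man_space :> topologicalType;
  man_hausdorff : hausdorff_space man_space;
  man_second_countable : @second_countable man_space;
  atlas : set (chart R n man_space);
  atlas_cover : forall p : man_space, exists2 c, atlas c & chart_dom c p;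
  atlas_smooth : forall c d, atlas c -> atlas d ->
    smooth_on (loc_dom idfun c d) (loc_rep idfun c d) }.

(* The metric is the (0,2)-tensor field with components metric c x at the point
   of coordinates x in the chart c. *)
Record riemannian (R : realType) (n : nat) := Riemannian {
  riem_manifold :> manifold R n;
  metric : chart R n riem_manifold -> 'rV[R]_n -> 'M[R]_n;
  metric_smooth : forall c, atlas c -> smooth_on (chart_cod c) (metric c);
  metric_sym : forall c x, atlas c -> chart_cod c x ->
    (metric c x)^T = metric c x;
  metric_posdef : forall c x, atlas c -> chart_cod c x -> posdef (metric c x);
  metric_change : forall c d x, atlas c -> atlas d -> loc_dom idfun c d x ->
    metric c x = pullback (loc_rep idfun c d) (metric d) x }.

(* Linearly independent u, v span a tangent 2-plane. *)
Definition sec_le (R : realType) (n : nat) (N : riemannian R n) (sigma : R) :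
    Prop :=
  forall (c : chart R n N) (x u v : 'rV[R]_n), atlas c -> chart_cod c x ->
    row_free (col_mx u v) -> sectional (metric c) x u v <= sigma.

Definition sec_ge (R : realType) (n : nat) (M : riemannian R n) (sigma : R) :
    Prop :=
  forall (c : chart R n M) (x u v : 'rV[R]_n), atlas c -> chart_cod c x ->
    row_free (col_mx u v) -> sigma <= sectional (metric c) x u v.

Definition smooth_map (R : realType) (m n : nat) (M : manifold R m)
    (N : manifold R n) (f : M -> N) : Prop :=
  continuous f /\
  (forall (c : chart R m M) (d : chart R n N), atlas c -> atlas d ->
    smooth_on (loc_dom f c d) (loc_rep f c d)).

(* P holds for the expressions gM, gN, h of the two metrics and of f in any
   pair of charts, at any point x of the domain. *)
Definition in_charts (R : realType) (m n : nat) (M : riemannian R m)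
    (N : riemannian R n) (f : M -> N)
    (P : ('rV[R]_m -> 'M[R]_m) -> ('rV[R]_n -> 'M[R]_n) ->
         ('rV[R]_m -> 'rV[R]_n) -> 'rV[R]_m -> Prop) : Prop :=
  forall (c : chart R m M) (d : chart R n N) (x : 'rV[R]_m),
    atlas c -> atlas d -> loc_dom f c d x ->
    P (metric c) (metric d) (loc_rep f c d) x.

Definition minimal_map (R : realType) (m n : nat) (M : riemannian R m)
    (N : riemannian R n) (f : M -> N) : Prop :=
  in_charts f (fun gM gN h x => forall e : 'I_m -> 'rV[R]_m,
    orthonormal_frame (graph_metric gM gN h x) e ->
    mean_curvature gM gN h x e = 0).

(* Main.v *)
(** Let c be the infimum of the t such that t g_M - f^* g_N is positive definite
    everywhere, i.e. the maximum over the compact M of the squared operator norm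
    of df.  At some point a vector v with g_M(v, v) = 1 is null for the
    semidefinite form Q = c g_M - f^* g_N.

    The second-derivative test for Q along a straight line in a chart, in the
    direction e and with v corrected by the Christoffel symbols of the graph
    metric g, gives an inequality at that point.  Summed over a g-orthonormal
    frame (e_k), minimality kills the trace of nabla A up to curvature (Codazzi)
    and one finds
      0 <= sum_k (c |A_M(e_k, v)|^2 - |A_N(e_k, v)|^2) + curvature terms,
    where A_M, A_N are the components of A.  The curvature bounds make the second
    term at most - sigma c (tr s + (c - 1) / (1 + c)); as A is normal,
    |A_M|^2 <= c |A_N|^2, so the first one is at most (c - 1) sum_k |A(e_k, v)|^2.
    If c > 1 this contradicts the bound on |A|^2; if 0 < c <= 1 the frame may be
    taken with one vector along v and one in ker df (which is non-trivial since
    n < m), and then tr s + (c - 1) / (1 + c) >= 1.  Hence c = 0 and df = 0. *)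

Require Import Defs.
From HB Require Import structures.
From mathcomp Require Import all_boot all_order all_algebra.
From mathcomp Require Import all_classical all_reals all_analysis.
From mathcomp Require Import ring lra.
Import Order.TTheory GRing.Theory Num.Theory.
Import numFieldNormedType.Exports.
Local Open Scope classical_set_scope.
Local Open Scope ring_scope.

Set Implicit Arguments.
Unset Strict Implicit.
Unset Printing Implicit Defensive.

(** * Calculus on R^n *)

(** No parallel extension of v is needed. With C the Christoffel symbols of g, v - t C(e, v) is
    correct to first order only; the second-order error enters as dF(Z), with the same vector Z for
    both components F = id and F = h of the graph map, and v, being null for the semidefinite form
    Q, is Q-orthogonal to every Z. So id and h go through one computation with a common C, and only
    the difference of the results, the first one weighted by c, is used.

    After Codazzi the terms A(C(e_k, e_k), v) remain, which have no sign. They cancel in the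
    weighted difference by the first-derivative condition in the direction C(e_k, e_k).

    The constants: g(v, v) = 1 + c, whence sum_k |A(e_k, v)|^2 <= (1 + c) |A|^2, and s takes the
    value -(c - 1)/(1 + c) on the g-unit vector along v. For c > 1 the estimate closes if |A|^2 <=
    sigma c/(c^2 - 1) tr s; the factor c/(c^2 - 1) decreases in c, and at c = kappa^2 it is the
    assumed kappa^2/(kappa^4 - 1). The assumption is not strict: the contradiction rests on the
    extra term (c - 1)/(1 + c) > 0. *)

Lemma is_derive_mxP (R : realType) (V : normedModType R) (m n : nat)
    (f : V -> 'M[R]_(m, n)) (x v : V) (df : 'M[R]_(m, n)) :
  is_derive x v f df <-> forall i j, is_derive x v (fun y => f y i j) (df i j).
Proof.
split=> [[fx <-] i j|fx].
  by split; [exact: (derivable_mxP _ _ _).1 | rewrite derive_mx// mxE].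
have dfx : derivable f x v by apply: (derivable_mxP _ _ _).2 => i j; case: (fx i j).
split=> //; rewrite derive_mx//; apply/matrixP => i j; rewrite mxE.
by case: (fx i j).
Qed.

Lemma differentiable_mxP (R : realType) (V : normedModType R) (m n : nat)
    (f : V -> 'M[R]_(m, n)) (x : V) :
  differentiable f x <-> forall i j, differentiable (fun y => f y i j) x.
Proof.
split=> [fx i j|fx].
  by apply: (differentiable_comp (g := fun M : 'M[R]_(m, n) => M i j)) => //;
    exact: differentiable_coord.
have -> : f = \sum_i \sum_j (fun y => f y i j *: delta_mx i j).
  apply/funext => y; rewrite fct_sumE [LHS]matrix_sum_delta.
  by apply: eq_bigr => i _; rewrite fct_sumE.
by do 2!apply: differentiable_sum => ?; apply: differentiableZl.
Qed.

Lemma derivative_along_line (R : realType) (n : nat) (f : 'rV[R]_n -> R)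
    (x e : 'rV[R]_n) (t : R) : derivable f (t *: e + x) e ->
  is_derive t 1 (fun s => f (s *: e + x)) ('D_e f (t *: e + x)).
Proof.
move=> fx.
have E : (fun h : R => h^-1 *: (((fun s => f (s *: e + x)) \o shift t) (h *: 1)
           - f (t *: e + x))) =
         (fun h : R => h^-1 *: ((f \o shift (t *: e + x)) (h *: e)
           - f (t *: e + x))).
  by apply/funext => h /=; rewrite [h *: 1]mulr1 scalerDl addrA.
by split; [rewrite /derivable E | rewrite /derive E].
Qed.

(** Bounding the intermediate point by the absolute value of [t] gives one statement for both signs
    of [t]. *)
Lemma mean_value_line (R : realType) (n : nat) (f : 'rV[R]_n -> R)
    (x e : 'rV[R]_n) (t : R) :
  (forall s : R, `|s| <= `|t| -> derivable f (s *: e + x) e) ->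
  exists2 s : R, `|s| <= `|t| & f (t *: e + x) - f x = t * 'D_e f (s *: e + x).
Proof.
move=> fd.
have main (a b : R) : a <= b -> (forall s, a <= s <= b -> `|s| <= `|t|) ->
    exists2 s, `|s| <= `|t| &
      f (b *: e + x) - f (a *: e + x) = 'D_e f (s *: e + x) * (b - a).
  move=> ab abt.
  have [s|s|s] := @MVT_segment R (fun s => f (s *: e + x))
    (fun s => 'D_e f (s *: e + x)) a b ab.
  - rewrite in_itv/= => /andP[/ltW as_ /ltW sb]; apply: derivative_along_line.
    by apply: fd; apply: abt; rewrite as_.
  - apply: derivable_within_continuous => s' /[!in_itv]/= s'ab.
    by case: (derivative_along_line (fd _ (abt _ s'ab))).
  by rewrite in_itv/= => sab Es; exists s; [exact: abt|].
have [t0|t0] := leP 0 t.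
  have [s|s st] := main 0 t t0.
    by move=> /andP[s0 st]; rewrite !ger0_norm.
  by rewrite scale0r add0r subr0 mulrC => Es; exists s.
have [s|s st] := main t 0 (ltW t0).
  by move=> /andP[s0 st]; rewrite !ler0_norm ?lerN2// ltW.
rewrite scale0r add0r sub0r mulrN mulrC => Es; exists s => //.
by rewrite -[RHS]opprK -Es opprB.
Qed.

Lemma rV_norm_le (R : realType) (n : nat) (v : 'rV[R]_n) (r : R) :
  0 <= r -> (forall i, `|v 0 i| <= r) -> `|v| <= r.
Proof.
move=> r0 vr; rewrite [leLHS]/Num.Def.normr/= mx_normrE.
by apply: bigmax_le => // -[i j] _ /=; rewrite ord1.
Qed.

Lemma rV_norm_ge (R : realType) (n : nat) (v : 'rV[R]_n) (i : 'I_n) :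
  `|v 0 i| <= `|v|.
Proof.
rewrite [leRHS]/Num.Def.normr/= mx_normrE.
exact: (le_bigmax _ (fun k => `|v k.1 k.2|) (0, i)).
Qed.

Lemma rV_basis_sum (R : realType) (n : nat) (v : 'rV[R]_n) :
  v = \sum_i v 0 i *: basisv R i.
Proof. by rewrite [LHS]row_sum_delta. Qed.

(* [trunc_row h k], k = 0, ..., n, is a path from 0 to h along the coordinate axes. *)
Definition trunc_row (R : realType) (n : nat) (h : 'rV[R]_n) (k : nat) : 'rV[R]_n :=
  \row_i (if (i < k)%N then h 0 i else 0).

Lemma trunc_rowS (R : realType) (n : nat) (h : 'rV[R]_n) (k : 'I_n) :
  trunc_row h k.+1 = h 0 k *: basisv R k + trunc_row h k.
Proof.
apply/rowP => i; rewrite !mxE /= ltnS leq_eqVlt -val_eqE /=.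
by case: eqVneq => [/val_inj ->|_]; rewrite /= ?ltnn ?mulr1 ?addr0// mulr0 add0r.
Qed.

(** The increment of [f] is split along the coordinate path [trunc_row h]. On each leg the mean
    value theorem gives a partial derivative at a nearby point, which continuity compares with the
    one at [x]. *)
Lemma C1_differentiable (R : realType) (n : nat) (f : 'rV[R]_n -> R)
    (x : 'rV[R]_n) :
  (\forall y \near x, forall i, derivable f y (basisv R i)) ->
  (forall i, {for x, continuous ('D_(basisv R i) f)}) ->
  differentiable f x.
Proof.
move=> fd fc.
pose df := fun (h : 'rV[R]_n) => (\sum_i h 0 i * 'D_(basisv R i) f x : R).
have df_lin : linear df.
  move=> a u v; rewrite /df scaler_sumr -big_split; apply: eq_bigr => i _.
  by rewrite !mxE /= mulrDl -mulrA.
have df_cont : continuous df.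
    move=> h; apply: differentiable_continuous.
    have -> : df = \sum_i (fun u : 'rV[R]_n => u 0 i * 'D_(basisv R i) f x : R).
      by apply/funext => u; rewrite fct_sumE.
    apply: differentiable_sum => i.
    apply: (@differentiableM R _ (fun h : 'rV[R]_n => h 0 i : R)) => //.
    exact: differentiable_coord.
  pose Df := HB.pack df (GRing.isLinear.Build _ _ _ _ df df_lin) : {linear 'rV[R]_n -> R}.
  have Df_cont : continuous Df by exact: df_cont.
  have fE : f \o shift x = cst (f x) + Df +o_ (0 : 'rV[R]_n) id.
  apply/eqaddoP => e e0.
  (* Each of the [n] legs costs at most [e'] times the norm of [h]; dividing by [n.+1] also covers
     [n = 0]. *)
  pose e' := e / n.+1%:R.
  have e'0 : 0 < e' by rewrite divr_gt0.
  have /nbhs_ballP[d /= d0 dP] : \forall y \near x, forall i,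
      derivable f y (basisv R i) /\ `|'D_(basisv R i) f y - 'D_(basisv R i) f x| <= e'.
    apply: (@filter_forall _ _ (fun i y => derivable f y (basisv R i) /\
      `|'D_(basisv R i) f y - 'D_(basisv R i) f x| <= e') (nbhs x) _) => i.
    near=> y; split; first by near: y; apply: filterS fd.
    rewrite distrC; near: y; have /cvgrPdist_le := fc i; exact.
  suff : \forall h \near (0 : 'rV[R]_n), `|h| < d ->
      `|(f \o shift x - (cst (f x) + df)) h| <= e * `|h|.
    by apply: filter_app; near=> h; apply; near: h; exact: (@nbhs0_lt R ('rV[R]_n) d d0).
  near=> h => hd.
  have near_h y : `|y - x| <= `|h| -> forall i, derivable f y (basisv R i) /\
      `|'D_(basisv R i) f y - 'D_(basisv R i) f x| <= e'.
    by move=> yh; apply: dP; rewrite -ball_normE/= distrC (le_lt_trans yh).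
  have stp (k : 'I_n) :
      `|f (trunc_row h k.+1 + x) - f (trunc_row h k + x)
        - h 0 k * 'D_(basisv R k) f x| <= e' * `|h|.
    have inh s : `|s| <= `|h 0 k| ->
        `|s *: basisv R k + (trunc_row h k + x) - x| <= `|h|.
      move=> sh; rewrite addrA addrK; apply: rV_norm_le => // i; rewrite !mxE /=.
      case: eqVneq => [->|ik]; rewrite ?ltnn ?mulr1 ?addr0.
        by rewrite (le_trans sh)// rV_norm_ge.
      by rewrite mulr0 add0r; case: ifP => // _; rewrite ?normr0 // rV_norm_ge.
    rewrite trunc_rowS -(addrA _ (trunc_row h k) x).
    have [s|s sh ->] := @mean_value_line R n f (trunc_row h k + x) (basisv R k) (h 0 k).
      by move=> sh; apply: (near_h _ (inh _ sh) k).1.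
    rewrite -mulrBr normrM mulrC ler_pM ?rV_norm_ge//.
    by have [] := near_h _ (inh _ sh) k.
  have -> : (f \o shift x - (cst (f x) + df)) h =
     \sum_(k < n) (f (trunc_row h k.+1 + x) - f (trunc_row h k + x)
        - h 0 k * 'D_(basisv R k) f x).
    rewrite sumrB -(big_mkord xpredT (fun k => f (trunc_row h k.+1 + x) - f (trunc_row h k + x))).
    rewrite telescope_sumr// /= -[RHS]addrA -opprD.
    congr (f (_ + _) - (f _ + _)).
      by apply/rowP => i; rewrite !mxE ltn_ord.
    by apply/rowP => i; rewrite !mxE add0r.
  apply: le_trans (ler_norm_sum _ _ _) _.
  apply: (@le_trans _ _ (\sum_(k < n) e' * `|h|)).
    by apply: ler_sum => k _; exact: stp.
  rewrite sumr_const card_ord -mulrnAl ler_wpM2r// /e' -mulr_natr -mulrA.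
  by rewrite ler_piMr ?(ltW e0)// mulrC ler_pdivrMr// mul1r ler_nat.
apply/diff_locallyP; rewrite (diff_unique Df_cont fE); split => //.
Unshelve. all: by end_near. Qed.

Lemma is_derive_translate (R : realType) (V W : normedModType R) (f : V -> W)
    (z x v : V) : derivable f (z + x) v ->
  is_derive x v (fun y => f (z + y)) ('D_v f (z + x)).
Proof.
move=> fx.
have E : (fun h : R => h^-1 *: (((fun y => f (z + y)) \o shift x) (h *: v)
           - f (z + x))) =
         (fun h : R => h^-1 *: ((f \o shift (z + x)) (h *: v) - f (z + x))).
  by apply/funext => h /=; rewrite addrCA.
by split; [rewrite /derivable E | rewrite /derive E].
Qed.

(** * Symmetry of second derivatives *)

Section schwarz.
Context {R : realType} {n : nat}.
Implicit Types (f : 'rV[R]_n -> R) (u v x : 'rV[R]_n).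

Let second_difference f u v x (s : R) : R :=
  f (s *: v + (s *: u + x)) - f (s *: v + x) - (f (s *: u + x) - f x).

Let second_differenceC f u v x s :
  second_difference f u v x s = second_difference f v u x s.
Proof.
rewrite /second_difference addrCA !opprB; lra.
Qed.

(** Two mean value theorems: for y |-> f (s v + y) - f y in the direction [u], then for ['D_u f] in
    the direction [v]. The second difference is thus s^2 times a value of ['D_v ('D_u f)] near
    [x]. *)
Let second_difference_derive f u v x (e : R) : 0 < e ->
  (\forall y \near x, derivable f y u /\ derivable ('D_u f) y v) ->
  {for x, continuous ('D_v ('D_u f))} ->
  \forall s \near (0 : R),
    `|second_difference f u v x s - s ^+ 2 * 'D_v ('D_u f) x| <= e * s ^+ 2.
Proof.
move=> e0 fd fc.
have /nbhs_ballP[d /= d0 dP] : \forall y \near x,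
    [/\ derivable f y u, derivable ('D_u f) y v &
        `|'D_v ('D_u f) y - 'D_v ('D_u f) x| <= e].
  have fe : \forall y \near x, `|'D_v ('D_u f) x - 'D_v ('D_u f) y| <= e.
    by have /cvgrPdist_le := fc; exact.
  near=> y; have [yu yv] : derivable f y u /\ derivable ('D_u f) y v by near: y.
  by split=> //; rewrite distrC; near: y.
have c0 : 0 < `|u| + `|v| + 1 by rewrite ltr_wpDl// addr_ge0.
have near_pt (s a b : R) : `|s| < d / (`|u| + `|v| + 1) -> `|a| <= `|s| ->
    `|b| <= `|s| -> ball x d (a *: v + (b *: u + x)).
  rewrite ltr_pdivlMr// => sd as_ bs; rewrite -ball_normE/= distrC addrA addrK.
  apply: le_lt_trans sd; apply: le_trans (ler_normD _ _) _; rewrite !normrZ.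
  apply: le_trans (lerD (ler_wpM2r (normr_ge0 _) as_) (ler_wpM2r (normr_ge0 _) bs)) _.
  by rewrite -mulrDr ler_wpM2l// (addrC `|u|) lerDl.
have s0 (s : R) : `|0 : R| <= `|s| by rewrite normr0.
suff : forall s : R, `|s| < d / (`|u| + `|v| + 1) ->
    `|second_difference f u v x s - s ^+ 2 * 'D_v ('D_u f) x| <= e * s ^+ 2.
  move=> H; near=> s; apply: H; near: s.
  exact: (@nbhs0_lt R R (d / (`|u| + `|v| + 1)) (divr_gt0 d0 c0)).
move=> s sd.
have g_derive b : `|b| <= `|s| -> is_derive (b *: u + x) u
    (fun y => f (s *: v + y) - f y)
    ('D_u f (s *: v + (b *: u + x)) - 'D_u f (b *: u + x)).
  move=> bs; apply: is_deriveB; first apply: is_derive_translate.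
    by have [fu _ _] := dP _ (near_pt s s b sd (lexx _) bs); exact: fu.
  apply: derivableP.
  have := near_pt s 0 b sd (s0 s) bs; rewrite scale0r add0r => /dP[fu _ _].
  exact: fu.
have [b|b bs] := @mean_value_line R n (fun y => f (s *: v + y) - f y) x u s.
  by move=> bs; case: (g_derive b bs).
have [_ ->] := g_derive b bs.
have [a|a as_] := @mean_value_line R n ('D_u f) (b *: u + x) v s.
  by move=> as_; have [] := dP _ (near_pt s a b sd as_ bs).
move=> -> E.
have -> : second_difference f u v x s =
    f (s *: v + (s *: u + x)) - f (s *: u + x) - (f (s *: v + x) - f x).
  by rewrite /second_difference; ring.
rewrite E mulrA -expr2 -mulrBr normrM.
rewrite ger0_norm ?sqr_ge0// mulrC ler_wpM2r ?sqr_ge0//.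
by have [] := dP _ (near_pt s a b sd as_ bs).
Unshelve. all: by end_near. Qed.

(** The second difference is symmetric in [u] and [v], and divided by s^2 it approximates both mixed
    derivatives. *)
Lemma derive_comm f u v x :
  (\forall y \near x, [/\ derivable f y u, derivable f y v,
     derivable ('D_u f) y v & derivable ('D_v f) y u]) ->
  {for x, continuous ('D_v ('D_u f))} -> {for x, continuous ('D_u ('D_v f))} ->
  'D_v ('D_u f) x = 'D_u ('D_v f) x.
Proof.
move=> fd cvu cuv; apply/eqP; rewrite -subr_eq0 -normr_le0.
apply/ler_addgt0Pl => e e0; rewrite addr0.
have e20 : 0 < e / 2 by rewrite divr_gt0.
have H1 : \forall s \near (0 : R),
    `|second_difference f u v x s - s ^+ 2 * 'D_v ('D_u f) x| <= e / 2 * s ^+ 2.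
  by apply: second_difference_derive => //; apply: filterS fd => y [].
have H2 : \forall s \near (0 : R),
    `|second_difference f v u x s - s ^+ 2 * 'D_u ('D_v f) x| <= e / 2 * s ^+ 2.
  by apply: second_difference_derive => //; apply: filterS fd => y [].
have [d /= d0 dP] := (nbhs_ballP _ _).1 (filterI H1 H2).
have [] := dP (d / 2).
  by rewrite -ball_normE/= sub0r normrN ger0_norm; lra.
rewrite (second_differenceC f v u) => K1 K2.
move: (second_difference _ _ _ _ _) K1 K2 => D K1 K2.
have s20 : 0 < (d / 2) ^+ 2 by rewrite exprn_gt0// divr_gt0.
move: ('D_v _ _) ('D_u _ _) K1 K2 => a b K1 K2.
move: ((d / 2) ^+ 2) s20 K1 K2 => s s0 K1 K2.
rewrite -(ler_pM2l s0) -[X in X * `|_|](gtr0_norm s0) -normrM mulrBr ler_norml.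
move: K1 K2; rewrite !ler_norml => /andP[K1 K1'] /andP[K2 K2'].
by apply/andP; split; lra.
Qed.

End schwarz.

(** If [d] were negative, [f1] would be negative just to the right of 0, and the mean value theorem
    would make [f] negative there. This replaces a Taylor expansion, as [f1] is assumed
    differentiable at 0 only. *)
Lemma second_derivative_test (R : realType) (f f1 : R -> R) (d : R) :
  (\forall t \near (0 : R), is_derive (t : R) 1 f (f1 t)) -> is_derive (0 : R) 1 f1 d ->
  f 0 = 0 -> (\forall t \near (0 : R), 0 <= f t) -> f1 0 = 0 /\ 0 <= d.
Proof.
move=> fd f1d f00 f_ge0.
have [r /= r0 rP] := (nbhs_ballP _ _).1 (filterI fd f_ge0).
have inr (t : R) : `|t| < r -> is_derive t 1 f (f1 t) /\ 0 <= f t.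
  by move=> tr; apply: rP; rewrite -ball_normE/= sub0r normrN.
have f10 : f1 0 = 0.
  have [_ D0] : is_derive (0 : R) 1 f 0.
    apply: (@derive1_at_min R f (- (r / 2)) (r / 2)).
    - by lra.
    - move=> t /[!in_itv]/= /andP[t1 t2]; have [] : is_derive t 1 f (f1 t) => //.
      by apply: (inr t _).1; rewrite ltr_norml; lra.
    - by rewrite in_itv/=; lra.
    - move=> t /[!in_itv]/= /andP[t1 t2]; rewrite f00.
      by apply: (inr t _).2; rewrite ltr_norml; lra.
  have [[_ <-] _] := inr 0 ltac:(by rewrite normr0).
  exact: D0.
split=> //; rewrite leNgt; apply/negP => d_lt0.
have [f1c f1E] := f1d.
have : (fun h : R => h^-1 *: ((f1 \o shift 0) (h *: 1) - f1 0)) @ 0^' --> d.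
  by rewrite -f1E.
move=> /cvgrPdist_lt /(_ (- d)); rewrite oppr_gt0 => /(_ d_lt0).
rewrite near_withinE => /nbhs_ballP[q /= q0 qP].
pose t := Num.min (r / 2) (q / 2).
have t0 : 0 < t by rewrite lt_min; lra.
have tr : t < r by rewrite gt_min; lra.
have tq : t < q by rewrite gt_min; lra.
have f1neg c : 0 < c <= t -> f1 c < 0.
  move=> /andP[c0 ct].
  have := qP c; rewrite -ball_normE/= sub0r normrN gtr0_norm//.
  move=> /(_ (le_lt_trans ct tq)) /(_ (lt0r_neq0 c0)).
  rewrite f10 subr0 addr0 [c *: 1]mulr1 ltr_norml => /andP[c1 _].
  have : c^-1 *: f1 c < 0 by move: c1; set z := _ *: _; lra.
  by rewrite [_ *: _]/(c^-1 * f1 c) pmulr_rlt0 ?invr_gt0.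
have [c|c|c] := @MVT R f f1 0 t t0.
- rewrite in_itv/= => /andP[c0 ct]; apply: (inr c _).1.
  by rewrite gtr0_norm// (lt_trans ct).
- apply: derivable_within_continuous => z /[!in_itv]/= /andP[z0 zt].
  by have [[]] := inr z ltac:(by rewrite ger0_norm// (le_lt_trans zt)).
rewrite in_itv/= => /andP[c0 ct].
rewrite f00 !subr0 => ft; have [_] := inr t ltac:(by rewrite gtr0_norm).
by rewrite ft leNgt pmulr_llt0// f1neg ?c0 ?ltW.
Qed.

(* Differentiability is required at each order, unlike in [smooth_on], which only
   asks for directional derivatives; [C1_differentiable] bridges the gap. *)
Fixpoint Ck (R : realType) (n k : nat) (U : set 'rV[R]_n) (f : 'rV[R]_n -> R) : Prop :=
  if k is k'.+1 then
    (forall x, U x -> differentiable f x) /\ (forall v, Ck k' U ('D_v f))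
  else forall x, U x -> {for x, continuous f}.

Definition smooth (R : realType) (n : nat) (U : set 'rV[R]_n)
  (f : 'rV[R]_n -> R) : Prop := forall k, Ck k U f.

(** * Closure properties of smooth functions *)

Section smooth_scalar.
Context {R : realType} {n : nat}.
Implicit Types (U : set 'rV[R]_n) (f g : 'rV[R]_n -> R) (k : nat).

Lemma smooth_differentiable U f x : smooth U f -> U x -> differentiable f x.
Proof. by move=> /(_ 1%N)[fd _] /fd. Qed.

Lemma smooth_derive U f v : smooth U f -> smooth U ('D_v f).
Proof. by move=> fU k; have [_] := fU k.+1; exact. Qed.

Lemma near_open_eq (W : Type) U (f g : 'rV[R]_n -> W) x :
  open U -> (forall y, U y -> f y = g y) -> U x -> \forall y \near x, f y = g y.
Proof.
move=> oU fg Ux; have : nbhs x U by exact: open_nbhs_nbhs.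
by apply: filterS.
Qed.

Lemma near_eq_continuous (V W : topologicalType) (f g : V -> W) x :
  (\forall y \near x, f y = g y) -> {for x, continuous f} -> {for x, continuous g}.
Proof.
move=> fg fx; have : f y @[y --> x] --> f x by exact: fx.
rewrite (nbhs_singleton fg) => fgx; change (g y @[y --> x] --> g x).
by move: fgx; apply: cvg_trans; exact: near_eq_cvg.
Qed.

Lemma derive_open_eq (W : normedModType R) U (f g : 'rV[R]_n -> W) x v :
  open U -> (forall y, U y -> f y = g y) -> U x -> 'D_v f x = 'D_v g x.
Proof. by move=> oU fg Ux; apply: near_eq_derive; exact: near_open_eq Ux. Qed.

Lemma near_eq_differentiable (W : normedModType R) (f g : 'rV[R]_n -> W) x :
  (\forall y \near x, f y = g y) -> differentiable f x -> differentiable g x.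
Proof.
move=> fg fx; have fgx := nbhs_singleton fg.
have gE : g \o shift x = cst (g x) + 'd f x +o_ (0 : 'rV[R]_n) id.
  apply/eqaddoP => e e0; have /eqaddoP/(_ _ e0) := diff_locally fx.
  have : \forall h \near (0 : 'rV[R]_n), f (h + x) = g (h + x).
    by move: fg; rewrite (near_shift 0) subr0.
  apply: filterS2 => h E; rewrite !fctE /= -E -fgx; exact.
apply/diff_locallyP.
have df_cont := diff_continuous fx.
by rewrite (diff_unique df_cont gE); split.
Qed.

Lemma Ck_eq k U f g : open U -> (forall x, U x -> f x = g x) ->
  Ck k U f -> Ck k U g.
Proof.
move=> oU; elim: k f g => [|k IH] f g fg /=.
  move=> fc x Ux; apply: near_eq_continuous (fc _ Ux); exact: near_open_eq Ux.
move=> [fd fk]; split=> [x Ux|v].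
  by apply: near_eq_differentiable (fd _ Ux); exact: near_open_eq Ux.
by apply: IH (fk v) => x Ux; exact: derive_open_eq Ux.
Qed.

Lemma smooth_eq U f g : open U -> (forall x, U x -> f x = g x) ->
  smooth U f -> smooth U g.
Proof. by move=> oU fg fU k; apply: Ck_eq (fU k). Qed.

Lemma CkS k U f : Ck k.+1 U f -> Ck k U f.
Proof.
elim: k f => [|k IH] f [fd fk].
  by move=> x /fd; exact: differentiable_continuous.
by split=> // v; apply: IH; exact: fk.
Qed.

Lemma Ck_cst k U (a : R) : Ck k U (cst a).
Proof.
elim: k a => [|k IH] a /=; first by move=> x _; exact: cst_continuous.
split=> [//|v]; rewrite (_ : 'D_v (cst a) = cst 0)//.
by apply/funext => x; rewrite derive_cst.
Qed.

Lemma Ck_coord k U i : Ck k U (fun x => x 0 i).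
Proof.
have D v : 'D_v (fun x : 'rV[R]_n => x 0 i) = cst (v 0 i).
  apply/funext => x.
  by case: ((is_derive_mxP id x v v).1 (is_derive_id x v) 0 i).
case: k => [|k]; first by move=> x _; exact: coord_continuous.
split=> [x _|v]; first exact: differentiable_coord.
by rewrite D; exact: Ck_cst.
Qed.

Lemma CkD k U f g : open U -> Ck k U f -> Ck k U g -> Ck k U (fun x => f x + g x).
Proof.
move=> oU; elim: k f g => [|k IH] f g.
  by move=> fc gc x Ux; exact: (continuousD (fc x Ux) (gc x Ux)).
move=> [fd fk] [gd gk]; split=> [x Ux|v].
  by apply: differentiableD; [exact: fd|exact: gd].
apply: Ck_eq (IH _ _ (fk v) (gk v)) => // x Ux.
by rewrite deriveD//; apply: diff_derivable; [exact: fd|exact: gd].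
Qed.

Lemma CkM k U f g : open U -> Ck k U f -> Ck k U g -> Ck k U (fun x => f x * g x).
Proof.
move=> oU; elim: k f g => [|k IH] f g.
  by move=> fc gc x Ux; exact: (continuousM (fc x Ux) (gc x Ux)).
move=> /[dup] /CkS fk' [fd fk] /[dup] /CkS gk' [gd gk]; split=> [x Ux|v].
  by apply: differentiableM; [exact: fd|exact: gd].
apply: Ck_eq (CkD oU (IH _ _ fk' (gk v)) (IH _ _ gk' (fk v))) => // x Ux.
by rewrite deriveM//; apply: diff_derivable; [exact: fd|exact: gd].
Qed.

Lemma Ck_sum k U (I : Type) (r : seq I) (F : I -> 'rV[R]_n -> R) : open U ->
  (forall i, Ck k U (F i)) -> Ck k U (fun x => \sum_(i <- r) F i x).
Proof.
move=> oU Fk; elim: r => [|i r IH].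
  by apply: Ck_eq (Ck_cst k U 0) => // x _; rewrite big_nil.
by apply: Ck_eq (CkD oU (Fk i) IH) => // x _; rewrite big_cons.
Qed.

Lemma Ck_prod k U (I : Type) (r : seq I) (F : I -> 'rV[R]_n -> R) : open U ->
  (forall i, Ck k U (F i)) -> Ck k U (fun x => \prod_(i <- r) F i x).
Proof.
move=> oU Fk; elim: r => [|i r IH].
  by apply: Ck_eq (Ck_cst k U 1) => // x _; rewrite big_nil.
by apply: Ck_eq (CkM oU (Fk i) IH) => // x _; rewrite big_cons.
Qed.

Lemma CkV k U f : open U -> (forall x, U x -> f x != 0) -> Ck k U f ->
  Ck k U (fun x => (f x)^-1).
Proof.
move=> oU f0; elim: k => [|k IH] /=.
  by move=> fc x Ux; exact: (continuousV (f0 x Ux) (fc x Ux)).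
move=> /[dup] /CkS /IH Vk [fd fk]; split=> [x Ux|v].
  by apply: differentiableV; [exact: fd|exact: f0].
apply: (@Ck_eq _ _ (fun x => -1 * ('D_v f x * ((f x)^-1 * (f x)^-1)))) => //.
  move=> x Ux; rewrite [RHS](deriveV (f0 _ Ux)); last exact: diff_derivable (fd _ Ux).
  by rewrite mulN1r scaleNr mulrC expr2 invfM.
apply: CkM => //; first exact: Ck_cst.
apply: CkM => //.
exact: CkM.
Qed.

End smooth_scalar.

Lemma continuous_mx (R : realType) (T : topologicalType) (m n : nat)
    (f : T -> 'M[R]_(m, n)) (x : T) :
  (forall i j, {for x, continuous (fun y => f y i j)}) -> {for x, continuous f}.
Proof.
move=> fx; have fE : f = (fun y => \sum_i \sum_j f y i j *: delta_mx i j).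
  by apply/funext => y; rewrite -matrix_sum_delta.
rewrite fE; apply: cvg_big => [|? _]; first exact: add_continuous.
apply: cvg_big => [|? _]; first exact: add_continuous.
apply: cvgZr_tmp; exact: fx.
Qed.

Lemma derive_basis_sum (R : realType) (n : nat) (W : normedModType R)
    (f : 'rV[R]_n -> W) (x v : 'rV[R]_n) : differentiable f x ->
  'D_v f x = \sum_i v 0 i *: 'D_(basisv R i) f x.
Proof.
move=> fd; rewrite (deriveE _ fd) {1}(rV_basis_sum v) linear_sum.
by apply: eq_bigr => i _; rewrite linearZ (deriveE _ fd).
Qed.

Section composition.
Context {R : realType} {m n : nat}.
Variables (U : set 'rV[R]_m) (V : set 'rV[R]_n) (g : 'rV[R]_m -> 'rV[R]_n).
Hypotheses (oU : open U) (gUV : forall x, U x -> V (g x)).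

Lemma derive_comp (W : normedModType R) (f : 'rV[R]_n -> W) x v :
  differentiable f (g x) -> differentiable g x ->
  is_derive x v (fun y => f (g y)) ('D_('D_v g x) f (g x)).
Proof.
move=> fd gd; rewrite -[fun y => _]/(f \o g).
have fgd : differentiable (f \o g) x by exact: differentiable_comp.
split; first exact: diff_derivable.
by rewrite !deriveE// diff_comp.
Qed.

(** Induction through the chain rule in coordinates: its factors are derivatives of the entries of
    [g] and partial derivatives of [f] composed with [g], all one order lower. *)
Lemma Ck_comp k (f : 'rV[R]_n -> R) : Ck k V f ->
  (forall i, Ck k U (fun x => g x 0 i)) -> Ck k U (fun x => f (g x)).
Proof.
elim: k f => [|k IH] f /=.
  move=> fc gc x Ux; have gx : {for x, continuous g}.
    by apply: continuous_mx => i j; rewrite ord1; exact: gc.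
  exact: (continuous_comp gx (fc _ (gUV Ux))).
move=> [fd fk] gk.
have gd x : U x -> differentiable g x.
  by move=> Ux; apply/differentiable_mxP => i j; rewrite ord1; exact: (gk j).1.
split=> [x Ux|v].
  by apply: (differentiable_comp (gd _ Ux)); exact/fd/gUV.
apply: (@Ck_eq _ _ _ _ (fun x => \sum_i 'D_v (fun y => g y 0 i) x *
    'D_(basisv R i) f (g x))) => //.
  move=> x Ux; have [_ ->] := derive_comp v (fd _ (gUV Ux)) (gd _ Ux).
  rewrite (derive_basis_sum _ (fd _ (gUV Ux))); apply: eq_bigr => i _.
  have [_ <-//] := (is_derive_mxP g x v _).1 (derivableP (diff_derivable (v := v) (gd _ Ux))) 0 i.
apply: Ck_sum => // i; apply: CkM => //; first by case: (gk i).
exact: (IH _ (fk _) (fun j => CkS (gk j : Ck k.+1 U _))).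
Qed.

End composition.

Definition smooth_mx (R : realType) (n p q : nat) (U : set 'rV[R]_n)
  (f : 'rV[R]_n -> 'M[R]_(p, q)) : Prop := forall i j, smooth U (fun x => f x i j).

Lemma is_derive_mulmx (R : realType) (V : normedModType R) (p q r : nat)
    (f : V -> 'M[R]_(p, q)) (g : V -> 'M[R]_(q, r)) (x v : V) df dg :
  is_derive x v f df -> is_derive x v g dg ->
  is_derive x v (fun y => f y *m g y) (df *m g x + f x *m dg).
Proof.
move=> /is_derive_mxP fx /is_derive_mxP gx; apply/is_derive_mxP => i j.
have -> : (fun y => (f y *m g y) i j) = \sum_k ((fun y => f y i k) * (fun y => g y k j)).
  by apply/funext => y; rewrite fct_sumE mxE.
apply: is_derive_eq.
rewrite !mxE -big_split; apply: eq_bigr => k _ /=.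
by rewrite addrC [g x k j *: _]mulrC.
Qed.

Lemma is_derive_trmx (R : realType) (V : normedModType R) (p q : nat)
    (f : V -> 'M[R]_(p, q)) (x v : V) df :
  is_derive x v f df -> is_derive x v (fun y => (f y)^T) df^T.
Proof.
move=> /is_derive_mxP fx; apply/is_derive_mxP => i j; rewrite mxE.
by rewrite (_ : (fun y => _) = (fun y => f y j i))//; apply/funext => y; rewrite mxE.
Qed.

Section smooth_mx.
Context {R : realType} {n : nat}.
Variable (U : set 'rV[R]_n).
Hypothesis oU : open U.

Lemma smooth_mx_differentiable p q (f : 'rV[R]_n -> 'M[R]_(p, q)) x :
  smooth_mx U f -> U x -> differentiable f x.
Proof. by move=> fU Ux; apply/differentiable_mxP => i j; exact: smooth_differentiable Ux. Qed.

Lemma smooth_mx_is_derive p q (f : 'rV[R]_n -> 'M[R]_(p, q)) x v :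
  smooth_mx U f -> U x -> is_derive x v f ('D_v f x).
Proof. by move=> fU Ux; apply/derivableP/diff_derivable/smooth_mx_differentiable. Qed.

Lemma smooth_is_derive (f : 'rV[R]_n -> R) x v :
  smooth U f -> U x -> is_derive x v f ('D_v f x).
Proof. by move=> fU Ux; apply/derivableP/diff_derivable/(smooth_differentiable fU). Qed.

Lemma derive_entry p q (f : 'rV[R]_n -> 'M[R]_(p, q)) x v i j :
  smooth_mx U f -> U x -> 'D_v f x i j = 'D_v (fun y => f y i j) x.
Proof.
move=> fU Ux.
by have [_ ->] := (is_derive_mxP f x v _).1 (smooth_mx_is_derive v fU Ux) i j.
Qed.

Lemma smooth_mx_derive p q (f : 'rV[R]_n -> 'M[R]_(p, q)) v :
  smooth_mx U f -> smooth_mx U ('D_v f).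
Proof.
move=> fU i j; apply: (smooth_eq oU _ (smooth_derive v (fU i j))) => x Ux.
by rewrite derive_entry.
Qed.

Lemma smooth_mx_eq p q (f g : 'rV[R]_n -> 'M[R]_(p, q)) :
  (forall x, U x -> f x = g x) -> smooth_mx U f -> smooth_mx U g.
Proof. by move=> fg fU i j; apply: smooth_eq (fU i j) => // x /fg ->. Qed.

Lemma smoothD (f g : 'rV[R]_n -> R) :
  smooth U f -> smooth U g -> smooth U (fun x => f x + g x).
Proof. by move=> fU gU k; exact: CkD. Qed.

Lemma smoothM (f g : 'rV[R]_n -> R) :
  smooth U f -> smooth U g -> smooth U (fun x => f x * g x).
Proof. by move=> fU gU k; exact: CkM. Qed.

Lemma smooth_cst (a : R) : smooth U (fun=> a).
Proof. by move=> k; apply: (Ck_cst k U a). Qed.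

Lemma smooth_sum (I : Type) (r : seq I) (F : I -> 'rV[R]_n -> R) :
  (forall i, smooth U (F i)) -> smooth U (fun x => \sum_(i <- r) F i x).
Proof. by move=> FU k; apply: Ck_sum => // i; exact: FU. Qed.

Lemma smooth_prod (I : Type) (r : seq I) (F : I -> 'rV[R]_n -> R) :
  (forall i, smooth U (F i)) -> smooth U (fun x => \prod_(i <- r) F i x).
Proof. by move=> FU k; apply: Ck_prod => // i; exact: FU. Qed.

Lemma smooth_mx_cst p q (A : 'M[R]_(p, q)) : smooth_mx U (fun=> A).
Proof. by move=> i j; exact: smooth_cst. Qed.

Lemma smooth_mx_id : smooth_mx U id.
Proof. by move=> i j k; rewrite ord1; exact: Ck_coord. Qed.

Lemma smooth_mxD p q (f g : 'rV[R]_n -> 'M[R]_(p, q)) :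
  smooth_mx U f -> smooth_mx U g -> smooth_mx U (fun x => f x + g x).
Proof.
move=> fU gU i j; apply: (smooth_eq oU _ (smoothD (fU i j) (gU i j))) => x _.
by rewrite mxE.
Qed.

Lemma smooth_mxM p q r (f : 'rV[R]_n -> 'M[R]_(p, q)) (g : 'rV[R]_n -> 'M[R]_(q, r)) :
  smooth_mx U f -> smooth_mx U g -> smooth_mx U (fun x => f x *m g x).
Proof.
move=> fU gU i j.
apply: (smooth_eq oU (f := fun x => \sum_k f x i k * g x k j)) => [x _|].
  by rewrite mxE.
by apply: smooth_sum => k; exact: smoothM.
Qed.

Lemma smooth_trmx p q (f : 'rV[R]_n -> 'M[R]_(p, q)) :
  smooth_mx U f -> smooth_mx U (fun x => (f x)^T).
Proof. by move=> fU i j; apply: (smooth_eq oU _ (fU j i)) => x _; rewrite mxE. Qed.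

Lemma smooth_det p (f : 'rV[R]_n -> 'M[R]_p) :
  smooth_mx U f -> smooth U (fun x => \det (f x)).
Proof.
move=> fU; rewrite /determinant; apply: smooth_sum => s.
by apply: smoothM; [exact: smooth_cst|exact: smooth_prod].
Qed.

(** Cramer's rule: the entries of the inverse are cofactors divided by the determinant. *)
Lemma smooth_invmx p (f : 'rV[R]_n -> 'M[R]_p) :
  smooth_mx U f -> (forall x, U x -> f x \in unitmx) ->
  smooth_mx U (fun x => invmx (f x)).
Proof.
move=> fU f1 i j.
apply: (smooth_eq oU (f := fun x => (\det (f x))^-1 *
    ((-1) ^+ (j + i) * \det (row' j (col' i (f x)))))) => [x Ux|].
  by rewrite /invmx f1// mxE [in RHS]mxE.
apply: smoothM.
  by move=> k; apply: CkV => // [x /f1|]; [rewrite unitmxE unitfE|exact: smooth_det].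
apply: smoothM; first exact: smooth_cst.
apply: smooth_det => i' j'.
by apply: (smooth_eq oU _ (fU (lift j i') (lift i j'))) => x _; rewrite !mxE.
Qed.

Lemma derive_smooth_comm p q (f : 'rV[R]_n -> 'M[R]_(p, q)) u v x :
  smooth_mx U f -> U x -> 'D_v ('D_u f) x = 'D_u ('D_v f) x.
Proof.
move=> fU Ux; apply/matrixP => i j.
have E w w' : 'D_w ('D_w' f) x i j = 'D_w ('D_w' (fun y => f y i j)) x.
  rewrite derive_entry//; last exact: smooth_mx_derive.
  by apply: derive_open_eq Ux => // y Uy; rewrite derive_entry.
rewrite [LHS]E [RHS]E.
apply: (@derive_comm R n (fun y => f y i j) u v x).
- have : nbhs x U by exact: open_nbhs_nbhs.
  apply: filterS => y Uy.
  have fd := smooth_differentiable (fU i j) Uy.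
  have fdd w := smooth_differentiable (smooth_derive w (fU i j)) Uy.
  by split; apply: diff_derivable.
- apply: differentiable_continuous.
  by apply: smooth_differentiable Ux; do 2!apply: smooth_derive.
- apply: differentiable_continuous.
  by apply: smooth_differentiable Ux; do 2!apply: smooth_derive.
Qed.

Lemma smooth_on_derive (W : normedModType R) (h : 'rV[R]_n -> W) v :
  smooth_on U h -> smooth_on U ('D_v h).
Proof.
(* [iter_derive] applies the head of the list last, so the derivative taken first goes to the end of
   the list. *)
move=> hU vs x Ux; have := hU (rcons vs v) x Ux.
by rewrite /iter_derive foldr_rcons.
Qed.

Lemma smooth_on_smooth (f : 'rV[R]_n -> R) : smooth_on U f -> smooth U f.
Proof.
move=> fU k; elim: k f fU => [|k IH] f fU /=.
  by move=> x Ux; case: (fU [::] x Ux).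
split=> [x Ux|v]; last by apply: IH; exact: smooth_on_derive.
apply: C1_differentiable => [|i].
  have : nbhs x U by exact: open_nbhs_nbhs.
  by apply: filterS => y Uy i; have [_ ] := fU [::] y Uy; apply.
by have [] := fU [:: basisv R i] x Ux.
Qed.

Lemma smooth_on_entry p q (f : 'rV[R]_n -> 'M[R]_(p, q)) i j :
  smooth_on U f -> smooth_on U (fun x => f x i j).
Proof.
move=> fU vs.
have E x : U x -> iter_derive vs f x i j = iter_derive vs (fun y => f y i j) x.
  elim: vs x => [//|v vs IH] x Ux /=.
  have [_ /(_ v) d] := fU vs x Ux.
  have [_ <-] := (is_derive_mxP _ _ _ _).1 (derivableP d) i j.
  exact: (derive_open_eq _ oU IH Ux).
move=> x Ux; have nE := near_open_eq oU E Ux.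
have [fc fd] := fU vs x Ux; split=> [|v].
  apply: near_eq_continuous nE _.
  exact: (continuous_comp fc (@coord_continuous _ _ _ i j _)).
apply: near_eq_derivable nE _.
exact: ((derivable_mxP _ _ _).1 (fd v) i j).
Qed.

Lemma smooth_on_smooth_mx p q (f : 'rV[R]_n -> 'M[R]_(p, q)) :
  smooth_on U f -> smooth_mx U f.
Proof. by move=> fU i j; apply: smooth_on_smooth; exact: smooth_on_entry. Qed.

End smooth_mx.

Lemma smooth_mx_comp (R : realType) (m n p q : nat) (U : set 'rV[R]_m)
    (V : set 'rV[R]_n) (g : 'rV[R]_m -> 'rV[R]_n) (f : 'rV[R]_n -> 'M[R]_(p, q)) :
  open U -> (forall x, U x -> V (g x)) -> smooth_mx V f -> smooth_mx U g ->
  smooth_mx U (fun x => f (g x)).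
Proof. by move=> oU gUV fV gU i j k; apply: (Ck_comp oU gUV (fV i j k)) => l; exact: gU. Qed.

Lemma smooth_mx_sub (R : realType) (n p q : nat) (U V : set 'rV[R]_n)
    (f : 'rV[R]_n -> 'M[R]_(p, q)) :
  U `<=` V -> smooth_mx V f -> smooth_mx U f.
Proof.
move=> UV fV i j k; move: (fV i j k); move: (fun x => f x i j) => g.
elim: k g => [|k IH] g /=; first by move=> gc x /UV; exact: gc.
by move=> [gd gk]; split=> [x /UV|v]; [exact: gd|exact: IH].
Qed.

(** * Bilinear forms and frames *)

Section bform_theory.
Context {R : realType} {n : nat}.
Implicit Types (G H : 'M[R]_n) (u v w : 'rV[R]_n) (a : R).

Lemma bformDl G u u' v : bform G (u + u') v = bform G u v + bform G u' v.
Proof. by rewrite /bform !mulmxDl mxE. Qed.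

Lemma bformZl G a u v : bform G (a *: u) v = a * bform G u v.
Proof. by rewrite /bform -!scalemxAl mxE. Qed.

Lemma bformDr G u v v' : bform G u (v + v') = bform G u v + bform G u v'.
Proof. by rewrite /bform linearD mulmxDr mxE. Qed.

Lemma bformZr G a u v : bform G u (a *: v) = a * bform G u v.
Proof. by rewrite /bform linearZ -scalemxAr mxE. Qed.

Lemma bformNl G u v : bform G (- u) v = - bform G u v.
Proof. by rewrite -scaleN1r bformZl mulN1r. Qed.

Lemma bformNr G u v : bform G u (- v) = - bform G u v.
Proof. by rewrite -scaleN1r bformZr mulN1r. Qed.

Lemma bformBl G u u' v : bform G (u - u') v = bform G u v - bform G u' v.
Proof. by rewrite bformDl bformNl. Qed.

Lemma bformBr G u v v' : bform G u (v - v') = bform G u v - bform G u v'.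
Proof. by rewrite bformDr bformNr. Qed.

Lemma bform0l G v : bform G 0 v = 0.
Proof. by rewrite /bform !mul0mx mxE. Qed.

Lemma bform0r G v : bform G v 0 = 0.
Proof. by rewrite /bform trmx0 mulmx0 mxE. Qed.

Lemma bform_suml G (I : Type) (r : seq I) (F : I -> 'rV[R]_n) v :
  bform G (\sum_(i <- r) F i) v = \sum_(i <- r) bform G (F i) v.
Proof. by elim/big_rec2: _ => [|i y x _ <-]; rewrite ?bform0l// bformDl. Qed.

Lemma bform_sumr G (I : Type) (r : seq I) (F : I -> 'rV[R]_n) u :
  bform G u (\sum_(i <- r) F i) = \sum_(i <- r) bform G u (F i).
Proof. by elim/big_rec2: _ => [|i y x _ <-]; rewrite ?bform0r// bformDr. Qed.

Lemma bform_addm G H u v : bform (G + H) u v = bform G u v + bform H u v.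
Proof. by rewrite /bform mulmxDr mulmxDl mxE. Qed.

Lemma bform_scalem G a u v : bform (a *: G) u v = a * bform G u v.
Proof. by rewrite /bform -scalemxAr -scalemxAl mxE. Qed.

Lemma bform_subm G H u v : bform (G - H) u v = bform G u v - bform H u v.
Proof. by rewrite bform_addm -scaleN1r bform_scalem mulN1r. Qed.

Lemma bformC G u v : G^T = G -> bform G u v = bform G v u.
Proof.
move=> Gs; rewrite /bform; have -> : u *m G *m v^T = (v *m G *m u^T)^T.
  by rewrite !trmx_mul trmxK Gs mulmxA.
by rewrite [LHS]mxE.
Qed.

Lemma bform_basis G (i j : 'I_n) : bform G (basisv R i) (basisv R j) = G i j.
Proof. by rewrite /bform /basisv -rowE trmx_delta -colE !mxE. Qed.

Lemma bform_basisr G u (k : 'I_n) : bform G u (basisv R k) = (u *m G) 0 k.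
Proof. by rewrite /bform /basisv trmx_delta -colE mxE. Qed.

Lemma posdef_unitmx G : posdef G -> G \in unitmx.
Proof.
move=> Gpos; rewrite -row_free_unit -kermx_eq0; apply/eqP/row_matrixP => i.
rewrite row0; apply/eqP/negPn/negP => /Gpos.
by rewrite /bform -row_mul mulmx_ker row0 mul0mx mxE ltxx.
Qed.

Lemma unitmx_bform_inj G u v : G \in unitmx ->
  (forall w, bform G u w = bform G v w) -> u = v.
Proof.
move=> Gu uv; rewrite -[u](mulmxK Gu) -[v](mulmxK Gu); congr (_ *m _).
by apply/rowP => k; rewrite -!bform_basisr.
Qed.

Lemma posdef_ge0 G v : posdef G -> 0 <= bform G v v.
Proof. by move=> Gp; have [->|/Gp/ltW//] := eqVneq v 0; rewrite bform0l. Qed.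

Lemma psd_null G v : G^T = G -> (forall w, 0 <= bform G w w) ->
  bform G v v = 0 -> forall w, bform G v w = 0.
Proof.
move=> Gs Gp v0 w; apply/eqP/negPn/negP => b0.
set b := bform G v w in b0; set c := bform G w w.
(* On s v + w the form equals 2 s b + c, affine in s; this choice of s makes it -1. *)
have /= := Gp (- ((c + 1) / (2 * b)) *: v + w).
rewrite bformDl !bformDr !bformZl !bformZr v0 (bformC w v Gs) -/b -/c !mulr0 add0r.
have -> : - ((c + 1) / (2 * b)) * b = - ((c + 1) / 2) by field.
lra.
Qed.

Lemma bform_CauchySchwarz G u v : G^T = G -> posdef G ->
  bform G u v ^+ 2 <= bform G u u * bform G v v.
Proof.
move=> Gs Gp; have [->|v0] := eqVneq v 0.
  by rewrite !bform0r expr0n mulr0.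
(* This is G(v, v) times the component of [u] orthogonal to [v]; its square is G(v, v) times the
   Gram determinant. *)
have := posdef_ge0 (bform G v v *: u - bform G u v *: v) Gp.
have vv0 := Gp v v0.
rewrite bformBl !bformBr !bformZl !bformZr (bformC v u Gs).
move: vv0; set a := bform G u u; set b := bform G u v; set c := bform G v v => c0.
rewrite (_ : _ - _ = c * (a * c - b ^+ 2)); last by ring.
by rewrite pmulr_rge0// subr_ge0.
Qed.

(** [d] counts the missing vectors. A vector orthogonal to the [p] given ones exists because a
    matrix with [n] rows and p < n columns has a left kernel. Indexing [F] by [nat] lets the
    induction change [p] without changing types. *)
Lemma orthonormal_extension G (d p : nat) (F : nat -> 'rV[R]_n) :
  G^T = G -> posdef G -> (p + d = n)%N ->
  (forall i j, (i < p)%N -> (j < p)%N -> bform G (F i) (F j) = (i == j)%:R) ->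
  exists2 e : 'I_n -> 'rV[R]_n, orthonormal_frame G e &
    forall i : 'I_n, (i < p)%N -> e i = F i.
Proof.
move=> Gs Gp; elim: d p F => [|d IH] p F pdn Fo.
  rewrite addn0 in pdn.
  exists (fun i : 'I_n => F i) => // i j; rewrite Fo ?pdn ?ltn_ord//.
pose A : 'M[R]_(n, p) := G *m (\matrix_(i < p) F i)^T.
have /rowV0Pn[w /sub_kermxP wA w0] : kermx A != 0.
  rewrite kermx_eq0 /row_free neq_ltn (leq_ltn_trans (rank_leq_col A))//.
  by rewrite -pdn addnS ltnS leq_addr.
have Fw i : (i < p)%N -> bform G w (F i) = 0.
  move=> ip; have := congr1 (fun M : 'rV_p => M 0 (Ordinal ip)) wA.
  rewrite /A mulmxA [RHS]mxE => <-; rewrite /bform !mxE.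
  by apply: eq_bigr => k _; rewrite !mxE.
have ww := Gp w w0.
pose w' := (Num.sqrt (bform G w w))^-1 *: w.
have w'w' : bform G w' w' = 1.
  rewrite bformZl bformZr mulrA -invfM -expr2 sqr_sqrtr ?ltW// mulVf//.
  by rewrite gt_eqF.
have [||e eo eF] := IH p.+1 (fun i => if i == p then w' else F i).
- by rewrite addSn -addnS.
- move=> i j; rewrite !ltnS (leq_eqVlt i p) (leq_eqVlt j p).
  have [->|ip] /= := eqVneq i p; have [->|jp] /= := eqVneq j p.
  + by move=> _ _; rewrite w'w'.
  + by move=> _ /Fw Fj; rewrite bformZl Fj mulr0.
  + by move=> /Fw Fi _; rewrite (bformC _ _ Gs) bformZl Fi mulr0 (negbTE ip).
  + exact: Fo.
exists e => // i ip; rewrite eF ?(ltn_trans ip)//.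
by rewrite ltn_eqF.
Qed.

End bform_theory.

Definition bilin (R : realType) (p q r : nat)
    (B : 'rV[R]_p -> 'rV[R]_q -> 'rV[R]_r) : Prop :=
  (forall a u u' v, B (a *: u + u') v = a *: B u v + B u' v) /\
  (forall a u v v', B u (a *: v + v') = a *: B u v + B u v').

Section bilin_theory.
Context {R : realType} {p q r : nat} (B : 'rV[R]_p -> 'rV[R]_q -> 'rV[R]_r).
Hypothesis BB : bilin B.

Lemma bilinDl u u' v : B (u + u') v = B u v + B u' v.
Proof. by have := BB.1 1 u u' v; rewrite !scale1r. Qed.

Lemma bilinDr u v v' : B u (v + v') = B u v + B u v'.
Proof. by have := BB.2 1 u v v'; rewrite !scale1r. Qed.

Lemma bilin0l v : B 0 v = 0.
Proof. by apply: (addrI (B 0 v)); rewrite -bilinDl !addr0. Qed.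

Lemma bilin0r u : B u 0 = 0.
Proof. by apply: (addrI (B u 0)); rewrite -bilinDr !addr0. Qed.

Lemma bilinZl a u v : B (a *: u) v = a *: B u v.
Proof. by have := BB.1 a u 0 v; rewrite bilin0l !addr0. Qed.

Lemma bilinZr a u v : B u (a *: v) = a *: B u v.
Proof. by have := BB.2 a u v 0; rewrite bilin0r !addr0. Qed.

Lemma bilin_suml (I : Type) (s : seq I) (F : I -> 'rV[R]_p) v :
  B (\sum_(i <- s) F i) v = \sum_(i <- s) B (F i) v.
Proof. by elim/big_rec2: _ => [|i y x _ <-]; rewrite ?bilin0l// bilinDl. Qed.

Lemma bilin_sumr (I : Type) (s : seq I) (F : I -> 'rV[R]_q) u :
  B u (\sum_(i <- s) F i) = \sum_(i <- s) B u (F i).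
Proof. by elim/big_rec2: _ => [|i y x _ <-]; rewrite ?bilin0r// bilinDr. Qed.

Lemma bilin_basis u v :
  B u v = \sum_i \sum_j (u 0 i * v 0 j) *: B (basisv R i) (basisv R j).
Proof.
rewrite {1}(rV_basis_sum u) bilin_suml; apply: eq_bigr => i _.
rewrite bilinZl {1}(rV_basis_sum v) bilin_sumr scaler_sumr.
by apply: eq_bigr => j _; rewrite bilinZr scalerA.
Qed.

End bilin_theory.

Section orthonormal_frames.
Context {R : realType} {n : nat} (G : 'M[R]_n) (e : 'I_n -> 'rV[R]_n).
Hypotheses (Gs : G^T = G) (eo : orthonormal_frame G e).

Let E : 'M[R]_n := \matrix_i e i.

Let EGE : E *m G *m E^T = 1%:M.
Proof.
apply/matrixP => i j; rewrite [RHS]mxE -eo /bform !mxE; apply: eq_bigr => k _.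
by rewrite !mxE; congr (_ * _); apply: eq_bigr => l _; rewrite mxE.
Qed.

Lemma orthonormal_frame_expansion v : v = \sum_k bform G v (e k) *: e k.
Proof.
have EE : (G *m E^T) *m E = 1%:M by apply: mulmx1C; rewrite mulmxA.
rewrite -[LHS]mulmx1 -EE mulmxA [LHS]mulmx_sum_row.
apply: eq_bigr => k _; rewrite rowK; congr (_ *: _).
rewrite /bform mulmxA !mxE; apply: eq_bigr => l _.
by rewrite !mxE.
Qed.

Lemma orthonormal_frame_parseval u v :
  bform G u v = \sum_k bform G u (e k) * bform G v (e k).
Proof.
rewrite {1}(orthonormal_frame_expansion v) bform_sumr.
by apply: eq_bigr => k _; rewrite bformZr mulrC.
Qed.

Lemma orthonormal_frame_invmx : invmx G = E^T *m E.
Proof.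
have GEE : G *m (E^T *m E) = 1%:M by rewrite mulmxA; apply: mulmx1C; rewrite mulmxA.
have Gu : G \in unitmx by case: (mulmx1_unit GEE).
by rewrite -[RHS]mul1mx -(mulVmx Gu) -mulmxA GEE mulmx1.
Qed.

(** The right-hand side does not involve the frame and depends smoothly on the metric, so a trace
    can be differentiated without choosing a smooth orthonormal frame. *)
Lemma bilin_trace (r : nat) (B : 'rV[R]_n -> 'rV[R]_n -> 'rV[R]_r) : bilin B ->
  \sum_k B (e k) (e k) =
  \sum_i \sum_j invmx G i j *: B (basisv R i) (basisv R j).
Proof.
move=> BB; under eq_bigr => k _ do rewrite (bilin_basis BB).
rewrite exchange_big; apply: eq_bigr => i _; rewrite exchange_big.
apply: eq_bigr => j _; rewrite -scaler_suml orthonormal_frame_invmx; congr (_ *: _).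
by rewrite mxE; apply: eq_bigr => k _; rewrite !mxE.
Qed.

End orthonormal_frames.

Lemma bform_is_derive (R : realType) (V : normedModType R) (n : nat)
    (G : V -> 'M[R]_n) (X Y : V -> 'rV[R]_n) (x e : V) (dG : 'M[R]_n)
    (dX dY : 'rV[R]_n) :
  is_derive x e G dG -> is_derive x e X dX -> is_derive x e Y dY ->
  is_derive x e (fun y => bform (G y) (X y) (Y y))
    (bform dG (X x) (Y x) + bform (G x) dX (Y x) + bform (G x) (X x) dY).
Proof.
move=> Gd Xd Yd.
have := is_derive_mulmx (is_derive_mulmx Xd Gd) (is_derive_trmx Yd).
move=> /is_derive_mxP/(_ 0 0) H; apply: is_derive_eq.
by rewrite /bform mulmxDl !mxE; ring.
Qed.

Section bilinear_fields.
Context {R : realType} {m p q r n : nat}.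
Variables (U : set 'rV[R]_m) (V : set 'rV[R]_n) (F : 'rV[R]_m -> 'rV[R]_n).
Variable B : 'rV[R]_n -> 'rV[R]_p -> 'rV[R]_q -> 'rV[R]_r.
Hypotheses (oU : open U) (oV : open V) (FUV : forall x, U x -> V (F x)).
Hypotheses (BB : forall y, V y -> bilin (B y)).
Hypothesis Bs : forall u v, smooth_mx V (fun y => B y u v).
Hypothesis Fs : smooth_mx U F.

Let Bentry y u v k : V y -> B y u v 0 k =
  \sum_i \sum_j u 0 i * v 0 j * B y (basisv R i) (basisv R j) 0 k.
Proof.
move=> Vy; rewrite (bilin_basis (BB Vy)) summxE; apply: eq_bigr => i _.
by rewrite summxE; apply: eq_bigr => j _; rewrite mxE.
Qed.

Lemma smooth_bilin X Y : smooth_mx U X -> smooth_mx U Y ->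
  smooth_mx U (fun x => B (F x) (X x) (Y x)).
Proof.
move=> Xs Ys i k; rewrite ord1.
apply: (smooth_eq oU (f := fun x => \sum_i \sum_j X x 0 i * Y x 0 j *
  B (F x) (basisv R i) (basisv R j) 0 k)) => [x Ux|].
  by rewrite Bentry//; exact: FUV.
apply: smooth_sum => // a; apply: smooth_sum => // b.
apply: smoothM => //; first exact: smoothM.
exact: (smooth_mx_comp oU FUV (Bs _ _) Fs).
Qed.

(** Leibniz rule for a bilinear map depending on a point, whose smoothness is known on constant
    arguments only: expansion in the standard basis reduces it to products of scalar functions. *)
Lemma bilin_is_derive X Y dX dY (x e : 'rV[R]_m) : U x ->
  is_derive x e X dX -> is_derive x e Y dY ->
  is_derive x e (fun z => B (F z) (X z) (Y z))
    ('D_('D_e F x) (fun y => B y (X x) (Y x)) (F x)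
     + B (F x) dX (Y x) + B (F x) (X x) dY).
Proof.
move=> Ux /is_derive_mxP Xd /is_derive_mxP Yd; apply/is_derive_mxP => i k.
rewrite ord1 {i}.
have VFx := FUV Ux.
pose b i j y : R := B y (basisv R i) (basisv R j) 0 k.
have bs i j : smooth V (b i j) by exact: (Bs (basisv R i) (basisv R j) 0 k).
have bd i j : is_derive x e (fun z => b i j (F z)) ('D_('D_e F x) (b i j) (F x)).
  apply: derive_comp; first exact: smooth_differentiable VFx.
  exact: smooth_mx_differentiable Ux.
apply: (near_eq_is_derive (f := \sum_i \sum_j
    ((fun z => X z 0 i) * (fun z => Y z 0 j) * (fun z => b i j (F z))))).
  apply: (near_open_eq oU _ Ux) => z Uz; rewrite Bentry; last exact: FUV.
  by rewrite fct_sumE; apply: eq_bigr => i _; rewrite fct_sumE.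
have D0 : 'D_('D_e F x) (fun y => B y (X x) (Y x)) (F x) 0 k =
    \sum_i \sum_j X x 0 i * Y x 0 j * 'D_('D_e F x) (b i j) (F x).
  rewrite (derive_entry _ 0 k (Bs (X x) (Y x)) VFx).
  rewrite (derive_open_eq (g := \sum_i \sum_j (X x 0 i * Y x 0 j) *: b i j) _ oV _ VFx).
    have H i j : is_derive (F x) ('D_e F x) (b i j) ('D_('D_e F x) (b i j) (F x)).
      exact: smooth_is_derive VFx.
    by rewrite derive_val.
  move=> y Vy; rewrite Bentry// fct_sumE; apply: eq_bigr => i _.
  by rewrite fct_sumE.
apply: is_derive_eq.
rewrite [RHS]mxE [X in _ = X + _]mxE D0 !Bentry// -!big_split; apply: eq_bigr => i _.
rewrite -!big_split; apply: eq_bigr => j _ /=; rewrite /b /GRing.scale /=.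
rewrite !fctE; ring.
Qed.

End bilinear_fields.

(** * Levi-Civita connection *)

Lemma bform_basis_sumr (R : realType) (n : nat) (G : 'M[R]_n) (u w : 'rV[R]_n) :
  bform G u w = \sum_k w 0 k * bform G u (basisv R k).
Proof.
by rewrite {1}(rV_basis_sum w) bform_sumr; apply: eq_bigr => k _; rewrite bformZr.
Qed.

Lemma smooth_bform (R : realType) (n : nat) (W : set 'rV[R]_n)
    (p : nat) (H : 'rV[R]_n -> 'M[R]_p) u v :
  open W -> smooth_mx W H -> smooth W (fun y => bform (H y) u v).
Proof.
move=> oW Hs; apply: (smooth_mxM oW (f := fun y => u *m H y) (g := fun=> v^T)).
  by apply: smooth_mxM => //; exact: smooth_mx_cst.
exact: smooth_mx_cst.
Qed.

Lemma bform_0m (R : realType) (n : nat) (u v : 'rV[R]_n) : bform 0 u v = 0.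
Proof. by rewrite /bform mulmx0 mul0mx mxE. Qed.

Lemma koszul_dual (R : realType) (n : nat) (G : 'M[R]_n) (c : 'I_n -> R) w :
  G \in unitmx -> bform G ((\row_k c k) *m invmx G) w = \sum_k w 0 k * c k.
Proof.
move=> Gu; rewrite bform_basis_sumr; apply: eq_bigr => k _.
by rewrite bform_basisr mulmxKV// mxE.
Qed.

Lemma koszul_sum (R : realType) (n : nat) (A B : 'M[R]_n) (C : 'I_n -> 'M[R]_n)
    (u v w : 'rV[R]_n) :
  \sum_k w 0 k * (2^-1 * (bform A v (basisv R k) + bform B u (basisv R k)
                           - bform (C k) u v)) =
  2^-1 * (bform A v w + bform B u w - \sum_k w 0 k * bform (C k) u v).
Proof.
rewrite (bform_basis_sumr A v w) (bform_basis_sumr B u w).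
rewrite -big_split -sumrB mulr_sumr; apply: eq_bigr => k _ /=.
by rewrite -mulrDr -mulrBr mulrCA.
Qed.

Section christoffel_theory.
Context {R : realType} {n : nat}.
Variables (V : set 'rV[R]_n) (G : 'rV[R]_n -> 'M[R]_n).
Hypotheses (oV : open V) (Gs : smooth_mx V G).
Hypotheses (Gsym : forall y, V y -> (G y)^T = G y).
Hypothesis Gunit : forall y, V y -> G y \in unitmx.

Lemma derive_bform u v w y : V y ->
  'D_w (fun z => bform (G z) u v) y = bform ('D_w G y) u v.
Proof.
move=> Vy; have Gd := smooth_mx_is_derive w Gs Vy.
have [_ ->] := bform_is_derive Gd (is_derive_cst u y w) (is_derive_cst v y w).
by rewrite bform0l bform0r !addr0.
Qed.

Lemma derive_metric_sym w y : V y -> ('D_w G y)^T = 'D_w G y.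
Proof.
move=> Vy; have [_ <-] := is_derive_trmx (smooth_mx_is_derive w Gs Vy).
exact: (derive_open_eq w oV Gsym Vy).
Qed.

Lemma derive_dirP (W : normedModType R) (f : 'rV[R]_n -> W) a u u' y :
  differentiable f y -> 'D_(a *: u + u') f y = a *: 'D_u f y + 'D_u' f y.
Proof. by move=> fd; rewrite !(deriveE _ fd) linearP. Qed.

Lemma christoffel_koszul y u v w : V y ->
  bform (G y) (christoffel G y u v) w =
  2^-1 * (bform ('D_u G y) v w + bform ('D_v G y) u w - bform ('D_w G y) u v).
Proof.
move=> Vy; have Gd := smooth_mx_differentiable Gs Vy.
have Gw : bform ('D_w G y) u v = \sum_k w 0 k * bform ('D_(basisv R k) G y) u v.
  rewrite (derive_basis_sum _ Gd).
  elim/big_rec2: _ => [|i a b _ <-]; first by rewrite bform_0m.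
  by rewrite bform_addm bform_scalem.
rewrite Gw; apply: etrans (koszul_dual _ _ (Gunit Vy)) _.
under eq_bigr => k _ do rewrite !derive_bform//.
exact: koszul_sum.
Qed.

Lemma metric_inj y u v : V y ->
  (forall w, bform (G y) u w = bform (G y) v w) -> u = v.
Proof. by move=> /Gunit; exact: unitmx_bform_inj. Qed.

Lemma christoffel_bilin y : V y -> bilin (christoffel G y).
Proof.
move=> Vy; have Gd := smooth_mx_differentiable Gs Vy.
split=> a.
  move=> u u' v; apply: (metric_inj Vy) => w.
  have := christoffel_koszul (a *: u + u') v w Vy.
  have := christoffel_koszul u v w Vy; have := christoffel_koszul u' v w Vy.
  rewrite (derive_dirP a u u' Gd).
  move: ('D_u G y) ('D_u' G y) ('D_v G y) ('D_w G y) => Du Du' Dv Dw.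
  move: (christoffel _ _ _ _) (christoffel _ _ _ _) (christoffel _ _ _ _) (G y).
  move=> X Y Z g EX EY EZ; rewrite bformDl bformZl EX EY EZ.
  rewrite bform_addm bform_scalem !(bformDl, bformDr, bformZl, bformZr); ring.
move=> u v v'; apply: (metric_inj Vy) => w.
have := christoffel_koszul u (a *: v + v') w Vy.
have := christoffel_koszul u v w Vy; have := christoffel_koszul u v' w Vy.
rewrite (derive_dirP a v v' Gd).
move: ('D_u G y) ('D_v' G y) ('D_v G y) ('D_w G y) => Du Dv' Dv Dw.
move: (christoffel _ _ _ _) (christoffel _ _ _ _) (christoffel _ _ _ _) (G y).
move=> X Y Z g EX EY EZ; rewrite bformDl bformZl EX EY EZ.
rewrite bform_addm bform_scalem !(bformDl, bformDr, bformZl, bformZr); ring.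
Qed.

Lemma christoffelC y u v : V y -> christoffel G y u v = christoffel G y v u.
Proof.
move=> Vy; apply: (metric_inj Vy) => w.
have := christoffel_koszul u v w Vy; have := christoffel_koszul v u w Vy.
have := derive_metric_sym w Vy.
move: ('D_u G y) ('D_v G y) ('D_w G y) => Du Dv Dw Ds -> ->.
by rewrite (bformC u v Ds); ring.
Qed.

Lemma christoffel_smooth u v : smooth_mx V (fun y => christoffel G y u v).
Proof.
rewrite /christoffel; apply: smooth_mxM => //; last exact: smooth_invmx.
move=> i k; apply: (smooth_eq oV (f := fun y => 2^-1 *
  (bform ('D_u G y) v (basisv R k) + bform ('D_v G y) u (basisv R k)
   + (-1) * bform ('D_(basisv R k) G y) u v))).
  by move=> y Vy; rewrite mxE !derive_bform// mulN1r.
have bs w a b : smooth V (fun y => bform ('D_w G y) a b).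
  by apply: smooth_bform => //; exact: smooth_mx_derive.
apply: (smoothM oV); first exact: smooth_cst.
apply: (smoothD oV); first exact: (smoothD oV (bs _ _ _) (bs _ _ _)).
exact: (smoothM oV (smooth_cst _ _) (bs _ _ _)).
Qed.

(** Compatibility of the connection with the metric: in the sum of the Koszul formulas for (w, u; v)
    and (w, v; u) only the derivative in the direction [w] survives. *)
Lemma metric_derive y u v w : V y ->
  bform ('D_w G y) u v =
  bform (G y) (christoffel G y w u) v + bform (G y) u (christoffel G y w v).
Proof.
move=> Vy; have gs := Gsym Vy.
have := christoffel_koszul w u v Vy; have := christoffel_koszul w v u Vy.
have := derive_metric_sym u Vy; have := derive_metric_sym v Vy.
have := derive_metric_sym w Vy.
move: ('D_u G y) ('D_v G y) ('D_w G y) => Du Dv Dw.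
move: (G y) gs (christoffel G y w u) (christoffel G y w v) => g gs X Y.
move=> Dws Dvs Dus EY EX; rewrite (bformC u Y gs) EX EY.
by rewrite (bformC v u Dws) (bformC w v Dus) (bformC w u Dvs); field.
Qed.

Lemma levi_civita_cst u v : levi_civita G (cst u) (cst v) =
  fun y => christoffel G y u v.
Proof. by apply/funext => y; rewrite /levi_civita derive_cst add0r. Qed.

Lemma riemann_cst y u v w : V y -> riemann G (cst u) (cst v) (cst w) y =
  'D_u (fun z => christoffel G z v w) y + christoffel G y u (christoffel G y v w)
  - ('D_v (fun z => christoffel G z u w) y
     + christoffel G y v (christoffel G y u w)).
Proof.
move=> Vy; rewrite /riemann !levi_civita_cst /lie_bracket.
rewrite /levi_civita /= !derive_cst subr0 (bilin0l (christoffel_bilin Vy)).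
by rewrite addr0 subr0.
Qed.

Lemma riemann_cstC y u v w : V y ->
  riemann G (cst u) (cst v) (cst w) y = - riemann G (cst v) (cst u) (cst w) y.
Proof. by move=> Vy; rewrite !riemann_cst// opprB. Qed.

End christoffel_theory.

Lemma curvature_algebra (R : realType) (n : nat)
    (a a' c c' d1 d2 c1 c2 c3 c4 r s : 'rV[R]_n) :
  s = a' + (d2 + c' + c2) + (c1 + c3) -> r = d1 + c4 - (d2 + c3) ->
  a = a' -> c = c' -> a + (d1 + c + c1) + (c2 + c4) = s + r.
Proof.
by move=> -> -> -> ->; apply/rowP => k; rewrite !mxE; ring.
Qed.

Section along_theory.
Context {R : realType} {m n : nat}.
Variables (U : set 'rV[R]_m) (V : set 'rV[R]_n) (F : 'rV[R]_m -> 'rV[R]_n).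
Variable G : 'rV[R]_n -> 'M[R]_n.
Hypotheses (oU : open U) (oV : open V) (FUV : forall x, U x -> V (F x)).
Hypotheses (Gs : smooth_mx V G) (Fs : smooth_mx U F).
Hypotheses (Gsym : forall y, V y -> (G y)^T = G y).
Hypothesis Gunit : forall y, V y -> G y \in unitmx.

Local Notation nabla := (levi_civita_along G F).

Lemma along_compat (X Y : 'rV[R]_m -> 'rV[R]_n) dX dY x e : U x ->
  is_derive x e X dX -> is_derive x e Y dY ->
  is_derive x e (fun z => bform (G (F z)) (X z) (Y z))
    (bform (G (F x)) (nabla e X x) (Y x) + bform (G (F x)) (X x) (nabla e Y x)).
Proof.
move=> Ux Xd Yd; have VFx := FUV Ux.
have GFd : is_derive x e (fun z => G (F z)) ('D_('D_e F x) G (F x)).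
  apply: derive_comp; first exact: smooth_mx_differentiable VFx.
  exact: smooth_mx_differentiable Ux.
apply: is_derive_eq (bform_is_derive GFd Xd Yd) _.
rewrite (metric_derive oV Gs Gsym Gunit _ _ _ VFx) /levi_civita_along.
by rewrite !bformDl !bformDr !derive_val; ring.
Qed.

Lemma along_sym e v x : U x -> nabla e ('D_v F) x = nabla v ('D_e F) x.
Proof.
move=> Ux; rewrite /levi_civita_along (derive_smooth_comm oU _ _ Fs Ux).
by rewrite (christoffelC oV Gs Gsym Gunit _ _ (FUV Ux)).
Qed.

Lemma along_smooth e X : smooth_mx U X -> smooth_mx U (nabla e X).
Proof.
move=> Xs; apply: smooth_mxD => //; first exact: smooth_mx_derive.
exact: (smooth_bilin oU FUV (christoffel_bilin Gs Gunit)
  (christoffel_smooth oV Gs Gunit) Fs (smooth_mx_derive oU e Fs) Xs).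
Qed.

(** Curvature of the pulled-back connection. Both orders of differentiation have the expansion [E];
    the mixed derivatives of [X] and of [F] agree by Schwarz, the cross terms match, and the rest is
    [riemann_cst] at F x. *)
Lemma along_curvature e v X x : smooth_mx U X -> U x ->
  nabla e (nabla v X) x = nabla v (nabla e X) x
    + riemann G (cst ('D_e F x)) (cst ('D_v F x)) (cst (X x)) (F x).
Proof.
move=> Xs Ux; have VFx := FUV Ux.
have Cb := christoffel_bilin Gs Gunit.
have Cs := christoffel_smooth oV Gs Gunit.
have E a b : nabla a (nabla b X) x = 'D_a ('D_b X) x
   + ('D_('D_a F x) (fun y => christoffel G y ('D_b F x) (X x)) (F x)
      + christoffel G (F x) ('D_a ('D_b F) x) (X x)
      + christoffel G (F x) ('D_b F x) ('D_a X x))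
   + (christoffel G (F x) ('D_a F x) ('D_b X x)
      + christoffel G (F x) ('D_a F x) (christoffel G (F x) ('D_b F x) (X x))).
  apply: (@etrans _ _ ('D_a (nabla b X) x + christoffel G (F x) ('D_a F x)
    ('D_b X x + christoffel G (F x) ('D_b F x) (X x)))) => //.
  rewrite (bilinDr (Cb _ VFx)); congr (_ + _).
  have Fbd := smooth_mx_is_derive a (smooth_mx_derive oU b Fs) Ux.
  have Xd := smooth_mx_is_derive a Xs Ux.
  have Xbd := smooth_mx_is_derive a (smooth_mx_derive oU b Xs) Ux.
  have H := bilin_is_derive oU oV FUV Cb Cs Fs Ux Fbd Xd.
  by have [_ E] := is_deriveD Xbd H; exact: E.
apply: etrans (E e v) _; apply: curvature_algebra (E v e)
  (riemann_cst Gs Gunit _ _ _ VFx) _ _; first exact: (derive_smooth_comm oU v e Xs Ux).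
apply: (congr1 (fun w => christoffel G (F x) w (X x))).
exact: (derive_smooth_comm oU v e Fs Ux).
Qed.

Lemma alongD e X Y dX dY x : U x ->
  is_derive x e X dX -> is_derive x e Y dY ->
  nabla e (fun z => X z + Y z) x = nabla e X x + nabla e Y x.
Proof.
move=> Ux Xd Yd; have Cb := christoffel_bilin Gs Gunit (FUV Ux).
rewrite /levi_civita_along (bilinDr Cb).
by have [_ ->] := is_deriveD Xd Yd; rewrite !derive_val addrACA.
Qed.

End along_theory.

Lemma field_algebra (R : realType) (n : nat) (a b c d r s t : 'rV[R]_n) :
  a + (b + c) + r =
  a + (b - d) - 2 *: (s - t) + r + (c + d - 2 *: t) + 2 *: s.
Proof. by apply/rowP => k; rewrite !mxE; ring. Qed.

(** * Second fundamental form of a map *)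

Section second_fundamental.
Context {R : realType} {m n : nat}.
Variables (U : set 'rV[R]_m) (V : set 'rV[R]_n) (F : 'rV[R]_m -> 'rV[R]_n).
Variable G : 'rV[R]_n -> 'M[R]_n.
Variable C : 'rV[R]_m -> 'rV[R]_m -> 'rV[R]_m -> 'rV[R]_m.
Hypotheses (oU : open U) (oV : open V) (FUV : forall x, U x -> V (F x)).
Hypotheses (Gs : smooth_mx V G) (Fs : smooth_mx U F).
Hypotheses (Gsym : forall y, V y -> (G y)^T = G y).
Hypothesis Gunit : forall y, V y -> G y \in unitmx.
Hypothesis Cb : forall x, U x -> bilin (C x).
Hypothesis CC : forall x u v, U x -> C x u v = C x v u.
Hypothesis Cs : forall u v, smooth_mx U (fun x => C x u v).

Local Notation nabla := (levi_civita_along G F).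

(* C stands for the Christoffel symbols of the metric on the source, which need not
   be the pullback of G: for the graph of h it is the graph metric, and F is the
   identity or h, so that [sff] gives either component of A. *)
Definition sff (e w x : 'rV[R]_m) : 'rV[R]_n :=
  nabla e ('D_w F) x - 'D_(C x e w) F x.

Lemma derive_dirD x u v : U x -> 'D_(u + v) F x = 'D_u F x + 'D_v F x.
Proof.
move=> Ux; have := derive_dirP 1 u v (smooth_mx_differentiable Fs Ux).
by rewrite !scale1r.
Qed.

Lemma derive_dirZ x a u : U x -> 'D_(a *: u) F x = a *: 'D_u F x.
Proof.
move=> Ux; have := derive_dirP a u 0 (smooth_mx_differentiable Fs Ux).
by rewrite derive0 !addr0.
Qed.

(** The differential disguised as a bilinear map, with a dummy scalar as second argument, so that
    [smooth_bilin] and [bilin_is_derive] apply to fields of the form dF(Y). *)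
Let dF (x u : 'rV[R]_m) (c : 'rV[R]_1) : 'rV[R]_n := c 0 0 *: 'D_u F x.

Let dF_bilin x : U x -> bilin (dF x).
Proof.
move=> Ux; split=> a u v w; rewrite /dF.
  by rewrite derive_dirD// derive_dirZ// scalerDr !scalerA mulrC.
by rewrite !mxE scalerDl scalerA.
Qed.

Let dF_smooth u c : smooth_mx U (fun x => dF x u c).
Proof.
move=> i j; apply: (smooth_eq oU (f := fun x => c 0 0 * 'D_u F x i j)).
  by move=> x _; rewrite /dF mxE.
by apply: (smoothM oU); [exact: smooth_cst|exact: smooth_mx_derive].
Qed.

Let idU x : U x -> U (id x). Proof. by []. Qed.

Lemma derive_field_smooth Y : smooth_mx U Y ->
  smooth_mx U (fun x => 'D_(Y x) F x).
Proof.
move=> Ys; have H := smooth_bilin oU idU dF_bilin dF_smooth (@smooth_mx_id R m U) Ys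
  (smooth_mx_cst U (const_mx 1)).
by apply: smooth_mx_eq H => // x _; rewrite /dF mxE scale1r.
Qed.

Lemma derive_field_is_derive Y dY x e : U x -> is_derive x e Y dY ->
  is_derive x e (fun z => 'D_(Y z) F z) ('D_e ('D_(Y x) F) x + 'D_dY F x).
Proof.
move=> Ux Yd.
have H := bilin_is_derive oU oU idU dF_bilin dF_smooth (@smooth_mx_id R m U) Ux Yd
  (is_derive_cst (const_mx 1) x e).
have E z u : dF z u (const_mx 1) = 'D_u F z by rewrite /dF mxE scale1r.
have N := near_open_eq oU (fun z (_ : U z) => E z (Y z)) Ux.
apply: is_derive_eq (near_eq_is_derive N H) _.
apply: (etrans (congr1 (fun r => _ + r) (bilin0r (dF_bilin Ux) (Y x)))).
rewrite addr0; congr (_ + _); last exact: E.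
rewrite derive_id; apply: derive_open_eq oU _ Ux => z _; exact: E.
Qed.

Lemma sff_smooth e w : smooth_mx U (sff e w).
Proof.
have H1 := along_smooth oU oV FUV Gs Fs Gunit e (smooth_mx_derive oU w Fs).
have H2 := derive_field_smooth (Cs e w).
have H3 : smooth_mx U (fun x => (-1)%:M *m 'D_(C x e w) F x).
  by apply: smooth_mxM => //; exact: smooth_mx_cst.
apply: smooth_mx_eq (smooth_mxD oU H1 H3) => // x Ux.
by rewrite mul_scalar_mx scaleN1r.
Qed.

Lemma along_near_eq e X Y x : U x -> (forall z, U z -> X z = Y z) ->
  nabla e X x = nabla e Y x.
Proof.
move=> Ux XY; exact: (f_equal2 (fun a b => a + christoffel G (F x) ('D_e F x) b)
  (derive_open_eq e oU XY Ux) (XY x Ux)).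
Qed.

Lemma sffC e w x : U x -> sff e w x = sff w e x.
Proof.
move=> Ux.
exact: (f_equal2 (fun a b => a - b) (along_sym oU oV FUV Gs Fs Gsym Gunit e w Ux)
  (congr1 (fun u => 'D_u F x) (CC e w Ux))).
Qed.

Lemma along_field e Y dY x : U x -> is_derive x e Y dY ->
  nabla e (fun z => 'D_(Y z) F z) x = nabla e ('D_(Y x) F) x + 'D_dY F x.
Proof.
move=> Ux Yd; rewrite /levi_civita_along.
have [_ E] := derive_field_is_derive Ux Yd.
apply: etrans (congr1 (fun a => a + _) E) _.
exact: addrAC.
Qed.

(** Torsion-freeness turns nabla_e dF(v) into nabla_v dF(e), commuting nabla_e with nabla_v costs a
    curvature term, and nabla_e dF(e) is A(e, e) + dF(C(e, e)). This is where the Codazzi equation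
    is hidden. *)
Lemma along_second_derivative e v x : U x ->
  nabla e (nabla e ('D_v F)) x = nabla v (sff e e) x
    + (nabla v ('D_(C x e e) F) x + 'D_('D_v (fun z => C z e e) x) F x)
    + riemann G (cst ('D_e F x)) (cst ('D_v F x)) (cst ('D_e F x)) (F x).
Proof.
move=> Ux.
apply: etrans (along_near_eq e Ux
  (fun z Uz => along_sym oU oV FUV Gs Fs Gsym Gunit e v Uz)) _.
apply: etrans (along_curvature oU oV FUV Gs Fs Gunit e v (smooth_mx_derive oU e Fs) Ux) _.
apply: (congr1 (fun r => r + _)).
have E z : nabla e ('D_e F) z = sff e e z + 'D_(C z e e) F z by rewrite /sff subrK.
have Yd := smooth_mx_is_derive v (Cs e e) Ux.
apply: etrans (along_near_eq v Ux (fun z _ => E z)) _.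
apply: etrans (alongD FUV Gs Gunit Ux (smooth_mx_is_derive v (sff_smooth e e) Ux)
  (derive_field_is_derive Ux Yd)) _.
exact: (congr1 (fun r => _ + r) (along_field Ux Yd)).
Qed.

Definition energy (v w x : 'rV[R]_m) : R := bform (G (F x)) ('D_v F x) ('D_w F x).

Lemma energy_is_derive v w x e : U x ->
  is_derive x e (energy v w) (bform (G (F x)) (nabla e ('D_v F) x) ('D_w F x)
    + bform (G (F x)) ('D_v F x) (nabla e ('D_w F) x)).
Proof.
move=> Ux; have vd := smooth_mx_is_derive e (smooth_mx_derive oU v Fs) Ux.
have wd := smooth_mx_is_derive e (smooth_mx_derive oU w Fs) Ux.
exact: (along_compat oV FUV Gs Fs Gsym Gunit Ux vd wd).
Qed.

Lemma energy_smooth v w : smooth U (energy v w).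
Proof.
have H1 := smooth_mx_derive oU v Fs.
have H2 := smooth_trmx oU (smooth_mx_derive oU w Fs).
have H3 := smooth_mx_comp oU FUV Gs Fs.
exact: (smooth_mxM oU (smooth_mxM oU H1 H3) H2 0 0).
Qed.

(** The left side is the derivative at t = 0 of the pulled-back form on v - t C(e, v) at x + t e,
    that is, its covariant derivative with respect to the connection [C]. *)
Lemma energy_first_variation v x e : U x ->
  'D_e (energy v v) x - 2 * energy v (C x e v) x =
  2 * bform (G (F x)) (sff e v x) ('D_v F x).
Proof.
move=> Ux; have [_ E] := energy_is_derive v v e Ux.
apply: etrans (congr1 (fun r => r - _) E) _.
rewrite /energy /sff; have := Gsym (FUV Ux); move: (G (F x)) => g gs.
move: (nabla e ('D_v F) x) ('D_v F x) ('D_(C x e v) F x) => X Fv Fw.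
by rewrite bformBl (bformC Fv X gs) (bformC Fv Fw gs); ring.
Qed.

Lemma energy_second_derivative v x e : U x ->
  'D_e ('D_e (energy v v)) x =
  2 * (bform (G (F x)) (nabla e (nabla e ('D_v F)) x) ('D_v F x)
       + bform (G (F x)) (nabla e ('D_v F) x) (nabla e ('D_v F) x)).
Proof.
move=> Ux; pose X := nabla e ('D_v F).
have Xs : smooth_mx U X.
  exact: (along_smooth oU oV FUV Gs Fs Gunit e (smooth_mx_derive oU v Fs)).
have Xd := smooth_mx_is_derive e Xs Ux.
have vd := smooth_mx_is_derive e (smooth_mx_derive oU v Fs) Ux.
have H := along_compat oV FUV Gs Fs Gsym Gunit Ux Xd vd.
have E z : U z -> 'D_e (energy v v) z = 2 * bform (G (F z)) (X z) ('D_v F z).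
  move=> Uz; have [_ ->] := energy_is_derive v v e Uz.
  have := Gsym (FUV Uz); rewrite -/X; move: (G (F z)) => g gs.
  move: (X z) ('D_v F z) => a b.
  by rewrite (bformC b a gs); ring.
apply: etrans (derive_open_eq e oU E Ux) _.
have [_ HE] := is_deriveZ 2 H.
exact: HE.
Qed.

(* What is left of nabla_e nabla_e dF(v), after commuting derivatives, without
   2 nabla_e dF(C(e, v)) and a tangential part. *)
Definition hessian_term (e v x : 'rV[R]_m) : 'rV[R]_n :=
  nabla v (sff e e) x + sff v (C x e e) x - 2 *: sff e (C x e v) x
  + riemann G (cst ('D_e F x)) (cst ('D_v F x)) (cst ('D_e F x)) (F x).

(** The left side is the second derivative at t = 0 of the pulled-back form on v - t C(e, v) at x +
    t e. On the right, the vector to which dF is applied depends on [C] alone and not on [F]; this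
    allows its removal when id and h are compared. *)
Lemma energy_second_variation v x e : U x ->
  'D_e ('D_e (energy v v)) x - 4 * 'D_e (energy v (C x e v)) x
    + 2 * energy (C x e v) (C x e v) x =
  2 * (bform (G (F x)) (sff e v x) (sff e v x)
       + bform (G (F x)) (hessian_term e v x
           + 'D_('D_v (fun z => C z e e) x + C x v (C x e e)
                 - 2 *: C x e (C x e v)) F x) ('D_v F x)).
Proof.
move=> Ux; have E2 := energy_second_derivative v e Ux.
have [_ E1] := energy_is_derive v (C x e v) e Ux.
apply: etrans (f_equal2 (fun a b => a - 4 * b + _) E2 E1) _.
have D3 p q r : 'D_(p + q - 2 *: r) F x = 'D_p F x + 'D_q F x - 2 *: 'D_r F x.
  by rewrite -scaleNr derive_dirD// derive_dirD// derive_dirZ// scaleNr.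
have -> : nabla e (nabla e ('D_v F)) x = hessian_term e v x
    + 'D_('D_v (fun z => C z e e) x + C x v (C x e e) - 2 *: C x e (C x e v)) F x
    + 2 *: nabla e ('D_(C x e v) F) x.
  apply: etrans (along_second_derivative e v Ux) _.
  apply: etrans _ (congr1 (fun d => hessian_term e v x + d + _) (esym (D3 _ _ _))).
  exact: field_algebra.
rewrite /sff /energy.
have := Gsym (FUV Ux); move: (G (F x)) => g gs.
move: (hessian_term e v x) => h.
move: (nabla e ('D_v F) x) ('D_v F x) ('D_(C x e v) F x) => X Fv Fw.
move: (nabla e ('D_(C x e v) F) x) ('D_(_) F x) => Y Fz.
rewrite !(bformDl, bformBl, bformDr, bformBr, bformZl, bformNl, bformNr).
by rewrite (bformC Fv Y gs) (bformC Fw X gs); ring.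
Qed.

End second_fundamental.

(** * Second-order condition for a semidefinite form along a line *)

Lemma is_derive_quadratic (R : realType) (a b c : R -> R) (t da db dc : R) :
  is_derive t 1 a da -> is_derive t 1 b db -> is_derive t 1 c dc ->
  is_derive t 1 (fun s => a s - 2 * (s * b s) + s * s * c s)
    (da - 2 * (b t + t * db) + (2 * (t * c t) + t * t * dc)).
Proof.
move=> ad bd cd; have idd : is_derive t 1 (id : R -> R) 1 by exact: is_derive_id.
have two : is_derive t 1 (cst 2 : R -> R) 0 by exact: is_derive_cst.
have H := is_deriveD (is_deriveB ad (is_deriveM two (is_deriveM idd bd)))
  (is_deriveM (is_deriveM idd idd) cd).
apply: is_derive_eq H _.
by rewrite !fctE /GRing.scale /=; ring.
Qed.

(* The quadratic form is evaluated on v - t w over the point x + t e: a, b, c are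
   its coefficients on (v, v), (v, w) and (w, w). *)
Lemma psd_second_order (R : realType) (m : nat) (U : set 'rV[R]_m)
    (a b c : 'rV[R]_m -> R) (x e : 'rV[R]_m) :
  open U -> smooth U a -> smooth U b -> smooth U c -> U x ->
  (forall t : R, U (t *: e + x) ->
    0 <= a (t *: e + x) - 2 * t * b (t *: e + x) + t ^+ 2 * c (t *: e + x)) ->
  a x = 0 ->
  'D_e a x - 2 * b x = 0 /\
  0 <= 'D_e ('D_e a) x - 4 * 'D_e b x + 2 * c x.
Proof.
move=> oU as_ bs cs Ux H a0.
have nU : \forall t \near (0 : R), U (t *: e + x).
  have lc : {for (0 : R), continuous (fun t : R => t *: e + x)}.
    apply: differentiable_continuous; apply: differentiableD.
      exact: (@differentiableZl R _ _ (id : R -> R) e).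
    exact: differentiable_cst.
  apply: (lc U); rewrite scale0r add0r; exact: open_nbhs_nbhs.
have line f t : smooth U f -> U (t *: e + x) ->
    is_derive t 1 (fun s => f (s *: e + x)) ('D_e f (t *: e + x)).
  move=> fs Ut; apply: derivative_along_line.
  exact/diff_derivable/(smooth_differentiable fs Ut).
have das := smooth_derive e as_; have dbs := smooth_derive e bs.
have dcs := smooth_derive e cs.
have U0 : U (0 *: e + x) by rewrite scale0r add0r.
pose l (f : 'rV[R]_m -> R) (t : R) : R := f (t *: e + x).
have l0 f : l f 0 = f x by rewrite /l scale0r add0r.
pose f (t : R) : R := l a t - 2 * (t * l b t) + t * t * l c t.
pose f1 (t : R) : R := l ('D_e a) t - 2 * (l b t + t * l ('D_e b) t)
  + (2 * (t * l c t) + t * t * l ('D_e c) t).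
have fd : \forall t \near (0 : R), is_derive (t : R) 1 f (f1 t).
  have : \forall t \near (0 : R), U (t *: e + x) by exact: nU.
  apply: filterS => t Ut.
  exact: (is_derive_quadratic (line _ _ as_ Ut) (line _ _ bs Ut) (line _ _ cs Ut)).
have f1d : is_derive (0 : R) 1 f1 ('D_e ('D_e a) x - 4 * 'D_e b x + 2 * c x).
  (* [f1] is regrouped into the shape of [f], so that [is_derive_quadratic] also computes its
     derivative. *)
  have E : f1 = (fun t => (l ('D_e a) t - 2 * l b t) - 2 * (t * (l ('D_e b) t - l c t))
      + t * t * l ('D_e c) t).
    by apply/funext => t; rewrite /f1; ring.
  rewrite E; have ad := line _ _ das U0; have bd := line _ _ bs U0.
  have cd := line _ _ cs U0; have dbd := line _ _ dbs U0; have dcd := line _ _ dcs U0.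
  have two : is_derive (0 : R) 1 (cst 2 : R -> R) 0 by exact: is_derive_cst.
  have A := is_deriveB ad (is_deriveM two bd); have B := is_deriveB dbd cd.
  apply: is_derive_eq (is_derive_quadratic A B dcd) _.
  rewrite /l !fctE !scale0r !add0r.
  move: ('D_e ('D_e a) x) ('D_e ('D_e b) x) ('D_e b x) ('D_e c x) (b x) (c x).
  by move=> r1 r2 r3 r4 r5 r6; rewrite /GRing.scale /=; ring.
have f0 : f 0 = 0 by rewrite /f !l0 a0; ring.
have f_ge0 : \forall t \near (0 : R), 0 <= f t.
  have : \forall t \near (0 : R), U (t *: e + x) by exact: nU.
  apply: filterS => t Ut; have := H t Ut; rewrite -!/(l _ t) /f.
  by rewrite expr2 -mulrA.
have [f10 d0] := second_derivative_test fd f1d f0 f_ge0; split=> //.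
by move: f10; rewrite /f1 !l0 => <-; ring.
Qed.

(** * Differentiating the vanishing trace of A *)

Lemma bilin_frame_sum (R : realType) (n r : nat) (e : 'I_n -> 'rV[R]_n)
    (B : 'rV[R]_n -> 'rV[R]_n -> 'rV[R]_r) (T : 'M[R]_n) : bilin B ->
  \sum_k \sum_l T k l *: B (e k) (e l) =
  \sum_i \sum_j ((\matrix_k e k)^T *m T *m (\matrix_k e k)) i j *:
    B (basisv R i) (basisv R j).
Proof.
move=> BB; transitivity (\sum_k \sum_l \sum_i \sum_j
    (T k l * (e k 0 i * e l 0 j)) *: B (basisv R i) (basisv R j)).
  apply: eq_bigr => k _; apply: eq_bigr => l _; rewrite (bilin_basis BB) scaler_sumr.
  apply: eq_bigr => i _; rewrite scaler_sumr; apply: eq_bigr => j _.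
  by rewrite scalerA.
rewrite (eq_bigr _ (fun k _ => exchange_big _ _ _ _ _ _)) /= exchange_big.
apply: eq_bigr => i _.
rewrite (eq_bigr _ (fun k _ => eq_bigr _ (fun l _ => erefl))) /=.
under eq_bigr => k _ do rewrite exchange_big.
rewrite exchange_big; apply: eq_bigr => j _ /=.
rewrite !mxE scaler_suml exchange_big; apply: eq_bigr => l _.
rewrite !mxE mulr_suml scaler_suml; apply: eq_bigr => k _.
by rewrite !mxE mulrCA mulrA.
Qed.

Lemma hessian_sum_algebra (R : realType) (n r : nat) (a b d f : 'I_n -> 'rV[R]_r)
    (b' d' : 'rV[R]_r) :
  \sum_k a k = 2 *: d' -> \sum_k b k = b' -> \sum_k d k = d' ->
  \sum_k (a k + b k - 2 *: d k + f k) = b' + \sum_k f k.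
Proof.
move=> Ea Eb Ed; rewrite !big_split /= sumrN -scaler_sumr Ea Eb Ed.
by rewrite (addrC (2 *: d')) addrK.
Qed.

Lemma sum_oppm (R : realType) (n r : nat) (M : 'M[R]_n) (B : 'I_n -> 'I_n -> 'rV[R]_r) :
  \sum_i \sum_j (- M) i j *: B i j = - \sum_i \sum_j M i j *: B i j.
Proof.
rewrite -sumrN; apply: eq_bigr => i _; rewrite -sumrN; apply: eq_bigr => j _.
by rewrite mxE scaleNr.
Qed.

Lemma frame_gram (R : realType) (n : nat) (G : 'M[R]_n) (e : 'I_n -> 'rV[R]_n) i j :
  ((\matrix_k e k) *m G *m (\matrix_k e k)^T) i j = bform G (e i) (e j).
Proof.
rewrite /bform !mxE; apply: eq_bigr => k _; rewrite !mxE; congr (_ * _).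
by apply: eq_bigr => l _; rewrite mxE.
Qed.

Lemma linear_field_algebra (R : realType) (n : nat) (a : R) (p q r p' q' r' : 'rV[R]_n) :
  a *: p + p' + (a *: q + q') - (a *: r + r') = a *: (p + q - r) + (p' + q' - r').
Proof. by apply/rowP => k; rewrite !mxE; ring. Qed.

Section trace_identity.
Context {R : realType} {m n : nat}.
Variables (U : set 'rV[R]_m) (V : set 'rV[R]_n) (F : 'rV[R]_m -> 'rV[R]_n).
Variables (G : 'rV[R]_n -> 'M[R]_n) (g : 'rV[R]_m -> 'M[R]_m).
Hypotheses (oU : open U) (oV : open V) (FUV : forall x, U x -> V (F x)).
Hypotheses (Gs : smooth_mx V G) (Fs : smooth_mx U F).
Hypotheses (Gsym : forall y, V y -> (G y)^T = G y).
Hypothesis Gunit : forall y, V y -> G y \in unitmx.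
Hypotheses (gs : smooth_mx U g) (gsym : forall x, U x -> (g x)^T = g x).
Hypothesis gunit : forall x, U x -> g x \in unitmx.

Local Notation nabla := (levi_civita_along G F).
Local Notation C := (christoffel g).
Local Notation A := (sff F G C).

Let Cb := christoffel_bilin gs gunit.
Let CC x u v (Ux : U x) := christoffelC oU gs gsym gunit u v Ux.
Let Cs := christoffel_smooth oU gs gunit.

Lemma alongZ e a X dX x : U x -> is_derive x e X dX ->
  nabla e (fun z => a *: X z) x = a *: nabla e X x.
Proof.
move=> Ux Xd; have Hb := christoffel_bilin Gs Gunit (FUV Ux).
have [_ E] := is_deriveZ a Xd; have [_ E'] := Xd.
apply: etrans (f_equal2 (fun p q => p + q) E (bilinZr Hb a ('D_e F x) (X x))) _.
by rewrite -E' -scalerDr.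
Qed.

Lemma sff_symmetric u w x : U x -> A u w x = A w u x.
Proof. exact: (sffC oU oV FUV Gs Fs Gsym Gunit CC). Qed.

Lemma sff_bilin x : U x -> bilin (fun u w => A u w x).
Proof.
move=> Ux.
have L a u u' w : A (a *: u + u') w x = a *: A u w x + A u' w x.
  have Hb := christoffel_bilin Gs Gunit (FUV Ux).
  have dd := smooth_mx_differentiable (smooth_mx_derive oU w Fs) Ux.
  have dF := smooth_mx_differentiable Fs Ux.
  have E1 := derive_dirP a u u' dd; have E2 := derive_dirP a u u' dF.
  have E3 := Hb.1 a ('D_u F x) ('D_u' F x) ('D_w F x).
  have E4 := (Cb Ux).1 a u u' w.
  have E5 := derive_dirP a (C x u w) (C x u' w) dF.
  rewrite /sff /levi_civita_along E1 E2 E3 E4 E5.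
  exact: linear_field_algebra.
by split=> [//|a u w w']; rewrite !(sff_symmetric u)// L.
Qed.

(** Makes [bilin_trace] applicable to nabla_v A. As nabla_v acts on fields, the bilinearity of [A]
    is used on all of [U] and not just at [x]. *)
Lemma nabla_sff_bilin v x : U x -> bilin (fun u w => nabla v (A u w) x).
Proof.
move=> Ux.
have sd u w := smooth_mx_is_derive v (sff_smooth oU oV FUV Gs Fs Gunit Cs u w) Ux.
have H a u w u' w' u1 w1 :
    (forall z, U z -> A u1 w1 z = a *: A u w z + A u' w' z) ->
    nabla v (A u1 w1) x = a *: nabla v (A u w) x + nabla v (A u' w') x.
  move=> E; have HE := along_near_eq F G oU v Ux E.

  apply: etrans HE _.
  have Zd : is_derive x v (fun z => a *: A u w z) (a *: 'D_v (A u w) x).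
    exact: is_deriveZ.
  have HH := alongD FUV Gs Gunit Ux Zd (sd u' w').
  apply: etrans HH _.
  exact: (congr1 (fun r => r + _) (alongZ a Ux (sd u w))).
split=> [a u u' w|a u w w']; apply: H => z Uz.
  exact: (sff_bilin Uz).1.
exact: (sff_bilin Uz).2.
Qed.

Let P x := invmx (g x).

(** From differentiating P g = 1, an identity on all of [U]. *)
Let P_derive v x : U x -> 'D_v P x = - (P x *m 'D_v g x *m P x).
Proof.
move=> Ux; have Ps := smooth_invmx oU gs gunit.
have H := is_derive_mulmx (smooth_mx_is_derive v Ps Ux) (smooth_mx_is_derive v gs Ux).
have E z : U z -> invmx (g z) *m g z = 1%:M by move=> /gunit; exact: mulVmx.
have [_ D1] := H; have D0 := derive_open_eq v oU E Ux.
have Z : 'D_v P x *m g x + P x *m 'D_v g x = 0.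
  apply: etrans (esym D1) _; apply: etrans D0 _; exact: derive_cst.
have := congr1 (fun M => M *m P x) Z; rewrite mulmxDl mul0mx mulmxK ?gunit//.
by move=> /eqP; rewrite addr_eq0 => /eqP.
Qed.

Hypothesis H0 : forall x, U x ->
  \sum_i \sum_j invmx (g x) i j *: A (basisv R i) (basisv R j) x = 0.

(* Differentiate the vanishing trace of A: only the derivative of the inverse metric
   is left. *)
Lemma trace_nabla v x : U x ->
  \sum_i \sum_j invmx (g x) i j *: nabla v (A (basisv R i) (basisv R j)) x =
  - \sum_i \sum_j 'D_v P x i j *: A (basisv R i) (basisv R j) x.
Proof.
move=> Ux; have Ps := smooth_invmx oU gs gunit.
have Hb := christoffel_bilin Gs Gunit (FUV Ux).
pose a i j := A (basisv R i) (basisv R j).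
have as_ i j : smooth_mx U (a i j) by exact: (sff_smooth oU oV FUV Gs Fs Gunit Cs).
(* The Christoffel part of nabla_v is linear in the field, so its trace vanishes with that of [A];
   only plain derivatives remain. *)
have G0 : \sum_i \sum_j invmx (g x) i j *: christoffel G (F x) ('D_v F x) (a i j x) = 0.
  apply: etrans (etrans (congr1 (christoffel G (F x) ('D_v F x)) (H0 Ux))
    (bilin0r Hb ('D_v F x))).
  apply: esym; apply: etrans (bilin_sumr Hb _ _ _) _; apply: eq_bigr => i _.
  apply: etrans (bilin_sumr Hb _ _ _) _; apply: eq_bigr => j _.
  exact: (bilinZr Hb).
have D0 : \sum_i \sum_j ('D_v P x i j *: a i j x + invmx (g x) i j *: 'D_v (a i j) x) = 0.
  apply/rowP => k; rewrite [RHS]mxE.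
  have E z : U z -> (\sum_i \sum_j ((fun z => P z i j) * (fun z => a i j z 0 k))) z = 0.
    move=> Uz; have := congr1 (fun r : 'rV_n => r 0 k) (H0 Uz); rewrite [RHS]mxE => <-.
    rewrite fct_sumE summxE; apply: eq_bigr => i _; rewrite fct_sumE summxE.
    by apply: eq_bigr => j _; rewrite mxE.
  have pd i j : is_derive x v (fun z => P z i j) ('D_v P x i j).
    exact: (is_derive_mxP P x v _).1 (smooth_mx_is_derive v Ps Ux) i j.
  have ad i j : is_derive x v (fun z => a i j z 0 k) ('D_v (a i j) x 0 k).
    exact: (is_derive_mxP (a i j) x v _).1 (smooth_mx_is_derive v (as_ i j) Ux) 0 k.
  have S1 := is_derive_sum (fun i => is_derive_sum (fun j => is_deriveM (pd i j) (ad i j))).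
  have [_ S2] := S1; have S3 := derive_open_eq v oU E Ux.
  have S4 := etrans (esym S2) (etrans S3 (derive_cst (0 : R) x v)).
  rewrite -[RHS]S4 summxE; apply: eq_bigr => i _; rewrite summxE.
  apply: eq_bigr => j _; rewrite mxE [X in X + _]mxE [X in _ + X]mxE addrC.
  congr (_ + _); exact: mulrC.
apply/eqP; rewrite -addr_eq0; apply/eqP.
rewrite -[RHS](addr0 (0 : 'rV_n)) -[in X in _ = X + _]D0 -[X in _ = _ + X]G0.
rewrite addrC -!big_split; apply: eq_bigr => i _.
rewrite -!big_split; apply: eq_bigr => j _ /=.
by rewrite -addrA -scalerDr.
Qed.

(** Equivalently, the covariant derivative nabla_v(A(e_k, e_k)) - 2 A(e_k, C(v, e_k)) has zero
    trace. The derivative of the inverse metric produces ['D_v g] between frame vectors;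
    [metric_derive] splits it into two terms, which contribute equally because [A] is symmetric. *)
Lemma trace_hessian (e : 'I_m -> 'rV[R]_m) v x : U x ->
  orthonormal_frame (g x) e ->
  \sum_k nabla v (A (e k) (e k)) x = 2 *: \sum_k A (e k) (C x v (e k)) x.
Proof.
move=> Ux eo; have Ab := sff_bilin Ux.
rewrite (bilin_trace eo (nabla_sff_bilin v Ux)) trace_nabla//.
rewrite P_derive// /P (orthonormal_frame_invmx eo).
have md k l := metric_derive oU gs gsym gunit (e k) (e l) v Ux.
move: ('D_v g x) md => Dg md.
pose T := (\matrix_k e k) *m Dg *m (\matrix_k e k)^T.
have -> : \sum_i \sum_j (- ((\matrix_k e k)^T *m \matrix_k e k *m Dg *m
    ((\matrix_k e k)^T *m \matrix_k e k))) i j *: A (basisv R i) (basisv R j) x =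
  - \sum_k \sum_l T k l *: A (e k) (e l) x.
  have -> : (\matrix_k e k)^T *m \matrix_k e k *m Dg *m
    ((\matrix_k e k)^T *m \matrix_k e k) = (\matrix_k e k)^T *m T *m \matrix_k e k.
    by rewrite /T !mulmxA.
  apply: etrans (sum_oppm _ _) (congr1 -%R _).
  exact: (esym (bilin_frame_sum e T Ab)).
rewrite opprK; pose S := \sum_k A (e k) (C x v (e k)) x.
have S1 k : \sum_l bform (g x) (C x v (e k)) (e l) *: A (e k) (e l) x =
    A (e k) (C x v (e k)) x.
  rewrite [in RHS](orthonormal_frame_expansion eo (C x v (e k))).
  apply: esym; apply: etrans (bilin_sumr Ab _ _ _) _; apply: eq_bigr => l _.
  exact: (bilinZr Ab).
have S2 : \sum_k \sum_l bform (g x) (e k) (C x v (e l)) *: A (e k) (e l) x = S.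
  rewrite exchange_big; apply: eq_bigr => k _; rewrite -[RHS]S1.
  apply: eq_bigr => l _; rewrite (sff_symmetric _ _ Ux).
  exact: (congr1 (fun r => r *: _) (bformC _ _ (gsym Ux))).
rewrite scaler_nat mulr2n.
apply: etrans (f_equal2 (fun p q => p + q) (eq_bigr _ (fun k _ => S1 k)) S2).
rewrite -big_split; apply: eq_bigr => k _; rewrite -big_split; apply: eq_bigr => l _.
by rewrite /T frame_gram md scalerDl.
Qed.

(** The terms -2 A(e_k, C(e_k, v)) cancel the trace of nabla_v A given by [trace_hessian]. The terms
    A(C(e_k, e_k), v) cannot be removed yet; they are left to the first-order condition. *)
Lemma sum_hessian_term (e : 'I_m -> 'rV[R]_m) v x : U x ->
  orthonormal_frame (g x) e ->
  \sum_k hessian_term F G C (e k) v x =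
  \sum_k A (C x (e k) (e k)) v x
  + \sum_k riemann G (cst ('D_(e k) F x)) (cst ('D_v F x)) (cst ('D_(e k) F x)) (F x).
Proof.
move=> Ux eo; have T := trace_hessian v Ux eo.
have E1 : \sum_k A v (C x (e k) (e k)) x = \sum_k A (C x (e k) (e k)) v x.
  by apply: eq_bigr => k _; exact: sff_symmetric.
have E2 : \sum_k A (e k) (C x (e k) v) x = \sum_k A (e k) (C x v (e k)) x.
  by apply: eq_bigr => k _; exact: (congr1 (fun u => A (e k) u x) (CC _ _ Ux)).
rewrite /hessian_term; exact: (hessian_sum_algebra _ T E1 E2).
Qed.

End trace_identity.

Lemma bform_sum_sum (R : realType) (n : nat) (I J : finType) (G : 'M[R]_n)
    (a : I -> R) (b : J -> R) (X : I -> 'rV[R]_n) (Y : J -> 'rV[R]_n) :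
  bform G (\sum_i a i *: X i) (\sum_j b j *: Y j) =
  \sum_i \sum_j a i * b j * bform G (X i) (Y j).
Proof.
rewrite bform_suml; apply: eq_bigr => i _; rewrite bform_sumr; apply: eq_bigr => j _.
by rewrite bformZl bformZr mulrA.
Qed.

Lemma bform_pullback (R : realType) (m n : nat) (h : 'rV[R]_m -> 'rV[R]_n)
    (g : 'rV[R]_n -> 'M[R]_n) (x u v : 'rV[R]_m) : differentiable h x ->
  bform (pullback h g x) u v = bform (g (h x)) ('D_u h x) ('D_v h x).
Proof.
move=> hd; rewrite (derive_basis_sum u hd) (derive_basis_sum v hd) bform_sum_sum.
rewrite {1}(rV_basis_sum u) {1}(rV_basis_sum v) bform_sum_sum.
by apply: eq_bigr => i _; apply: eq_bigr => j _; rewrite bform_basis mxE.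
Qed.

Lemma bform_block (R : realType) (m n : nat) (A : 'M[R]_m) (B : 'M[R]_n)
    (u v : 'rV[R]_m) (u' v' : 'rV[R]_n) :
  bform (block_mx A 0 0 B) (row_mx u u') (row_mx v v') = bform A u v + bform B u' v'.
Proof.
rewrite /bform mul_row_block !mulmx0 addr0 add0r tr_row_mx mul_row_col.
by rewrite mxE.
Qed.

Section energy_koszul.
Context {R : realType} {m n : nat}.
Variables (U : set 'rV[R]_m) (V : set 'rV[R]_n) (F : 'rV[R]_m -> 'rV[R]_n).
Variable G : 'rV[R]_n -> 'M[R]_n.
Hypotheses (oU : open U) (oV : open V) (FUV : forall x, U x -> V (F x)).
Hypotheses (Gs : smooth_mx V G) (Fs : smooth_mx U F).
Hypotheses (Gsym : forall y, V y -> (G y)^T = G y).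
Hypothesis Gunit : forall y, V y -> G y \in unitmx.

(** The connection along [F] is metric and torsion-free on the fields dF(v), so the usual derivation
    of the Koszul formula applies to the pulled-back form, whether or not it is nondegenerate. *)
Lemma energy_koszul e v u x : U x ->
  2 * bform (G (F x)) (levi_civita_along G F e ('D_v F) x) ('D_u F x) =
  'D_e (energy F G v u) x + 'D_v (energy F G e u) x - 'D_u (energy F G e v) x.
Proof.
move=> Ux; have D a b w := energy_is_derive oU oV FUV Gs Fs Gsym Gunit a b w Ux.
have [_ E1] := D v u e; have [_ E2] := D e u v; have [_ E3] := D e v u.
apply: esym; apply: etrans (f_equal2 (fun p q => p - q) (f_equal2 (fun p q => p + q) E1 E2) E3) _.
have S a b := along_sym oU oV FUV Gs Fs Gsym Gunit a b Ux.
rewrite (S v e) (S u e) (S u v); have := Gsym (FUV Ux).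
move: (G (F x)) (levi_civita_along G F e ('D_v F) x) => g X gs.
move: (levi_civita_along G F e ('D_u F) x) (levi_civita_along G F v ('D_u F) x) => Y Z.
move: ('D_u F x) ('D_v F x) ('D_e F x) => Fu Fv Fe.
by rewrite (bformC Fv Y gs); ring.
Qed.

End energy_koszul.

(** * Product metrics *)

Lemma row_mx_is_derive (R : realType) (V : normedModType R) (m n : nat)
    (f : V -> 'rV[R]_m) (g : V -> 'rV[R]_n) (x v : V) df dg :
  is_derive x v f df -> is_derive x v g dg ->
  is_derive x v (fun y => row_mx (f y) (g y)) (row_mx df dg).
Proof.
move=> /is_derive_mxP fd /is_derive_mxP gd; apply/is_derive_mxP => i j.
have [k ->|k ->] := split_ordP j.
  rewrite row_mxEl (_ : (fun y => _) = fun y => f y i k)//.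
  by apply/funext => y; rewrite row_mxEl.
rewrite row_mxEr (_ : (fun y => _) = fun y => g y i k)//.
by apply/funext => y; rewrite row_mxEr.
Qed.

Lemma lsubmx_is_derive (R : realType) (m n : nat) (x v : 'rV[R]_(m + n)) :
  is_derive x v (lsubmx : 'rV[R]_(m + n) -> 'rV[R]_m) (lsubmx v).
Proof.
apply/is_derive_mxP => i j; rewrite mxE.
rewrite (_ : (fun y => _) = fun y : 'rV[R]_(m + n) => y i (lshift n j)).
  exact: (is_derive_mxP id x v v).1 (is_derive_id x v) i (lshift n j).
by apply/funext => y; rewrite mxE.
Qed.

Lemma rsubmx_is_derive (R : realType) (m n : nat) (x v : 'rV[R]_(m + n)) :
  is_derive x v (rsubmx : 'rV[R]_(m + n) -> 'rV[R]_n) (rsubmx v).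
Proof.
apply/is_derive_mxP => i j; rewrite mxE.
rewrite (_ : (fun y => _) = fun y : 'rV[R]_(m + n) => y i (rshift m j)).
  exact: (is_derive_mxP id x v v).1 (is_derive_id x v) i (rshift m j).
by apply/funext => y; rewrite mxE.
Qed.

Lemma smooth_lsubmx (R : realType) (m n : nat) (W : set 'rV[R]_(m + n)) :
  open W -> smooth_mx W (lsubmx : 'rV[R]_(m + n) -> 'rV[R]_m).
Proof.
move=> oW i j; rewrite ord1.
apply: (smooth_eq oW (f := fun z : 'rV[R]_(m + n) => z 0 (lshift n j))) => [x _|].
  by rewrite mxE.
by move=> k; exact: Ck_coord.
Qed.

Lemma smooth_rsubmx (R : realType) (m n : nat) (W : set 'rV[R]_(m + n)) :
  open W -> smooth_mx W (rsubmx : 'rV[R]_(m + n) -> 'rV[R]_n).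
Proof.
move=> oW i j; rewrite ord1.
apply: (smooth_eq oW (f := fun z : 'rV[R]_(m + n) => z 0 (rshift m j))) => [x _|].
  by rewrite mxE.
by move=> k; exact: Ck_coord.
Qed.

Lemma bform_block_sub (R : realType) (m n : nat) (A : 'M[R]_m) (B : 'M[R]_n)
    (u v : 'rV[R]_(m + n)) :
  bform (block_mx A 0 0 B) u v =
  bform A (lsubmx u) (lsubmx v) + bform B (rsubmx u) (rsubmx v).
Proof. by rewrite -{1}(hsubmxK u) -{1}(hsubmxK v) bform_block. Qed.

Section product_metric.
Context {R : realType} {m n : nat}.
Variables (U : set 'rV[R]_m) (V : set 'rV[R]_n).
Variables (gM : 'rV[R]_m -> 'M[R]_m) (gN : 'rV[R]_n -> 'M[R]_n).
Hypotheses (oU : open U) (oV : open V).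
Hypotheses (gMs : smooth_mx U gM) (gNs : smooth_mx V gN).
Hypotheses (gMu : forall x, U x -> gM x \in unitmx).
Hypotheses (gNu : forall y, V y -> gN y \in unitmx).

Let W : set 'rV[R]_(m + n) := [set z | U (lsubmx z) /\ V (rsubmx z)].

Let oW : open W.
Proof.
apply: openI.
  apply: (open_comp (f := lsubmx : 'rV[R]_(m + n) -> 'rV[R]_m)) => // z _.
  by apply: differentiable_continuous; exact: differentiable_lsubmx.
apply: (open_comp (f := rsubmx : 'rV[R]_(m + n) -> 'rV[R]_n)) => // z _.
by apply: differentiable_continuous; exact: differentiable_rsubmx.
Qed.

Let prod_smooth : smooth_mx W (prod_metric gM gN).
Proof.
have lU z : W z -> U (lsubmx z) by case.
have rV z : W z -> V (rsubmx z) by case.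
have Ms := smooth_mx_comp oW lU gMs (smooth_lsubmx oW).
have Ns := smooth_mx_comp oW rV gNs (smooth_rsubmx oW).
move=> i j; rewrite /prod_metric.
have [i' ->|i' ->] := split_ordP i; have [j' ->|j' ->] := split_ordP j.
- by apply: smooth_eq (Ms i' j') => // z _; rewrite block_mxEul.
- by apply: smooth_eq (smooth_cst W 0) => // z _; rewrite block_mxEur mxE.
- by apply: smooth_eq (smooth_cst W 0) => // z _; rewrite block_mxEdl mxE.
- by apply: smooth_eq (Ns i' j') => // z _; rewrite block_mxEdr.
Qed.

Let prod_unit z : W z -> prod_metric gM gN z \in unitmx.
Proof.
move=> [/gMu Mu /gNu Nu]; rewrite /prod_metric unitmxE det_ublock unitrM.
by rewrite -!unitmxE Mu Nu.
Qed.

Let prod_derive z X u v : W z -> bform ('D_X (prod_metric gM gN) z) u v =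
  bform ('D_(lsubmx X) gM (lsubmx z)) (lsubmx u) (lsubmx v)
  + bform ('D_(rsubmx X) gN (rsubmx z)) (rsubmx u) (rsubmx v).
Proof.
move=> Wz; have [Uz Vz] := Wz.
have ld := lsubmx_is_derive z X; have rd := rsubmx_is_derive z X.
have Md : is_derive z X (fun z => gM (lsubmx z)) ('D_(lsubmx X) gM (lsubmx z)).
  have [_ E] := ld; rewrite -E; apply: derive_comp.
    exact: smooth_mx_differentiable Uz.
  exact: differentiable_lsubmx.
have Nd : is_derive z X (fun z => gN (rsubmx z)) ('D_(rsubmx X) gN (rsubmx z)).
  have [_ E] := rd; rewrite -E; apply: derive_comp.
    exact: smooth_mx_differentiable Vz.
  exact: differentiable_rsubmx.
have H1 := bform_is_derive Md (is_derive_cst (lsubmx u) z X) (is_derive_cst (lsubmx v) z X).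
have H2 := bform_is_derive Nd (is_derive_cst (rsubmx u) z X) (is_derive_cst (rsubmx v) z X).
have [_ E] := is_deriveD H1 H2; rewrite !(bform0l, bform0r, addr0) in E.
apply: etrans (esym (derive_bform prod_smooth u v X Wz)) (etrans _ E).
apply: (derive_open_eq X oW _ Wz) => y _.
by rewrite /prod_metric bform_block_sub.
Qed.

(** The Koszul formula of the product is the sum of those of the factors. This is what separates the
    two components of [second_fund]. *)
Lemma christoffel_prod z X Y : U (lsubmx z) -> V (rsubmx z) ->
  christoffel (prod_metric gM gN) z X Y =
  row_mx (christoffel gM (lsubmx z) (lsubmx X) (lsubmx Y))
         (christoffel gN (rsubmx z) (rsubmx X) (rsubmx Y)).
Proof.
move=> Uz Vz; have Wz : W z by [].
apply: (metric_inj prod_unit Wz) => w.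
apply: etrans (christoffel_koszul prod_smooth prod_unit X Y w Wz) _.
apply: etrans (congr1 (fun r => 2^-1 * r) (f_equal2 (fun p q => p - q)
  (f_equal2 (fun p q => p + q) (prod_derive X Y w Wz) (prod_derive Y X w Wz))
  (prod_derive w X Y Wz))) _.
rewrite /prod_metric bform_block_sub row_mxKl row_mxKr.
apply: esym; apply: etrans (f_equal2 (fun p q => p + q)
  (christoffel_koszul gMs gMu (lsubmx X) (lsubmx Y) (lsubmx w) Uz)
  (christoffel_koszul gNs gNu (rsubmx X) (rsubmx Y) (rsubmx w) Vz)) _.
by rewrite -mulrDr opprD addrACA; congr (_ * (_ + _)); rewrite addrACA.
Qed.

End product_metric.

Lemma first_order_algebra (R : realType) (c dM dN qM qN bM bN : R) :
  dM - 2 * qM = 2 * bM -> dN - 2 * qN = 2 * bN ->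
  c * dM - dN - 2 * (c * qM - qN) = 0 -> c * bM - bN = 0.
Proof.
move=> EM EN E; have -> : c * bM - bN = (c * (2 * bM) - 2 * bN) / 2 by field.
by rewrite -EM -EN (_ : _ - _ = 0) ?mul0r// -[RHS]E; ring.
Qed.

(** [Z] is the tangential vector left by [energy_second_variation]; it cancels because it is
    orthogonal to the null vector for the weighted difference. [DZ] and [v'] are [Z] and [v] passed
    through the derivative of the identity. *)
Lemma second_order_algebra (R : realType) (m n : nat) (a : 'M[R]_m) (b : 'M[R]_n)
    (hM Z DZ v v' : 'rV[R]_m) (hN hZ hv : 'rV[R]_n)
    (c ddM ddN dM dN qM qN aM aN DDQ DQ Q : R) :
  ddM - 4 * dM + 2 * qM = 2 * (aM + bform a (hM + DZ) v') -> DZ = Z -> v' = v ->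
  ddN - 4 * dN + 2 * qN = 2 * (aN + bform b (hN + hZ) hv) ->
  c * bform a Z v - bform b hZ hv = 0 ->
  DDQ = c * ddM - ddN -> DQ = c * dM - dN -> Q = c * qM - qN ->
  0 <= DDQ - 4 * DQ + 2 * Q ->
  0 <= c * (aM + bform a hM v) - (aN + bform b hN hv).
Proof.
move=> + EZ Ev EN Z0 -> -> ->; rewrite EZ Ev => EM; rewrite !bformDl in EM EN.
move: Z0 EM EN; move: (bform a hM v) (bform a Z v) (bform b hN hv) (bform b hZ hv).
move=> bM zM bN zN Z0 EM EN E.
have -> : c * (aM + bM) - (aN + bN) =
    (c * (2 * (aM + (bM + zM))) - 2 * (aN + (bN + zN)) - 2 * (c * zM - zN)) / 2.
  by field.
rewrite Z0 -EM -EN mulr0 subr0 divr_ge0//; apply: le_trans E _.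
by rewrite le_eqVlt; apply/orP; left; apply/eqP; ring.
Qed.

Lemma koszul_combine (R : realType) (m n : nat) (a : 'M[R]_m) (b : 'M[R]_n)
    (Y c u : 'rV[R]_m) (X hc hu : 'rV[R]_n) (p1 p2 p3 q1 q2 q3 : R) :
  2 * bform a Y u = p1 + p2 - p3 -> 2 * bform b X hu = q1 + q2 - q3 ->
  bform a c u + bform b hc hu = 2^-1 * (p1 + q1 + (p2 + q2) - (p3 + q3)) ->
  bform a (Y - c) u + bform b (X - hc) hu = 0.
Proof. by rewrite !bformBl => K1 K2 K3; lra. Qed.

(** [HM], [HN] stand for the Hessian terms, [SM], [SN] for the components of A(C(e_k, e_k), v),
    which cancel in the weighted difference, and [RM], [RN] for the curvature terms. *)
Lemma bochner_algebra (R : realType) (m n p : nat) (c : R) (a : 'M[R]_m) (b : 'M[R]_n)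
    (v : 'rV[R]_m) (hv : 'rV[R]_n) (HM SM RM RM' : 'I_p -> 'rV[R]_m)
    (HN SN RN : 'I_p -> 'rV[R]_n) (qM qN : 'I_p -> R) :
  \sum_k HM k = \sum_k SM k + \sum_k RM' k ->
  \sum_k HN k = \sum_k SN k + \sum_k RN k ->
  (forall k, RM' k = RM k) ->
  (forall k, c * bform a (SM k) v - bform b (SN k) hv = 0) ->
  0 <= \sum_k (c * (qM k + bform a (HM k) v) - (qN k + bform b (HN k) hv)) ->
  0 <= \sum_k (c * qM k - qN k) + \sum_k (c * bform a (RM k) v - bform b (RN k) hv).
Proof.
move=> EM EN ER ES H; apply: le_trans H _; rewrite le_eqVlt; apply/orP; left; apply/eqP.
have SM0 : c * bform a (\sum_k SM k) v - bform b (\sum_k SN k) hv = 0.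
  rewrite !bform_suml mulr_sumr -sumrB; apply: big1 => k _; exact: ES.
have E : \sum_k (c * bform a (HM k) v - bform b (HN k) hv) =
    \sum_k (c * bform a (RM k) v - bform b (RN k) hv).
  rewrite !sumrB -!mulr_sumr -!bform_suml EM EN !bformDl (eq_bigr _ (fun k _ => ER k)).
  by rewrite mulrDr opprD addrACA SM0 add0r.
rewrite -E -big_split; apply: eq_bigr => k _ /=; ring.
Qed.

(** * Geometry of a graph *)

Section graph_geometry.
Context {R : realType} {m n : nat}.
Variables (U : set 'rV[R]_m) (V : set 'rV[R]_n).
Variables (gM : 'rV[R]_m -> 'M[R]_m) (gN : 'rV[R]_n -> 'M[R]_n).
Variable h : 'rV[R]_m -> 'rV[R]_n.
Hypotheses (oU : open U) (oV : open V) (hUV : forall x, U x -> V (h x)).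
Hypotheses (gMs : smooth_mx U gM) (gNs : smooth_mx V gN) (hs : smooth_mx U h).
Hypotheses (gMsym : forall x, U x -> (gM x)^T = gM x).
Hypotheses (gNsym : forall y, V y -> (gN y)^T = gN y).
Hypotheses (gMpos : forall x, U x -> posdef (gM x)).
Hypotheses (gNpos : forall y, V y -> posdef (gN y)).

Local Notation g := (graph_metric gM gN h).
Local Notation C := (christoffel g).
Local Notation AM := (sff id gM C).
Local Notation AN := (sff h gN C).

Let gMu x : U x -> gM x \in unitmx. Proof. by move=> /gMpos; exact: posdef_unitmx. Qed.
Let gNu y : V y -> gN y \in unitmx. Proof. by move=> /gNpos; exact: posdef_unitmx. Qed.
Let idU x : U x -> U (id x). Proof. by []. Qed.
Let ids : smooth_mx U (id : 'rV[R]_m -> 'rV[R]_m). Proof. exact: smooth_mx_id. Qed.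

Lemma bform_graph_metric x u v : U x ->
  bform (g x) u v = bform (gM x) u v + bform (gN (h x)) ('D_u h x) ('D_v h x).
Proof.
by move=> Ux; rewrite bform_addm (bform_pullback _ _ _ (smooth_mx_differentiable hs Ux)).
Qed.

Lemma pullback_sym x : U x -> (pullback h gN x)^T = pullback h gN x.
Proof.
move=> Ux; apply/matrixP => i j; rewrite !mxE.
exact: (bformC _ _ (gNsym (hUV Ux))).
Qed.

Lemma graph_metric_sym x : U x -> (g x)^T = g x.
Proof. by move=> Ux; rewrite /graph_metric linearD /= (gMsym Ux) (pullback_sym Ux). Qed.

Lemma graph_metric_posdef x : U x -> posdef (g x).
Proof.
move=> Ux v v0; rewrite (bform_graph_metric _ _ Ux).
exact: (ltr_wpDr (posdef_ge0 _ (gNpos (hUV Ux))) (gMpos Ux v0)).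
Qed.

Lemma graph_metric_smooth : smooth_mx U g.
Proof.
apply: (smooth_mxD oU gMs) => i j.
apply: (smooth_eq oU _ (energy_smooth oU hUV gNs hs (basisv R i) (basisv R j))) => x _.
by rewrite mxE.
Qed.

Let gs := graph_metric_smooth.
Let gsym := graph_metric_sym.
Let gu x : U x -> g x \in unitmx.
Proof. by move=> /graph_metric_posdef; exact: posdef_unitmx. Qed.

Let derive_idE v : 'D_v (id : 'rV[R]_m -> 'rV[R]_m) = cst v.
Proof. by apply/funext => x; rewrite derive_id. Qed.

Lemma energy_idE v w x : energy id gM v w x = bform (gM x) v w.
Proof. by rewrite /energy !derive_id. Qed.

Lemma second_fund_split x v w : U x ->
  second_fund gM gN h x v w = row_mx (AM v w x) (AN v w x).
Proof.
move=> Ux; have Vhx := hUV Ux.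
have Fd w' y : U y -> is_derive y w' (graph_map h) (row_mx w' ('D_w' h y)).
  move=> Uy.
  exact: (row_mx_is_derive (is_derive_id y w') (smooth_mx_is_derive w' hs Uy)).
have D w' y : U y -> 'D_w' (graph_map h) y = row_mx w' ('D_w' h y).
  by move=> Uy; have [_ ->] := Fd w' y Uy.
have DD : 'D_v ('D_w (graph_map h)) x = row_mx 0 ('D_v ('D_w h) x).
  apply: etrans (derive_open_eq v oU (D w) Ux) _.
  have [_ E] := row_mx_is_derive (is_derive_cst w x v)
    (smooth_mx_is_derive v (smooth_mx_derive oU w hs) Ux).
  exact: E.
have lx : lsubmx (graph_map h x) = x by exact: row_mxKl.
have rx : rsubmx (graph_map h x) = h x by exact: row_mxKr.
have CP a b a' b' : christoffel (prod_metric gM gN) (graph_map h x) (row_mx a b) (row_mx a' b') =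
    row_mx (christoffel gM x a a') (christoffel gN (h x) b b').
  apply: etrans (christoffel_prod oU oV gMs gNs gMu gNu _ _ _ _) _.
  - by rewrite lx.
  - by rewrite rx.
  by rewrite lx rx !row_mxKl !row_mxKr.
have LC : levi_civita g (cst v) (cst w) x = C x v w.
  by rewrite levi_civita_cst.
have E1 : second_fund gM gN h x v w =
   row_mx 0 ('D_v ('D_w h) x) + row_mx (christoffel gM x v w)
     (christoffel gN (h x) ('D_v h x) ('D_w h x)) - row_mx (C x v w) ('D_(C x v w) h x).
  rewrite /second_fund /levi_civita_along LC.
  apply: (f_equal2 (fun p q => p - q)) (D _ _ Ux).
  apply: (f_equal2 (fun p q => p + q)) DD _.
  by rewrite (D v x Ux) (D w x Ux); exact: CP.
rewrite E1 add_row_mx -scaleN1r scale_row_mx add_row_mx !scaleN1r.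
(* The differential of the identity is constant, so this component is just the difference of the
   Christoffel symbols of [gM] and of the graph metric. *)
have E2 : AM v w x = 0 + christoffel gM x v w - C x v w.
  by rewrite /sff /levi_civita_along !derive_idE derive_cst !derive_id.
by rewrite E2.
Qed.

(** The graph metric is the sum of the forms pulled back by id and by [h], so the two instances of
    [energy_koszul] add up to its Koszul formula and the tangential part of [A] vanishes. *)
Lemma second_fund_normal x v w u : U x ->
  bform (gM x) (AM v w x) u + bform (gN (h x)) (AN v w x) ('D_u h x) = 0.
Proof.
move=> Ux.
have K1 := energy_koszul oU oU idU gMs ids gMsym gMu v w u Ux.
have K2 := energy_koszul oU oV hUV gNs hs gNsym gNu v w u Ux.
have K := christoffel_koszul gs gu v w u Ux.
have D a b e : bform ('D_e g x) a b =
    'D_e (energy id gM a b) x + 'D_e (energy h gN a b) x.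
  apply: etrans (esym (derive_bform gs a b e Ux)) _.
  have d1 := smooth_is_derive e (energy_smooth oU idU gMs ids a b) Ux.
  have d2 := smooth_is_derive e (energy_smooth oU hUV gNs hs a b) Ux.
  have [_ E] := is_deriveD d1 d2; apply: etrans _ E.
  apply: (derive_open_eq e oU _ Ux) => y Uy.
  apply: etrans (bform_graph_metric _ _ Uy) _.
  exact: (congr1 (fun r => r + _) (esym (energy_idE a b y))).
have K' := etrans K (congr1 (fun r => 2^-1 * r) (f_equal2 (fun p q => p - q)
  (f_equal2 (fun p q => p + q) (D w u v) (D v u w)) (D v w u))).
have EA : AM v w x = levi_civita_along gM id v ('D_w id) x - C x v w.
  exact: (congr1 (fun r => _ - r) (derive_id x (C x v w))).
rewrite EA; rewrite derive_id in K1.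
exact: (koszul_combine K1 K2 (etrans (esym (bform_graph_metric (C x v w) u Ux)) K')).
Qed.

Let Cs := christoffel_smooth oU gs gu.

Hypothesis hmin : forall x, U x -> forall e : 'I_m -> 'rV[R]_m,
  orthonormal_frame (g x) e -> mean_curvature gM gN h x e = 0.

Lemma minimal_split x e : U x -> orthonormal_frame (g x) e ->
  \sum_k AM (e k) (e k) x = 0 /\ \sum_k AN (e k) (e k) x = 0.
Proof.
move=> Ux eo; have := hmin Ux eo; rewrite /mean_curvature.
rewrite (eq_bigr _ (fun k _ => second_fund_split (e k) (e k) Ux)) => E.
have El := congr1 lsubmx E; have Er := congr1 rsubmx E.
rewrite linear_sum linear0 in El; rewrite linear_sum linear0 in Er.
split; [rewrite -[RHS]El|rewrite -[RHS]Er]; apply: eq_bigr => k _.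
  by rewrite /= row_mxKl.
by rewrite /= row_mxKr.
Qed.

(** Rewrites minimality, stated in frames, as an identity between smooth functions on [U]. *)
Let minimal_trace x : U x ->
  \sum_i \sum_j invmx (g x) i j *: AM (basisv R i) (basisv R j) x = 0 /\
  \sum_i \sum_j invmx (g x) i j *: AN (basisv R i) (basisv R j) x = 0.
Proof.
move=> Ux.
(* With no prescribed vectors, this is the mere existence of an orthonormal frame. *)
have [e eo _] := @orthonormal_extension R m (g x) m 0 (fun=> 0) (gsym Ux)
  (graph_metric_posdef Ux) (add0n m) (fun i j (i0 : (i < 0)%N) => False_ind _ (notF i0)).
have [EM EN] := minimal_split Ux eo; split.
  have B := sff_bilin oU oU idU gMs ids gMsym gMu gs gsym gu Ux.
  exact: etrans (esym (bilin_trace eo B)) EM.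
have B := sff_bilin oU oV hUV gNs hs gNsym gNu gs gsym gu Ux.
exact: etrans (esym (bilin_trace eo B)) EN.
Qed.

Variables (c : R) (x v : 'rV[R]_m) (e : 'I_m -> 'rV[R]_m).
Hypotheses (Ux : U x) (eo : orthonormal_frame (g x) e).
Hypothesis c_psd : forall y w, U y ->
  0 <= c * bform (gM y) w w - bform (gN (h y)) ('D_w h y) ('D_w h y).
Hypothesis c_null : c * bform (gM x) v v = bform (gN (h x)) ('D_v h x) ('D_v h x).

Let Q u w y := c * energy id gM u w y - energy h gN u w y.

Let Qs u w : smooth U (Q u w).
Proof.
have s1 := smoothM oU (smooth_cst U c) (energy_smooth oU idU gMs ids u w).
have s2 := smoothM oU (smooth_cst U (-1)) (energy_smooth oU hUV gNs hs u w).
by apply: (smooth_eq oU _ (smoothD oU s1 s2)) => y _; rewrite /Q mulN1r.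
Qed.

Let Q_derive u w z y : U y -> 'D_z (Q u w) y =
  c * 'D_z (energy id gM u w) y - 'D_z (energy h gN u w) y.
Proof.
move=> Uy; have d1 := smooth_is_derive z (energy_smooth oU idU gMs ids u w) Uy.
have d2 := smooth_is_derive z (energy_smooth oU hUV gNs hs u w) Uy.
have [_ E] := is_deriveB (is_deriveZ c d1) d2; exact: E.
Qed.

Let Q_derive2 u w z y : U y -> 'D_z ('D_z (Q u w)) y =
  c * 'D_z ('D_z (energy id gM u w)) y - 'D_z ('D_z (energy h gN u w)) y.
Proof.
move=> Uy; apply: etrans (derive_open_eq z oU (fun y Uy => Q_derive u w z Uy) Uy) _.
have d1 := smooth_is_derive z (smooth_derive z (energy_smooth oU idU gMs ids u w)) Uy.
have d2 := smooth_is_derive z (smooth_derive z (energy_smooth oU hUV gNs hs u w)) Uy.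
have [_ E] := is_deriveB (is_deriveZ c d1) d2; exact: E.
Qed.

Let Q_quadratic u w t y : U y -> 0 <= Q u u y - 2 * t * Q u w y + t ^+ 2 * Q w w y.
Proof.
move=> Uy; have := c_psd (u - t *: w) Uy.
have -> : 'D_(u - t *: w) h y = 'D_u h y - t *: 'D_w h y.
  rewrite -scaleNr; apply: etrans (derive_dirD hs _ _ Uy) _.
  by rewrite (derive_dirZ hs _ _ Uy) scaleNr.
rewrite /Q !energy_idE /energy; have := gMsym Uy; have := gNsym (hUV Uy).
move: (gM y) (gN (h y)) ('D_u h y) ('D_w h y) => a b hu hw bs as_.
rewrite !(bformBl, bformBr, bformZl, bformZr) (bformC hw hu bs) (bformC w u as_).
by move=> H; apply: le_trans H _; rewrite le_eqVlt; apply/orP; left; apply/eqP; ring.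
Qed.

Let S := c *: gM x - pullback h gN x.

(** A null vector of a semidefinite symmetric form lies in its radical. *)
Lemma null_vector_orthogonal w :
  c * bform (gM x) w v - bform (gN (h x)) ('D_w h x) ('D_v h x) = 0.
Proof.
have SE a b : bform S a b = c * bform (gM x) a b - bform (gN (h x)) ('D_a h x) ('D_b h x).
  rewrite bform_subm bform_scalem.
  exact: (congr1 (fun r => _ - r) (bform_pullback _ _ _ (smooth_mx_differentiable hs Ux))).
have Ssym : S^T = S.
  by rewrite /S linearB linearZ /= (gMsym Ux) (pullback_sym Ux).
apply: etrans (esym (SE w v)) _; apply: etrans (bformC w v Ssym) _.
apply: psd_null => // [z|]; first by rewrite SE; exact: c_psd.
by rewrite SE; apply/eqP; rewrite subr_eq0; apply/eqP.
Qed.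

(** The direction [z] is arbitrary because the condition will be used for C(e_k, e_k) rather than
    for frame vectors. *)
Let first_order z :
  c * bform (gM x) (AM z v x) v - bform (gN (h x)) (AN z v x) ('D_v h x) = 0.
Proof.
have Q0 : Q v v x = 0 by rewrite /Q energy_idE; exact: null_vector_orthogonal.
have [E _] := psd_second_order (e := z) oU (Qs v v) (Qs v (C x z v))
  (Qs (C x z v) (C x z v)) Ux (fun t Ut => Q_quadratic _ _ _ Ut) Q0.
have F1 := energy_first_variation C oU oU idU gMs ids gMsym gMu v z Ux.
have F2 := energy_first_variation C oU oV hUV gNs hs gNsym gNu v z Ux.
rewrite derive_id in F1; move: E; rewrite Q_derive// /Q.
exact: first_order_algebra F1 F2.
Qed.

(** The tangential leftover of the second variation is removed by [null_vector_orthogonal], the same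
    vector occurring for id and for [h]. *)
Let second_order z :
  0 <= c * (bform (gM x) (AM z v x) (AM z v x)
            + bform (gM x) (hessian_term id gM C z v x) v)
       - (bform (gN (h x)) (AN z v x) (AN z v x)
            + bform (gN (h x)) (hessian_term h gN C z v x) ('D_v h x)).
Proof.
have Q0 : Q v v x = 0 by rewrite /Q energy_idE; exact: null_vector_orthogonal.
have [_ E] := psd_second_order (e := z) oU (Qs v v) (Qs v (C x z v))
  (Qs (C x z v) (C x z v)) Ux (fun t Ut => Q_quadratic _ _ _ Ut) Q0.
have F1 := energy_second_variation oU oU idU gMs ids gMsym gMu Cs v z Ux.
have F2 := energy_second_variation oU oV hUV gNs hs gNsym gNu Cs v z Ux.
exact: (second_order_algebra F1 (derive_id _ _) (derive_id _ _) F2 (null_vector_orthogonal _)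
  (Q_derive2 v v z Ux) (Q_derive v _ z Ux) erefl E).
Qed.

Lemma bochner_inequality :
  0 <= \sum_k (c * bform (gM x) (AM (e k) v x) (AM (e k) v x)
          - bform (gN (h x)) (AN (e k) v x) (AN (e k) v x))
     + \sum_k (c * bform (gM x) (riemann gM (cst (e k)) (cst v) (cst (e k)) x) v
          - bform (gN (h x)) (riemann gN (cst ('D_(e k) h x)) (cst ('D_v h x))
                                (cst ('D_(e k) h x)) (h x)) ('D_v h x)).
Proof.
have TM := sum_hessian_term oU oU idU gMs ids gMsym gMu gs gsym gu
  (fun y Uy => (minimal_trace Uy).1) v Ux eo.
have TN := sum_hessian_term oU oV hUV gNs hs gNsym gNu gs gsym gu
  (fun y Uy => (minimal_trace Uy).2) v Ux eo.
have S2 := sumr_ge0 (index_enum 'I_m) (P := xpredT) (fun k _ => second_order (e k)).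
have ER k : riemann gM (cst ('D_(e k) id x)) (cst ('D_v id x)) (cst ('D_(e k) id x)) (id x)
    = riemann gM (cst (e k)) (cst v) (cst (e k)) x by rewrite !derive_id.
exact: (bochner_algebra TM TN ER (fun k => first_order _) S2).
Qed.

End graph_geometry.

(** * Sectional curvature bounds without division *)

Section curvature_bounds.
Context {R : realType} {n : nat}.
Variables (V : set 'rV[R]_n) (G : 'rV[R]_n -> 'M[R]_n).
Hypotheses (oV : open V) (Gs : smooth_mx V G).
Hypotheses (Gsym : forall y, V y -> (G y)^T = G y).
Hypothesis Gpos : forall y, V y -> posdef (G y).

Let Gunit y : V y -> G y \in unitmx. Proof. by move=> /Gpos; exact: posdef_unitmx. Qed.

(** Every term of [riemann_cst] in one order is [t] times the same expression as in the other
    order. *)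
Lemma riemann_cst_collinear y t v w : V y ->
  riemann G (cst (t *: v)) (cst v) (cst w) y = 0.
Proof.
move=> Vy; have Cb z := christoffel_bilin Gs Gunit (y := z).
have Cs := christoffel_smooth oV Gs Gunit v w.
apply: etrans (riemann_cst Gs Gunit _ _ _ Vy) _.
have E1 := derive_dirP t v 0 (smooth_mx_differentiable Cs Vy).
rewrite addr0 derive0 addr0 in E1.
have E2 : 'D_v (fun z => christoffel G z (t *: v) w) y =
    t *: 'D_v (fun z => christoffel G z v w) y.
  have [_ E] := is_deriveZ t (smooth_mx_is_derive v Cs Vy).
  apply: etrans _ E; apply: (derive_open_eq v oV _ Vy) => z Vz.
  exact: (bilinZl (Cb z Vz)).
have E3 : christoffel G y v (christoffel G y (t *: v) w) =
    t *: christoffel G y v (christoffel G y v w).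
  apply: etrans (congr1 (christoffel G y v) (bilinZl (Cb y Vy) t v w)) _.
  exact: (bilinZr (Cb y Vy)).
have E4 := bilinZl (Cb y Vy) t v (christoffel G y v w).
apply: etrans (f_equal2 (fun p q => p - q) (f_equal2 (fun p q => p + q) E1 E4)
  (f_equal2 (fun p q => p + q) E2 E3)) _.
exact: subrr.
Qed.

End curvature_bounds.

Lemma not_row_free2 (R : fieldType) (n : nat) (u w : 'rV[R]_n) :
  ~~ row_free (col_mx u w) -> (exists t, u = t *: w) \/ (exists t, w = t *: u).
Proof.
rewrite -kermx_eq0 => /rowV0Pn[z /sub_kermxP zK z0].
rewrite -(hsubmxK z) mul_row_col (mx11_scalar (lsubmx z)) (mx11_scalar (rsubmx z)) in zK.
rewrite !mul_scalar_mx in zK.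
have [a0|a0] := eqVneq (lsubmx z 0 0) 0.
  have [b0|b0] := eqVneq (rsubmx z 0 0) 0.
    move: z0; rewrite -(hsubmxK z) (mx11_scalar (lsubmx z)) (mx11_scalar (rsubmx z)) a0 b0.
    by rewrite !raddf0 row_mx0 eqxx.
  right; exists (- ((rsubmx z 0 0)^-1 * lsubmx z 0 0)).
  rewrite scaleNr -scalerA -scalerN.
  have -> : - (lsubmx z 0 0 *: u) = rsubmx z 0 0 *: w.
    by apply/eqP; rewrite eq_sym -addr_eq0 addrC zK.
  by rewrite scalerA mulVf// scale1r.
left; exists (- ((lsubmx z 0 0)^-1 * rsubmx z 0 0)).
rewrite scaleNr -scalerA -scalerN.
have -> : - (rsubmx z 0 0 *: w) = lsubmx z 0 0 *: u.
  by apply/eqP; rewrite eq_sym -addr_eq0 zK.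
by rewrite scalerA mulVf// scale1r.
Qed.

Definition area (R : realType) (n : nat) (G : 'M[R]_n) (u w : 'rV[R]_n) : R :=
  bform G u u * bform G w w - bform G u w ^+ 2.

(** Strict Cauchy-Schwarz: by independence, the orthogonal component of [u] is nonzero. *)
Lemma area_gt0 (R : realType) (n : nat) (G : 'M[R]_n) (u w : 'rV[R]_n) :
  G^T = G -> posdef G -> row_free (col_mx u w) -> 0 < area G u w.
Proof.
move=> Gs Gp uw; have w0 : w != 0.
  apply: contraTneq uw => ->; rewrite /row_free -addsmxE addsmx0 neq_ltn.
  by rewrite (leq_ltn_trans (rank_leq_row u)).
have ww := Gp w w0.
have z0 : bform G w w *: u - bform G u w *: w != 0.
  apply: contraTneq uw => z0; rewrite -kermx_eq0; apply/rowV0Pn.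
  exists (row_mx (bform G w w)%:M (- bform G u w)%:M).
    apply/sub_kermxP; rewrite mul_row_col !mul_scalar_mx scaleNr; exact: z0.
  apply/eqP => /(congr1 lsubmx); rewrite row_mxKl linear0.
  move=> /matrixP/(_ 0 0); rewrite !mxE eqxx mulr1n => E.
  by rewrite E ltxx in ww.
have := Gp _ z0; rewrite bformBl !bformBr !bformZl !bformZr (bformC w u Gs) /area.
move: ww; set a := bform G u u; set b := bform G u w; set c := bform G w w => c0.
rewrite (_ : _ - _ = c * (a * c - b ^+ 2)); last by ring.
by rewrite pmulr_rgt0.
Qed.

Section sectional_bounds.
Context {R : realType} {n : nat}.
Variables (V : set 'rV[R]_n) (G : 'rV[R]_n -> 'M[R]_n).
Hypotheses (oV : open V) (Gs : smooth_mx V G).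
Hypotheses (Gsym : forall y, V y -> (G y)^T = G y).
Hypothesis Gpos : forall y, V y -> posdef (G y).

Let Gunit y : V y -> G y \in unitmx. Proof. by move=> /Gpos; exact: posdef_unitmx. Qed.

Lemma riemann_degenerate y u w : V y -> ~~ row_free (col_mx u w) ->
  bform (G y) (riemann G (cst u) (cst w) (cst w) y) u = 0 /\ area (G y) u w = 0.
Proof.
move=> Vy /not_row_free2[[t ->]|[t ->]].
  rewrite (riemann_cst_collinear oV Gs Gpos)// bform0l; split=> //.
  by rewrite /area !(bformZl, bformZr); ring.
rewrite (riemann_cstC Gs Gunit _ _ _ Vy) (riemann_cst_collinear oV Gs Gpos)//.
rewrite oppr0 bform0l; split=> //.
by rewrite /area !(bformZl, bformZr); ring.
Qed.

(** The curvature hypotheses concern independent pairs only, but a frame vector may be parallel to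
    the null vector, and images under dh may be dependent or zero. Multiplied out by the Gram
    determinant, the bound persists there with both sides zero. *)
Lemma sectional_ge y u w sigma : V y ->
  (row_free (col_mx u w) -> sigma <= sectional G y u w) ->
  sigma * area (G y) u w <= bform (G y) (riemann G (cst u) (cst w) (cst w) y) u.
Proof.
move=> Vy; have [uw /(_ isT)|/(riemann_degenerate Vy)[-> ->] _] := boolP (row_free _).
  by rewrite /sectional ler_pdivlMr// area_gt0 ?Gsym//; exact: Gpos.
by rewrite mulr0.
Qed.

Lemma sectional_le y u w sigma : V y ->
  (row_free (col_mx u w) -> sectional G y u w <= sigma) ->
  bform (G y) (riemann G (cst u) (cst w) (cst w) y) u <= sigma * area (G y) u w.
Proof.
move=> Vy; have [uw /(_ isT)|/(riemann_degenerate Vy)[-> ->] _] := boolP (row_free _).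
  by rewrite /sectional ler_pdivrMr// area_gt0 ?Gsym//; exact: Gpos.
by rewrite mulr0.
Qed.

Lemma riemann_cst_swap y u w : V y ->
  bform (G y) (riemann G (cst w) (cst u) (cst w) y) u =
  - bform (G y) (riemann G (cst u) (cst w) (cst w) y) u.
Proof. by move=> Vy; rewrite (riemann_cstC Gs Gunit _ _ _ Vy) bformNl. Qed.

End sectional_bounds.

(** * Contradiction at a null vector *)

(** The right side exceeds the left by c t - s. Here s and t are the squared norms of the two
    components of A(e_k, v). *)
Lemma scale_difference_le (R : realType) (c s t : R) :
  s <= c * t -> c * s - t <= (c - 1) * (s + t).
Proof. lra. Qed.

(** Here p_k = g_M(e_k, e_k), q_k = g_N(dh e_k, dh e_k) and r_k = g_M(v, e_k), with g_M(v, v) = 1.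
    Since g_N(dh v, dh v) = c and g_N(dh v, dh e_k) = c r_k, the Gram determinants are p_k - r_k^2
    and c q_k - (c r_k)^2. *)
Lemma curvature_sum_le (R : realType) (m : nat) (c sigma : R)
    (p q r RM RN : 'I_m -> R) : 0 < c ->
  (forall k, sigma * (p k - r k ^+ 2) <= - RM k) ->
  (forall k, - RN k <= sigma * (c * q k - (c * r k) ^+ 2)) ->
  \sum_k r k ^+ 2 = (1 + c)^-1 ->
  \sum_k (c * RM k - RN k) <=
    - (sigma * c * (\sum_k (p k - q k) + (c - 1) / (1 + c))).
Proof.
move=> c0 HM HN Hr.
have -> : - (sigma * c * (\sum_k (p k - q k) + (c - 1) / (1 + c))) =
    \sum_k (sigma * (c * q k - (c * r k) ^+ 2) - c * (sigma * (p k - r k ^+ 2))).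
  rewrite -Hr mulr_sumr -big_split mulr_sumr -sumrN; apply: eq_bigr => k _ /=.
  ring.
apply: ler_sum => k _; have := HN k.
have : c * (sigma * (p k - r k ^+ 2)) <= c * - RM k by rewrite ler_pM2l.
lra.
Qed.

Section local_rigidity.
Context {R : realType} {m n : nat}.
Variables (U : set 'rV[R]_m) (V : set 'rV[R]_n).
Variables (gM : 'rV[R]_m -> 'M[R]_m) (gN : 'rV[R]_n -> 'M[R]_n).
Variable h : 'rV[R]_m -> 'rV[R]_n.
Hypotheses (oU : open U) (oV : open V) (hUV : forall x, U x -> V (h x)).
Hypotheses (gMs : smooth_mx U gM) (gNs : smooth_mx V gN) (hs : smooth_mx U h).
Hypotheses (gMsym : forall x, U x -> (gM x)^T = gM x).
Hypotheses (gNsym : forall y, V y -> (gN y)^T = gN y).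
Hypotheses (gMpos : forall x, U x -> posdef (gM x)).
Hypotheses (gNpos : forall y, V y -> posdef (gN y)).

Local Notation g := (graph_metric gM gN h).
Local Notation C := (christoffel g).
Local Notation AM := (sff id gM C).
Local Notation AN := (sff h gN C).

Hypothesis hmin : forall x, U x -> forall e : 'I_m -> 'rV[R]_m,
  orthonormal_frame (g x) e -> mean_curvature gM gN h x e = 0.
Variables (c sigma kappa : R) (x : 'rV[R]_m).
Hypotheses (m_gt1 : (1 < m)%N) (n_lt_m : (n < m)%N).
Hypotheses (sigma_gt0 : 0 < sigma) (kappa_gt1 : 1 < kappa ^+ 2).
Hypotheses (c_gt0 : 0 < c) (c_le : c <= kappa ^+ 2) (Ux : U x).
Hypothesis c_psd : forall y w, U y ->
  0 <= c * bform (gM y) w w - bform (gN (h y)) ('D_w h y) ('D_w h y).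
Hypothesis secM : forall u w, row_free (col_mx u w) -> sigma <= sectional gM x u w.
Hypothesis secN : forall u w, row_free (col_mx u w) -> sectional gN (h x) u w <= sigma.
Hypothesis A_bound : forall e : 'I_m -> 'rV[R]_m, orthonormal_frame (g x) e ->
  second_fund_norm2 gM gN h x e
    <= kappa ^+ 2 * sigma / (kappa ^+ 4 - 1) * tr_s gM gN h x e.

Let Vhx : V (h x). Proof. exact: hUV. Qed.

(** Normality tested on u = a gives |a|^2 = -g_N(b, dh a); by Cauchy-Schwarz |a|^4 <= |b|^2 |dh a|^2
    <= c |b|^2 |a|^2. *)
Lemma normal_form_le (a : 'rV[R]_m) (b : 'rV[R]_n) :
  (forall u, bform (gM x) a u + bform (gN (h x)) b ('D_u h x) = 0) ->
  bform (gM x) a a <= c * bform (gN (h x)) b b.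
Proof.
move=> N; have aa := posdef_ge0 a (gMpos Ux); have bb := posdef_ge0 b (gNpos Vhx).
have := bform_CauchySchwarz b ('D_a h x) (gNsym Vhx) (gNpos Vhx).
have := c_psd a Ux; have := N a.
move: (bform (gM x) a a) (bform (gN (h x)) b b) aa bb => s t s0 t0.
move: (bform (gN (h x)) b ('D_a h x)) (bform (gN (h x)) ('D_a h x) ('D_a h x)) => d q E Eq CS.
have {E}E : d = - s by apply/eqP; rewrite -subr_eq0 opprK addrC E.
move: CS; rewrite E sqrrN expr2 => CS.
have [->|sn0] := eqVneq s 0; first by rewrite mulr_ge0// ltW.
have sp : 0 < s by rewrite lt_neqAle eq_sym sn0.
rewrite -(ler_pM2r sp); apply: le_trans CS _.
rewrite (mulrC c) -mulrA ler_wpM2l//; lra.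
Qed.

Lemma second_fund_norm2_split e : second_fund_norm2 gM gN h x e =
  \sum_i \sum_j (bform (gM x) (AM (e i) (e j) x) (AM (e i) (e j) x)
               + bform (gN (h x)) (AN (e i) (e j) x) (AN (e i) (e j) x)).
Proof.
apply: eq_bigr => i _; apply: eq_bigr => j _.
rewrite (second_fund_split oU oV hUV gMs gNs hs gMpos gNpos _ _ Ux).
by rewrite /prod_metric /graph_map row_mxKl row_mxKr bform_block.
Qed.

Lemma null_vector_estimate v (e : 'I_m -> 'rV[R]_m) : orthonormal_frame (g x) e ->
  bform (gM x) v v = 1 -> bform (gN (h x)) ('D_v h x) ('D_v h x) = c ->
  0 <= (c - 1) * \sum_k (bform (gM x) (AM (e k) v x) (AM (e k) v x)
                + bform (gN (h x)) (AN (e k) v x) (AN (e k) v x))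
       - sigma * c * (tr_s gM gN h x e + (c - 1) / (1 + c)).
Proof.
move=> eo v1 hv; have c_null : c * bform (gM x) v v = bform (gN (h x)) ('D_v h x) ('D_v h x).
  by rewrite v1 mulr1 hv.
have N w := null_vector_orthogonal hUV hs gMsym gNsym Ux c_psd c_null w.
have B := bochner_inequality oU oV hUV gMs gNs hs gMsym gNsym gMpos gNpos hmin Ux eo
  c_psd c_null.
(* [v] is an eigenvector, with eigenvalue [c], of the pulled-back form relative to [gM]. *)
have hr k : bform (gN (h x)) ('D_v h x) ('D_(e k) h x) = c * bform (gM x) v (e k).
  rewrite (bformC _ _ (gNsym Vhx)) (bformC v _ (gMsym Ux)).
  by apply/esym/eqP; rewrite -subr_eq0; apply/eqP; exact: N.
have gE u w := bform_graph_metric gM gN hs u w Ux.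
have K0 := @curvature_sum_le R m c sigma
  (fun k => bform (gM x) (e k) (e k))
  (fun k => bform (gN (h x)) ('D_(e k) h x) ('D_(e k) h x))
  (fun k => bform (gM x) v (e k))
  (fun k => bform (gM x) (riemann gM (cst (e k)) (cst v) (cst (e k)) x) v)
  (fun k => bform (gN (h x)) (riemann gN (cst ('D_(e k) h x)) (cst ('D_v h x))
                                (cst ('D_(e k) h x)) (h x)) ('D_v h x)) c_gt0.
have K1 k : sigma * (bform (gM x) (e k) (e k) - bform (gM x) v (e k) ^+ 2) <=
    - bform (gM x) (riemann gM (cst (e k)) (cst v) (cst (e k)) x) v.
  rewrite (riemann_cst_swap gMs gMpos _ _ Ux) opprK.
  have := sectional_ge oU gMs gMsym gMpos Ux (@secM v (e k)).
  by rewrite /area v1 mul1r.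
have K2 k : - bform (gN (h x)) (riemann gN (cst ('D_(e k) h x)) (cst ('D_v h x))
       (cst ('D_(e k) h x)) (h x)) ('D_v h x) <=
    sigma * (c * bform (gN (h x)) ('D_(e k) h x) ('D_(e k) h x)
             - (c * bform (gM x) v (e k)) ^+ 2).
  rewrite (riemann_cst_swap gNs gNpos _ _ Vhx) opprK.
  have E : area (gN (h x)) ('D_v h x) ('D_(e k) h x) =
      c * bform (gN (h x)) ('D_(e k) h x) ('D_(e k) h x)
      - (c * bform (gM x) v (e k)) ^+ 2.
    exact: (f_equal2 (fun p q => p * _ - q ^+ 2) hv (hr k)).
  have S := sectional_le oV gNs gNsym gNpos Vhx (@secN ('D_v h x) ('D_(e k) h x)).
  exact: (eq_ind _ (fun a => _ <= sigma * a) S _ E).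
(* Parseval for g, where g(v, e_k) = (1 + c) g_M(v, e_k) and g(v, v) = 1 + c. *)
have K3 : \sum_k bform (gM x) v (e k) ^+ 2 = (1 + c)^-1.
  have P := orthonormal_frame_parseval eo v v.
  have E k : bform (g x) v (e k) = (1 + c) * bform (gM x) v (e k).
    by rewrite gE hr mulrDl mul1r.
  have c1 : 1 + c != 0 by rewrite gt_eqF// addr_gt0.
  apply: (mulfI (mulf_neq0 c1 c1)); rewrite mulfK// mulr_sumr.
  rewrite -[X in _ = X + _]v1 -[X in _ = _ + X]hv -gE P.
  apply: eq_bigr => k _; rewrite (E k); ring.
have trE : tr_s gM gN h x e = \sum_k (bform (gM x) (e k) (e k)
    - bform (gN (h x)) ('D_(e k) h x) ('D_(e k) h x)).
  apply: eq_bigr => k _; rewrite bform_subm.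
  exact: (congr1 (fun r => _ - r) (bform_pullback _ _ _ (smooth_mx_differentiable hs Ux))).
have K := K0 K1 K2 K3.
have A k : c * bform (gM x) (AM (e k) v x) (AM (e k) v x)
       - bform (gN (h x)) (AN (e k) v x) (AN (e k) v x) <=
    (c - 1) * (bform (gM x) (AM (e k) v x) (AM (e k) v x)
       + bform (gN (h x)) (AN (e k) v x) (AN (e k) v x)).
  have := normal_form_le (fun u => second_fund_normal oU oV hUV gMs gNs hs gMsym gNsym
    gMpos gNpos (e k) v u Ux).
  exact: scale_difference_le.
have SA := ler_sum (index_enum 'I_m) (P := xpredT) (fun k _ => A k).
rewrite trE mulr_sumr; exact: le_trans B (lerD SA K).
Qed.

Lemma kernel_vector : exists2 w : 'rV[R]_m, w != 0 & 'D_w h x = 0.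
Proof.
pose J : 'M[R]_(m, n) := \matrix_i 'D_(basisv R i) h x.
have /rowV0Pn[w /sub_kermxP wJ w0] : kermx J != 0.
  by rewrite kermx_eq0 /row_free neq_ltn (leq_ltn_trans (rank_leq_col J)).
exists w => //; rewrite -wJ (derive_basis_sum w (smooth_mx_differentiable hs Ux)).
by rewrite mulmx_sum_row; apply: eq_bigr => i _; rewrite rowK.
Qed.

(** If dh w = 0, then c g_M(w, v) = g_N(dh w, dh v) = 0, so [v] is orthogonal to the kernel for g_M
    and hence for g. Both vectors can therefore be normalized and completed to a frame. *)
Lemma adapted_frame v : bform (gM x) v v = 1 ->
  bform (gN (h x)) ('D_v h x) ('D_v h x) = c ->
  exists e, [/\ orthonormal_frame (g x) e,
    e (Ordinal (ltnW m_gt1)) = (Num.sqrt (1 + c))^-1 *: v &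
    'D_(e (Ordinal m_gt1)) h x = 0].
Proof.
move=> v1 hv; have c_null : c * bform (gM x) v v = bform (gN (h x)) ('D_v h x) ('D_v h x).
  by rewrite v1 mulr1 hv.
have [w w0 hw] := kernel_vector.
have gE u w := bform_graph_metric gM gN hs u w Ux.
have gsym := graph_metric_sym hUV gMsym gNsym Ux.
have gpos := graph_metric_posdef hUV hs gMpos gNpos Ux.
have gvw : bform (g x) v w = 0.
  have N := null_vector_orthogonal hUV hs gMsym gNsym Ux c_psd c_null w.
  rewrite hw bform0l subr0 in N; rewrite gE hw bform0r addr0 (bformC _ _ (gMsym Ux)).
  by move: N => /eqP; rewrite mulf_eq0 gt_eqF//= => /eqP.
have gvv : bform (g x) v v = 1 + c by rewrite gE v1 hv.
have gww := gpos w w0.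
pose F (i : nat) := if i == 0%N then (Num.sqrt (1 + c))^-1 *: v
                    else (Num.sqrt (bform (g x) w w))^-1 *: w.
have Fo i j : (i < 2)%N -> (j < 2)%N -> bform (g x) (F i) (F j) = (i == j)%:R.
  case: i j => [|[|//]] [|[|//]] _ _; rewrite /F /= bformZl bformZr.
  - by rewrite gvv mulrA -invfM -expr2 sqr_sqrtr ?mulVf ?gt_eqF ?addr_ge0 ?addr_gt0// ltW.
  - by rewrite gvw !mulr0.
  - by rewrite (bformC _ _ gsym) gvw !mulr0.
  - by rewrite mulrA -invfM -expr2 sqr_sqrtr ?mulVf ?gt_eqF// ltW.
have [e eo eF] := orthonormal_extension gsym gpos (subnKC m_gt1) Fo.
exists e; split=> //; first exact: eF.
rewrite (eF (Ordinal m_gt1))// /F /=.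
by rewrite (derive_dirZ hs _ _ Ux) hw scaler0.
Qed.

Lemma no_unit_null_vector v : bform (gM x) v v = 1 ->
  bform (gN (h x)) ('D_v h x) ('D_v h x) = c -> False.
Proof.
move=> v1 hv; have [e [eo e0 e1]] := adapted_frame v1 hv.
set i0 := Ordinal _ in e0; set i1 := Ordinal _ in e1.
have E := null_vector_estimate eo v1 hv.
have gE u w := bform_graph_metric gM gN hs u w Ux.
set T := tr_s gM gN h x e in E.
set S := \sum_k _ in E.
have S0 : 0 <= S.
  apply: sumr_ge0 => k _; apply: addr_ge0; first exact/posdef_ge0/gMpos.
  exact/posdef_ge0/gNpos.
have sc : 0 < sigma * c by rewrite mulr_gt0.
have c1 : 0 < 1 + c by rewrite addr_gt0.
have [c_le1|c_gt1] := leP c 1.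
  (* [e i0], along [v], contributes -(c - 1)/(1 + c) and [e i1], in the kernel, contributes 1; the
     other terms are nonnegative because c <= 1. *)
  have T1 : 1 - (c - 1) / (1 + c) <= T.
    have sE u : bform (s_tensor gM gN h x) u u =
        bform (gM x) u u - bform (gN (h x)) ('D_u h x) ('D_u h x).
      rewrite bform_subm; apply: (congr1 (fun r => _ - r)).
      exact: (bform_pullback _ _ _ (smooth_mx_differentiable hs Ux)).
    have s_ge0 u : 0 <= bform (s_tensor gM gN h x) u u.
      rewrite sE subr_ge0; have := c_psd u Ux; have := posdef_ge0 u (gMpos Ux).
      move: (bform _ _ _) (bform _ _ _) => q p p0.
      have : c * p <= 1 * p by rewrite ler_wpM2r.
      lra.
    have s0 : bform (s_tensor gM gN h x) (e i0) (e i0) = - ((c - 1) / (1 + c)).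
      rewrite sE e0 (derive_dirZ hs _ _ Ux) !(bformZl, bformZr) v1 hv.
      by rewrite mulr1 mulrA -invfM -expr2 sqr_sqrtr ?ltW//; field; rewrite gt_eqF.
    have s1 : bform (s_tensor gM gN h x) (e i1) (e i1) = 1.
      have := gE (e i1) (e i1); rewrite eo eqxx e1 bform0l addr0 => E1.
      by rewrite sE e1 bform0l subr0 -E1.
    rewrite /T /tr_s (bigD1 i0)//= (bigD1 i1)//= s0 s1.
    have : 0 <= \sum_(i < m | (i != i0) && (i != i1)) bform (s_tensor gM gN h x) (e i) (e i).
      by apply: sumr_ge0 => i _.
    lra.
  have : (c - 1) * S <= 0 by rewrite mulr_le0_ge0// subr_le0.
  have : sigma * c * 1 <= sigma * c * (T + (c - 1) / (1 + c)) by rewrite ler_pM2l//; lra.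
  lra.
have A := A_bound eo; rewrite second_fund_norm2_split -/T in A.
(* As v = sqrt(1 + c) e_0, [S] is 1 + c times the sum of the |A(e_k, e_0)|^2, which is part of the
   full norm. *)
have SA : S <= (1 + c) * (kappa ^+ 2 * sigma / (kappa ^+ 4 - 1) * T).
  have vE : v = Num.sqrt (1 + c) *: e i0.
    by rewrite e0 scalerA mulfV ?scale1r// gt_eqF// sqrtr_gt0.
  have gs := graph_metric_smooth oU hUV gMs gNs hs.
  have gsy y := graph_metric_sym hUV gMsym gNsym (x := y).
  have gun y (Uy : U y) := posdef_unitmx (graph_metric_posdef hUV hs gMpos gNpos Uy).
  have gMu y (Uy : U y) := posdef_unitmx (gMpos Uy).
  have gNu y (Vy : V y) := posdef_unitmx (gNpos Vy).
  have BM := sff_bilin oU oU (fun y Uy => Uy) gMs (@smooth_mx_id R m U) gMsym gMu gs gsy gun Ux.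
  have BN := sff_bilin oU oV hUV gNs hs gNsym gNu gs gsy gun Ux.
  apply: le_trans (ler_wpM2l (ltW c1) A); rewrite mulr_sumr; apply: ler_sum => k _.
  have EM : AM (e k) v x = Num.sqrt (1 + c) *: AM (e k) (e i0) x.
    by rewrite vE; exact: (bilinZr BM).
  have EN : AN (e k) v x = Num.sqrt (1 + c) *: AN (e k) (e i0) x.
    by rewrite vE; exact: (bilinZr BN).
  have Q j : 0 <= bform (gM x) (AM (e k) (e j) x) (AM (e k) (e j) x)
      + bform (gN (h x)) (AN (e k) (e j) x) (AN (e k) (e j) x).
    by apply: addr_ge0; [exact/posdef_ge0/gMpos|exact/posdef_ge0/gNpos].
  rewrite EM EN (bigD1 i0)//=.
  have : 0 <= \sum_(j < m | j != i0) (bform (gM x) (AM (e k) (e j) x) (AM (e k) (e j) x)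
      + bform (gN (h x)) (AN (e k) (e j) x) (AN (e k) (e j) x)) by exact: sumr_ge0.
  move: (\sum_(j < m | _) _) (AM _ _ _) (AN _ _ _) => r a b r0.
  rewrite !(bformZl, bformZr); move: (bform _ a a) (bform _ b b) => p q.
  have -> : Num.sqrt (1 + c) * (Num.sqrt (1 + c) * p)
      + Num.sqrt (1 + c) * (Num.sqrt (1 + c) * q) = Num.sqrt (1 + c) ^+ 2 * (p + q) by ring.
  by rewrite sqr_sqrtr ?(ltW c1)// ler_pM2l// lerDl.
have k4 : 0 < kappa ^+ 4 - 1 by rewrite subr_gt0 (exprM kappa 2 2) exprn_egt1.
have K0 : 0 < kappa ^+ 2 * sigma / (kappa ^+ 4 - 1).
  exact: divr_gt0 (mulr_gt0 (lt_trans ltr01 kappa_gt1) sigma_gt0) k4.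
(* The assumed bound forces this: a positive multiple of tr s dominates a sum of squares. *)
have T0 : 0 <= T.
  by have := le_trans S0 SA; rewrite pmulr_rge0// pmulr_rge0.
(* Here c <= kappa^2 enters, through the factorization of c (kappa^4 - 1) - (c^2 - 1) kappa^2. *)
have KT : (c - 1) * (1 + c) * (kappa ^+ 2 * sigma / (kappa ^+ 4 - 1)) <= sigma * c.
  have k0 : kappa ^+ 4 - 1 != 0 by rewrite gt_eqF.
  rewrite -(ler_pM2r k4) !mulrA mulfVK//.
  rewrite -subr_ge0 (_ : _ - _ = sigma * ((c * kappa ^+ 2 + 1) * (kappa ^+ 2 - c))).
    apply: mulr_ge0 (ltW sigma_gt0) _; apply: mulr_ge0; last by rewrite subr_ge0.
    by apply: addr_ge0 => //; apply: mulr_ge0 (ltW c_gt0) (sqr_ge0 _).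
  ring.
have cS : (c - 1) * S <= sigma * c * T.
  have c10 : 0 <= c - 1 by rewrite subr_ge0 ltW.
  apply: le_trans (ler_wpM2l c10 SA) _.
  by have := ler_wpM2r T0 KT; rewrite -!mulrA.
(* This strictly positive remainder contradicts [E], since [cS] already bounds the first term by the
   trace term. *)
have : 0 < sigma * c * ((c - 1) / (1 + c)) by rewrite mulr_gt0// divr_gt0// subr_gt0.
lra.
Qed.

Lemma no_null_vector v : v != 0 ->
  c * bform (gM x) v v = bform (gN (h x)) ('D_v h x) ('D_v h x) -> False.
Proof.
move=> v0 vn; have vv := gMpos Ux v0.
pose a := (Num.sqrt (bform (gM x) v v))^-1.
have aa : a * (a * bform (gM x) v v) = 1.
  by rewrite mulrA -invfM -expr2 sqr_sqrtr ?mulVf ?gt_eqF// ltW.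
apply: (@no_unit_null_vector (a *: v)); first by rewrite bformZl bformZr.
rewrite (derive_dirZ hs _ _ Ux) bformZl bformZr -vn -[RHS]mulr1 -aa; ring.
Qed.

End local_rigidity.

(** * From charts to manifolds *)

(** Positivity on the compact unit sphere is stable under small changes of the parameter, and
    homogeneity extends it to all nonzero vectors. The parameter space is arbitrary so that it can
    be a product of M with the real line. *)
Lemma posdef_near (R : realType) (n : nat) (T : topologicalType)
    (G : T -> 'M[R]_n) (t0 : T) :
  (forall i j, {for t0, continuous (fun t => G t i j)}) -> posdef (G t0) ->
  \forall t \near t0, posdef (G t).
Proof.
move=> Gc G0; pose K := [set v : 'rV[R]_n | `|v| = 1].
have Kcpt : compact K.
  apply: bounded_closed_compact.
    by exists 1; split=> // r r1 v /= ->; exact: ltW.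
  have -> : K = (fun v : 'rV[R]_n => `|v|) @^-1` [set 1] by [].
  apply: closed_comp => [v _|]; last exact: closed_eq.
  exact: norm_continuous.
have cov := (compact_near_coveringP K).1 Kcpt T (nbhs t0)
  (fun t v => 0 < bform (G t) v v) _.
have : \near t0, K `<=` (fun v => 0 < bform (G t0) v v).
  apply: cov => v /= v1.
  have v0 : v != 0 by rewrite -normr_eq0 v1 oner_eq0.
  have pos := G0 v v0.
  (* Written out in entries, the form is visibly continuous in the vector and the parameter
     jointly. *)
  pose phi (z : 'rV[R]_n * T) : R := \sum_i \sum_j z.1 0 i * z.1 0 j * G z.2 i j.
  have phiE v' t : phi (v', t) = bform (G t) v' v'.
    rewrite [in RHS](rV_basis_sum v') bform_sum_sum.
    by apply: eq_bigr => i _; apply: eq_bigr => j _; rewrite bform_basis.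
  have phic : phi z @[z --> (v, t0)] --> phi (v, t0).
    apply: cvg_big => [|i _]; first exact: add_continuous.
    apply: cvg_big => [|j _]; first exact: add_continuous.
    apply: cvgM; last first.
      apply: (cvg_comp snd (fun t => G t i j)); first exact: (@cvg_snd _ _ (nbhs v) (nbhs t0) _).
      exact: Gc.
    by apply: cvgM; apply: (cvg_comp fst (fun v : 'rV[R]_n => v 0 _));
      [exact: (@cvg_fst _ _ (nbhs v) (nbhs t0) _)|exact: coord_continuous
      |exact: (@cvg_fst _ _ (nbhs v) (nbhs t0) _)|exact: coord_continuous].
  have nP : nbhs (phi (v, t0)) [set r : R | 0 < r].
    by apply: open_nbhs_nbhs; split; [exact: open_gt|rewrite /= phiE].
  have phi_gt0 : nbhs (v, t0) [set z | 0 < phi z] by exact: (phic _ nP).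
  apply: (@filterS _ (nbhs (v, t0)) _ _ _ _ phi_gt0) => -[v' t] /=.
  by rewrite phiE.
apply: filterS => t Kt w w0.
have w1 : K (`|w|^-1 *: w).
  by rewrite /K /= normrZ normfV normr_id mulVf// normr_eq0.
have := Kt _ w1; rewrite bformZl bformZr mulrA pmulr_rgt0//.
by rewrite mulr_gt0// invr_gt0 normr_gt0.
Qed.

Section charts.
Context {R : realType} {n : nat} {T : topologicalType}.
Variable c : chart R n T.

Lemma chart_fun_cts p : chart_dom c p -> {for p, continuous (chart_fun c)}.
Proof.
move=> cp; have := @chart_fun_continuous _ _ _ c.
rewrite continuous_open_subspace; last exact: chart_dom_open.
by apply; rewrite inE.
Qed.

Lemma chart_inv_cts x : chart_cod c x -> {for x, continuous (chart_inv c)}.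
Proof.
move=> cx; have := @chart_inv_continuous _ _ _ c.
rewrite continuous_open_subspace; last exact: chart_cod_open.
by apply; rewrite inE.
Qed.

End charts.

Lemma open_loc_dom (R : realType) (m n : nat) (S T : topologicalType) (f : S -> T)
    (c : chart R m S) (d : chart R n T) : continuous f -> open (loc_dom f c d).
Proof.
move=> fc; rewrite openE => x [cx dx] /=.
have nx : nbhs x (chart_cod c).
  by apply: open_nbhs_nbhs; split=> //; exact: chart_cod_open.
have fic : {for x, continuous (f \o chart_inv c)}.
  by apply: continuous_comp; [exact: chart_inv_cts|exact: fc].
have nd : nbhs (f (chart_inv c x)) (chart_dom d).
  by apply: open_nbhs_nbhs; split=> //; exact: chart_dom_open.
exact: filterI nx (fic _ nd).
Qed.

Lemma loc_rep_cod (R : realType) (m n : nat) (S T : topologicalType) (f : S -> T)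
    (c : chart R m S) (d : chart R n T) x :
  loc_dom f c d x -> chart_cod d (loc_rep f c d x).
Proof. by move=> [_ /chart_funP[]]. Qed.

Lemma loc_dom_chart (R : realType) (m n : nat) (S T : topologicalType) (f : S -> T)
    (c : chart R m S) (d : chart R n T) p :
  chart_dom c p -> chart_dom d (f p) -> loc_dom f c d (chart_fun c p).
Proof. by move=> cp dp; have [? E] := chart_funP cp; split=> //; rewrite E. Qed.

Lemma locally_constant (R : realType) (m n : nat) (U : set 'rV[R]_m)
    (h : 'rV[R]_m -> 'rV[R]_n) (x : 'rV[R]_m) :
  open U -> smooth_mx U h -> (forall y w, U y -> 'D_w h y = 0) -> U x ->
  \forall y \near x, h y = h x.
Proof.
move=> oU hs h0 Ux; have /nbhs_ballP[r /= r0 rU] : nbhs x U by exact: open_nbhs_nbhs.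
have : nbhs x (ball x r) by exact: nbhsx_ballx.
apply: filterS => y xy; apply/rowP => k.
have seg (s : R) : `|s| <= `|1 : R| -> U (s *: (y - x) + x).
  rewrite normr1 => s1; apply: rU; move: xy; rewrite -!ball_normE /= distrC => xy.
  rewrite distrC addrK normrZ; apply: le_lt_trans xy.
  by rewrite ler_piMl.
have [s /seg Us|s /seg Us] := @mean_value_line R m (fun z => h z 0 k) x (y - x) 1.
  exact: diff_derivable (smooth_differentiable (hs 0 k) Us).
rewrite scale1r subrK -(derive_entry _ 0 k hs Us) h0// mxE mulr0.
by move/eqP; rewrite subr_eq0 => /eqP.
Qed.

Lemma locally_constant_connected (S : topologicalType) (T : Type) (f : S -> T) :
  connected [set: S] -> (forall p, \forall q \near p, f q = f p) ->
  forall p q, f p = f q.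
Proof.
move=> Sc loc p q; pose B := [set r | f r = f p].
have oB : open B.
  rewrite openE => r Br /=; have := loc r; apply: filterS => s.
  by rewrite /B /= => ->.
have cB : closed B.
  rewrite -[B]setCK; apply: open_closedC; rewrite openE => r Br /=.
  by have := loc r; apply: filterS => s sr sp; apply: Br; rewrite /B /= -sr.
have BT : B = setT.
  apply: Sc; first by exists p.
  - by exists B => //; rewrite setTI.
  - by exists B => //; rewrite setTI.
by have : B q by [rewrite BT]; rewrite /B /= => ->.
Qed.

Lemma idfun_continuous (T : topologicalType) : continuous (@idfun T).
Proof. by move=> x A. Qed.

Section stretch.
Context {R : realType} {m n : nat} (M : riemannian R m) (N : riemannian R n).
Variable f : M -> N.
Hypothesis f_smooth : smooth_map f.

Let fc : continuous f. Proof. exact: f_smooth.1. Qed.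

Lemma loc_rep_smooth c d : atlas c -> atlas d ->
  smooth_mx (loc_dom f c d) (loc_rep f c d).
Proof.
move=> ac ad; apply: smooth_on_smooth_mx; first exact: open_loc_dom.
exact: f_smooth.2.
Qed.

Lemma transition_smooth (k : nat) (X : manifold R k) (c d : chart R k X) :
  atlas c -> atlas d -> smooth_mx (loc_dom idfun c d) (loc_rep idfun c d).
Proof.
move=> ac ad; apply: smooth_on_smooth_mx; first exact/open_loc_dom/idfun_continuous.
exact: atlas_smooth.
Qed.

Lemma metric_smooth_mx (k : nat) (X : riemannian R k) (c : chart R k X) :
  atlas c -> smooth_mx (chart_cod c) (metric c).
Proof.
by move=> ac; apply: smooth_on_smooth_mx; [exact: chart_cod_open|exact: metric_smooth].
Qed.

(* (t g_M - f^* g_N)(w, w) in the charts c, d. *)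
Definition stretch (t : R) (c : chart R m M) (d : chart R n N) (x w : 'rV[R]_m) : R :=
  t * bform (metric c x) w w - bform (metric d (loc_rep f c d x))
    ('D_w (loc_rep f c d) x) ('D_w (loc_rep f c d) x).

Lemma stretchE t c d x w : atlas c -> atlas d -> loc_dom f c d x ->
  bform (t *: metric c x - pullback (loc_rep f c d) (metric d) x) w w =
  stretch t c d x w.
Proof.
move=> ac ad xcd; rewrite bform_subm bform_scalem.
have hd := smooth_mx_differentiable (loc_rep_smooth ac ad) xcd.
exact: (congr1 (fun r => _ - r) (bform_pullback (metric d) w w hd)).
Qed.

(** Near [x] the expression of [f] in (c2, d2) is its expression in (c1, d1) between two transition
    maps; the chain rule and [metric_change] on both sides do the rest. *)
Lemma stretch_change t c1 d1 c2 d2 x w : atlas c1 -> atlas d1 -> atlas c2 -> atlas d2 ->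
  loc_dom f c2 d2 x -> loc_dom idfun c2 c1 x -> loc_dom f c2 d1 x ->
  stretch t c2 d2 x w =
  stretch t c1 d1 (loc_rep idfun c2 c1 x) ('D_w (loc_rep idfun c2 c1) x).
Proof.
move=> ac1 ad1 ac2 ad2 xf xi xf1.
set tau := loc_rep idfun c2 c1; pose sigma := loc_rep idfun d1 d2.
pose h1 := loc_rep f c1 d1.
have tauE y : loc_dom idfun c2 c1 y -> chart_inv c1 (tau y) = chart_inv c2 y.
  by move=> [_ /chart_funP[]].
have h1E y : loc_dom idfun c2 c1 y -> h1 (tau y) = chart_fun d1 (f (chart_inv c2 y)).
  by move=> yi; rewrite /h1 /loc_rep tauE.
have d1E y : loc_dom f c2 d1 y ->
    chart_inv d1 (chart_fun d1 (f (chart_inv c2 y))) = f (chart_inv c2 y).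
  by move=> [_ /chart_funP[]].
have x1 : loc_dom f c1 d1 (tau x).
  by split; [exact: loc_rep_cod xi|rewrite tauE//; case: xf1].
have y1 : loc_dom idfun d1 d2 (h1 (tau x)).
  split; first exact: loc_rep_cod x1.
  by rewrite h1E// d1E//; case: xf.
have td := smooth_mx_differentiable (transition_smooth ac2 ac1) xi.
have hd := smooth_mx_differentiable (loc_rep_smooth ac1 ad1) x1.
have sd := smooth_mx_differentiable (transition_smooth ad1 ad2) y1.
have comp y : (loc_dom f c2 d1 `&` loc_dom idfun c2 c1) y ->
    loc_rep f c2 d2 y = sigma (h1 (tau y)).
  by move=> [yf1 yi]; rewrite h1E// /sigma /loc_rep /= d1E.
have oU : open (loc_dom f c2 d1 `&` loc_dom idfun c2 c1).
  by apply: openI; apply: open_loc_dom => //; exact: idfun_continuous.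
have D1 := derive_comp (g := tau) (f := h1) w hd td.
have D : 'D_w (loc_rep f c2 d2) x = 'D_('D_('D_w tau x) h1 (tau x)) sigma (h1 (tau x)).
  apply: etrans (derive_open_eq w oU comp (conj xf1 xi)) _.
  have h1td : differentiable (fun y => h1 (tau y)) x by exact: differentiable_comp td hd.
  have [_ E] := derive_comp (g := fun y => h1 (tau y)) (f := sigma) w sd h1td.
  have [_ E1] := D1; apply: (etrans E); exact: (congr1 (fun u => 'D_u sigma (h1 (tau x))) E1).
set a := 'D_('D_w tau x) h1 (tau x).
have EM := etrans (congr1 (fun G => bform G w w) (metric_change ac2 ac1 xi))
  (bform_pullback (metric c1) w w td).
have EN1 := etrans (congr1 (fun G => bform G a a) (metric_change ad1 ad2 y1))
  (bform_pullback (metric d2) a a sd).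
have EN : bform (metric d2 (loc_rep f c2 d2 x)) ('D_w (loc_rep f c2 d2) x)
    ('D_w (loc_rep f c2 d2) x) = bform (metric d1 (h1 (tau x))) a a.
  apply: etrans (esym EN1).
  exact: (f_equal2 (fun z u => bform (metric d2 z) u u) (comp x (conj xf1 xi)) D).
exact: (f_equal2 (fun p q => t * p - q) EM EN).
Qed.

(** Requiring a single pair of charts makes openness a local question in fixed coordinates;
    [stretch_change] passes to other pairs. *)
Definition posdef_at (t : R) (p : M) : Prop :=
  exists c d, [/\ atlas c, atlas d, chart_dom c p, chart_dom d (f p) &
    forall w, w != 0 -> 0 < stretch t c d (chart_fun c p) w].

(** Openness in the point and the parameter jointly is the form in which compactness of M can make
    it uniform in the point. *)
Lemma posdef_at_near t p : posdef_at t p ->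
  \forall q \near p & s \near t, posdef_at s q.
Proof.
move=> [c [d [ac ad cp dp pos]]]; have xcd := loc_dom_chart cp dp.
pose G (z : M * R) := z.2 *: metric c (chart_fun c z.1)
  - pullback (loc_rep f c d) (metric d) (chart_fun c z.1).
have smG : smooth_mx (loc_dom f c d) (pullback (loc_rep f c d) (metric d)).
  move=> i j; have oU := @open_loc_dom _ _ _ _ _ f c d fc.
  have es := energy_smooth oU (fun y => @loc_rep_cod _ _ _ _ _ f c d y)
    (metric_smooth_mx ad) (loc_rep_smooth ac ad) (basisv R i) (basisv R j).
  by apply: smooth_eq oU _ es => y _; rewrite mxE.
have chc : {for (p, t), continuous (fun z : M * R => chart_fun c z.1)}.
  apply: (continuous_comp (f := fst) (g := chart_fun c)).
    exact: (@cvg_fst _ _ (nbhs p) (nbhs t) _).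
  exact: chart_fun_cts.
have nG : nbhs (p, t) [set z | posdef (G z)].
  apply: (@posdef_near R m (M * R)%type G (p, t)) => [i j|w w0]; last first.
    by rewrite /G /= stretchE//; exact: pos.
  have -> : (fun z => G z i j) = (fun z => z.2 * metric c (chart_fun c z.1) i j
      - pullback (loc_rep f c d) (metric d) (chart_fun c z.1) i j).
    by apply/funext => z; rewrite !mxE.
  have g1 : {for chart_fun c p, continuous (fun y => metric c y i j)}.
    apply: differentiable_continuous.
    by apply: (smooth_differentiable (metric_smooth_mx ac i j)); case: xcd.
  have g2 : {for chart_fun c p, continuous
      (fun y => pullback (loc_rep f c d) (metric d) y i j)}.
    by apply: differentiable_continuous; exact: (smooth_differentiable (smG i j)).
  have k1 : {for (p, t), continuous (fun z : M * R => metric c (chart_fun c z.1) i j)}.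
    exact: (continuous_comp chc g1).
  have k2 : {for (p, t), continuous (fun z : M * R =>
      pullback (loc_rep f c d) (metric d) (chart_fun c z.1) i j)}.
    exact: (continuous_comp chc g2).
  have k0 : {for (p, t), continuous (fun z : M * R => z.2)}.
    exact: (@cvg_snd _ _ (nbhs p) (nbhs t) _).
  exact: (continuousB (continuousM k0 k1) k2).
have nc : nbhs p [set q | chart_dom c q /\ chart_dom d (f q)].
  apply: filterI.
    by apply: open_nbhs_nbhs; split=> //; exact: chart_dom_open.
  have nd : nbhs (f p) (chart_dom d).
    by apply: open_nbhs_nbhs; split=> //; exact: chart_dom_open.
  exact: (fc nd).
have nc' : nbhs (p, t) [set z | chart_dom c z.1 /\ chart_dom d (f z.1)].
  exact: (@cvg_fst _ _ (nbhs p) (nbhs t) _ _ nc).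
apply: (@filterS _ (nbhs (p, t)) _ _ _ _ (filterI nG nc')) => -[q s] /= [Gq [cq dq]].
exists c, d; split=> // w w0; rewrite -stretchE//; last exact: loc_dom_chart.
exact: Gq.
Qed.

Lemma posdef_at_compact t : compact [set: M] -> (forall p, posdef_at t p) ->
  \forall s \near t, forall p, posdef_at s p.
Proof.
move=> Mc pt; have H := (compact_near_coveringP _).1 Mc R (nbhs t) posdef_at (nbhs_filter t)
  (fun p _ => posdef_at_near (pt p)).
by apply: filterS H => s Hs p; exact: Hs.
Qed.

Lemma posdef_at_stretch_ge0 t c d x w : atlas c -> atlas d -> loc_dom f c d x ->
  posdef_at t (chart_inv c x) -> 0 <= stretch t c d x w.
Proof.
move=> ac ad xcd [c1 [d1 [ac1 ad1 c1p d1p pos]]].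
have xi : loc_dom idfun c c1 x by case: xcd.
have xf : loc_dom f c d1 x by case: xcd.
rewrite (stretch_change t w ac1 ad1 ac ad xcd xi xf).
(* Only a weak inequality is claimed, so a vector killed by the transition map is harmless and
   injectivity of its differential need not be shown. *)
have [->|w0] := eqVneq ('D_w (loc_rep idfun c c1) x) 0.
  by rewrite /stretch derive0 !bform0l mulr0 subr0.
exact/ltW/pos.
Qed.

End stretch.

(** * The critical value and the conclusion *)

Section critical_value.
Context {R : realType} {m n : nat} (M : riemannian R m) (N : riemannian R n).
Variable f : M -> N.
Hypothesis f_smooth : smooth_map f.
Hypotheses (M_compact : compact [set: M]) (m_gt0 : (0 < m)%N).

Lemma posdef_at_gt0 t p : posdef_at f t p -> 0 < t.
Proof.
move=> [c [d [ac ad cp dp pos]]]; have [xc xd] := loc_dom_chart cp dp.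
have [hx _] := chart_funP dp.
pose w : 'rV[R]_m := const_mx 1.
have w0 : w != 0.
  apply/eqP => /rowP/(_ (Ordinal m_gt0)); rewrite !mxE => /eqP; exact/negP/oner_neq0.
have := pos w w0; rewrite /stretch.
have := metric_posdef ac xc w0.
have : 0 <= bform (metric d (loc_rep f c d (chart_fun c p)))
    ('D_w (loc_rep f c d) (chart_fun c p)) ('D_w (loc_rep f c d) (chart_fun c p)).
  by apply/posdef_ge0/metric_posdef => //; exact: loc_rep_cod.
move: (bform _ _ _) (bform _ w w) => a b a0 b0 ab.
by rewrite -(pmulr_lgt0 t b0); lra.
Qed.

(** [c] is the infimum of the parameters that are positive definite everywhere. Semidefiniteness
    passes to the infimum; definiteness fails somewhere, since by compactness it would survive a
    small decrease of the parameter. *)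
Lemma critical_value (K : R) (p : M) : (forall q, posdef_at f K q) ->
  exists c, [/\ 0 <= c, c <= K,
    forall a b x w, atlas a -> atlas b -> loc_dom f a b x -> 0 <= stretch f c a b x w &
    exists q, ~ posdef_at f c q].
Proof.
move=> KS; pose S := [set t | forall q, posdef_at f t q].
have S0 : lbound S 0 by move=> t /(_ p) /posdef_at_gt0/ltW.
have hS : has_inf S by split; [exists K|exists 0].
exists (inf S); split.
- by apply: lb_le_inf => //; exists K.
- by apply: ge_inf => //; exists 0.
- move=> a b x w aa ab xab; rewrite leNgt; apply/negP => neg.
  have Gw : 0 <= bform (metric a x) w w.
    by apply/posdef_ge0/metric_posdef => //; case: xab.
  (* Chosen so that raising the parameter by at most [e] keeps the value negative; the added 1
     avoids a zero denominator when w = 0. *)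
  pose e := - stretch f (inf S) a b x w / (bform (metric a x) w w + 1).
  have e0 : 0 < e by rewrite divr_gt0 ?oppr_gt0// ltr_wpDl.
  have [s Ss se] := inf_adherent e0 hS.
  have H := posdef_at_stretch_ge0 f_smooth w aa ab xab (Ss (chart_inv a x)).
  have eE : e * (bform (metric a x) w w + 1) = - stretch f (inf S) a b x w.
    by rewrite divfK// gt_eqF// ltr_wpDl.
  move: H eE; rewrite /stretch; clearbody e.
  move: (bform (metric a x) w w) Gw => u u0; move: (bform _ _ _) => r H eE.
  have : (s - inf S) * u <= e * u by rewrite ler_wpM2r// lerBlDl ltW.
  move: (inf S) eE; clear -H e0 => c eE su; lra.
- apply: contrapT => /forallNP H.
  have Sinf q : posdef_at f (inf S) q by apply: contrapT; exact: H.
  have /nbhs_ballP[r /= r0 rS] := posdef_at_compact f_smooth M_compact Sinf.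
  (* A smaller parameter would still belong to [S]. *)
  have : S (inf S - r / 2).
    apply: rS; rewrite -ball_normE /= opprB addrC subrK gtr0_norm; lra.
  move=> /(ge_inf (ex_intro _ 0 S0)); lra.
Qed.

End critical_value.

(** At parameter 0 the form is minus the squared norm of df(w), so df = 0. *)
Lemma stretch0_constant (R : realType) (m n : nat) (M : riemannian R m)
    (N : riemannian R n) (f : M -> N) :
  connected [set: M] -> smooth_map f ->
  (forall c d x w, atlas c -> atlas d -> loc_dom f c d x -> 0 <= stretch f 0 c d x w) ->
  forall p q, f p = f q.
Proof.
move=> Mc fs H; apply: locally_constant_connected => // p.
have [c ac cp] := atlas_cover p; have [d ad dp] := atlas_cover (f p).
have xcd := loc_dom_chart cp dp.
have D0 y w : loc_dom f c d y -> 'D_w (loc_rep f c d) y = 0.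
  move=> ycd; apply/eqP; apply: contraT => D0.
  have yd := loc_rep_cod ycd; have := H c d y w ac ad ycd.
  by rewrite /stretch mul0r sub0r oppr_ge0 leNgt (metric_posdef ad yd D0).
have oU := @open_loc_dom _ _ _ _ _ f c d fs.1.
have L := locally_constant oU (loc_rep_smooth fs ac ad) D0 xcd.
have nc : nbhs p (chart_dom c).
  by apply: open_nbhs_nbhs; split=> //; exact: chart_dom_open.
have nd : nbhs p (f @^-1` chart_dom d).
  by apply: fs.1; apply: open_nbhs_nbhs; split=> //; exact: chart_dom_open.
have nL := chart_fun_cts cp L.
apply: filterS (filterI (filterI nc nd) nL) => q [[cq dq]].
rewrite /= /loc_rep (chart_funP cq).2 (chart_funP cp).2 => E.
by rewrite -(chart_funP dq).2 E (chart_funP dp).2.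
Qed.

Theorem corollary2 (R : realType) (m n : nat)
    (M : riemannian R m) (N : riemannian R n)
    (m_ge2 : (2 <= m)%N) (n_le : (2 * n <= m)%N)
    (M_connected : connected [set: M]) (M_compact : compact [set: M])
    (N_connected : connected [set: N])
    (sigma : R) (sigma_gt0 : 0 < sigma)
    (secN : sec_le N sigma) (secM : sec_ge M sigma)
    (f : M -> N) (f_smooth : smooth_map f) (f_minimal : minimal_map f)
    (kappa : R) (kappa_gt1 : 1 < kappa ^+ 2)
    (f_bound : in_charts f (fun gM gN h x =>
       posdef (kappa ^+ 2 *: gM x - pullback h gN x)))
    (A_bound : in_charts f (fun gM gN h x => forall e : 'I_m -> 'rV[R]_m,
       orthonormal_frame (graph_metric gM gN h x) e ->
       second_fund_norm2 gM gN h x e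
         <= kappa ^+ 2 * sigma / (kappa ^+ 4 - 1) * tr_s gM gN h x e)) :
  forall p q : M, f p = f q.
Proof.
move=> p q.
have m_gt0 : (0 < m)%N by exact: ltnW.
have n_lt_m : (n < m)%N.
  (* For n = 0 the claim is m > 0; otherwise n < 2 n <= m. *)
  case: n n_le {N N_connected secN f f_smooth f_minimal f_bound A_bound p q} => // k.
  by rewrite mul2n -addnn; apply: leq_trans; rewrite addnS ltnS leq_addr.
have kappa_posdef r : posdef_at f (kappa ^+ 2) r.
  have [c ac cr] := atlas_cover r; have [d ad dr] := atlas_cover (f r).
  exists c, d; split=> // w w0.
  have xcd := loc_dom_chart cr dr.
  by rewrite -stretchE//; exact: f_bound.
have [c [c0 c_le psd [r npos]]] := critical_value f_smooth M_compact m_gt0 p kappa_posdef.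
move: c0; rewrite le_eqVlt => /predU1P[c0|c_gt0].
  by apply: (stretch0_constant M_connected f_smooth _ p q); rewrite -c0 in psd.
have [a aa ar] := atlas_cover r; have [b ab br] := atlas_cover (f r).
have xab := loc_dom_chart ar br; have [xa _] := xab; have yb := loc_rep_cod xab.
(* Definiteness at [r] is derived after all, in the charts [a], [b]: the form is nonnegative there,
   and [no_null_vector] excludes the value zero. *)
exfalso; apply: npos; exists a, b; split=> // v v0.
rewrite lt_neqAle psd// andbT; apply/eqP => v_null.
have oU := @open_loc_dom _ _ _ _ _ f a b f_smooth.1.
have UM x : loc_dom f a b x -> chart_cod a x by case.
refine (no_null_vector oU (@chart_cod_open _ _ _ b) (@loc_rep_cod _ _ _ _ _ f a b)
  (smooth_mx_sub UM (metric_smooth_mx aa)) (metric_smooth_mx ab)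
  (loc_rep_smooth f_smooth aa ab)
  (fun x Ux => Defs.metric_sym aa (UM x Ux)) (fun y Vy => Defs.metric_sym ab Vy)
  (fun x Ux => metric_posdef aa (UM x Ux)) (fun y Vy => metric_posdef ab Vy)
  (fun x Ux => f_minimal a b x aa ab Ux) m_ge2 n_lt_m sigma_gt0 kappa_gt1 c_gt0 c_le xab
  (fun y w Uy => psd a b y w aa ab Uy) (fun u w => @secM a _ u w aa xa)
  (fun u w => @secN b _ u w ab yb) (A_bound a b _ aa ab xab) v0 _).
by apply/eqP; rewrite -subr_eq0; apply/eqP; exact: esym v_null.
Qed.
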